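(* For every $1\le p<2$ and $\beta>0$ there are $B=B(p,\beta)>0$ and $b=b(p,\beta)>0$ such that $$ n^{-\beta-B}\ \lesssim\ d_n^{\mathbb C}(\mathcal A_\beta,L_p(\mathbb T))\ \lesssim\ n^{-\beta-b} $$ for all positive integers $n$. Moreover, one may take $B=\alpha_p\min\{1,2\beta\}$ and $b=c(p)\min\{1,\beta\}$, where $\alpha_p:=\frac1p-\frac12$ and $c(p)>0$ depends only on $p$.
   Context: $\mathbb T=\mathbb R/\mathbb Z$ with normalized Lebesgue measure. The periodic weighted Wiener ball is $$ \mathcal A_\beta:=\left\{f\in L_1(\mathbb T)\colon \sum_{k\in\mathbb Z}(1+|k|)^\beta|\widehat f(k)|\le1\right\},$$ where $\widehat f(k)=\int_{\mathbb T}f(x)e^{-2\pi ikx}\,dx$. The complex Kolmogorov width is $$ d_n^{\mathbb C}(\mathcal K,X):=\inf_{\dim_{\mathbb C} V\le n}\ \sup_{f\in\mathcal K}\operatorname{dist}_{X}(f,V),$$ the infimum being over complex linear subspaces $V\subset X$ of dimension at most $n$. The notation $X_n\lesssim Y_n$ means $X_n\le CY_n$ with a constant $C>0$ not depending on $n$ (it may depend on $p$ and $\beta$). *)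

(* Defs.v *)
From HB Require Import structures.
From mathcomp Require Import all_boot all_order all_algebra.
From mathcomp Require Import complex.
From mathcomp Require Import all_classical all_reals all_analysis.

Set Implicit Arguments.
Unset Strict Implicit.
Unset Printing Implicit Defensive.
Import Order.TTheory GRing.Theory Num.Theory.
Import numFieldNormedType.Exports.

Local Open Scope classical_set_scope.
Local Open Scope ring_scope.
Local Open Scope complex_scope.

(* The circle R/Z is handled through 1-periodic functions on R; its normalized
   Lebesgue measure is Lebesgue measure restricted to the fundamental domain
   [0, 1[. *)
Definition torus_measure (R : realType) :
    {measure set (measurableTypeR R) -> \bar R} :=
  mrestr (@lebesgue_measure R) (measurable_itv `[0%R, 1%R[).

Definition Lp_norm (R : realType) (p : R) (f : R -> R[i]) : \bar R :=
  Lnorm (torus_measure R) p%:E (fun x => (Normc.normc (f x))%:E).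

(* Representatives of the elements of the complex space L_p(R/Z). *)
Definition Lp (R : realType) (p : R) : set (R -> R[i]) :=
  [set f : R -> R[i] |
    [/\ periodic f 1,
        measurable_fun [set: R] (fun x : R => complex.Re (f x)),
        measurable_fun [set: R] (fun x : R => complex.Im (f x)) &
        (Lp_norm p f < +oo)%E]].

Definition torus_integral (R : realType) (f : R -> R[i]) : R[i] :=
  (\int[torus_measure R]_x complex.Re (f x)) +i*
  (\int[torus_measure R]_x complex.Im (f x)).

(* expi t = e^{it} *)
Definition expi (R : realType) (t : R) : R[i] := cos t +i* sin t.

Definition fourier (R : realType) (f : R -> R[i]) (k : int) : R[i] :=
  torus_integral (fun x => f x * expi (- (2 * pi * k%:~R * x))).

Definition wiener_ball (R : realType) (beta : R) : set (R -> R[i]) :=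
  [set f | Lp 1 f /\
    (\esum_(k in [set: int])
       ((1 + `|k%:~R|) `^ beta * Normc.normc (fourier f k))%:E <= 1)%E].

(* Complex linear subspaces of L_p(R/Z).  Elements of L_p are classes modulo
   a.e. equality, so a subspace is given by the set of all representatives of
   its elements: the last clause says that this set is a union of classes. *)
Definition Lp_subspace (R : realType) (p : R) (V : set (R -> R[i])) : Prop :=
  [/\ V `<=` Lp p,
      V (fun=> 0),
      (forall (a : R[i]) f g, V f -> V g -> V (fun x => a * f x + g x)) &
      (forall f g, V f -> Lp p g -> f = g %[ae torus_measure R] -> V g)].

(* V is spanned, modulo a.e. equality, by n of its elements. *)
Definition dim_le (R : realType) (V : set (R -> R[i])) (n : nat) : Prop :=
  exists2 e : 'I_n -> R -> R[i],
    forall i, V (e i) &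
    forall f, V f -> exists a : 'I_n -> R[i],
      f = (fun x => \sum_(i < n) a i * e i x) %[ae torus_measure R].

Definition Lp_dist (R : realType) (p : R) (f : R -> R[i])
    (V : set (R -> R[i])) : \bar R :=
  ereal_inf [set Lp_norm p (fun x => f x - g x) | g in V].

Definition kolmogorov_width (R : realType) (p : R) (K : set (R -> R[i]))
    (n : nat) : \bar R :=
  ereal_inf [set ereal_sup [set Lp_dist p f V | f in K]
            | V in [set V | Lp_subspace p V /\ dim_le V n]].

Definition lesssim (R : realType) (X Y : nat -> \bar R) : Prop :=
  exists2 C : R, 0 < C & forall n : nat, (0 < n)%N -> (X n <= C%:E * Y n)%E.

Definition wiener_width_bounds (R : realType) (p beta B b : R) : Prop :=
  lesssim (fun n => (n%:R `^ (- beta - B))%:E)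
          (kolmogorov_width p (wiener_ball beta)) /\
  lesssim (kolmogorov_width p (wiener_ball beta))
          (fun n => (n%:R `^ (- beta - b))%:E).

(* Main.v *)
(* Upper bound. The Fourier matrix F of order n satisfies F^4 = n^2, so F minus a
   suitable scalar of modulus sqrt n has rank at most 3n/4, and the discarded
   scalar matrix has entries of p-th mean n^(p/2-1), which tends to 0 since p < 2.
   Tensoring this over coprime moduli, and then over the digits of k and x in a
   fixed base b, produces for every J a space of dimension at most (b/2)^J that
   approximates every e_k with 2|k| < b^J within O(2^-J) in L_p. The lowest
   frequencies of f are kept exactly, the intermediate ones are taken from this
   space, and the remaining tail is bounded in sup norm by the sum of its Fourier
   coefficients; this last bound follows by pairing with nonnegative
   trigonometric polynomials converging to indicators of intervals and Lebesgue
   differentiation.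

   Lower bound. Averages over the cells of a grid of M points turn an
   n-dimensional space close to e_0, ..., e_(N-1) into functions W_k on the grid
   that lie in a space of dimension n and are close to the rows F_k of the Fourier
   matrix. For a weight w, let K be the reproducing kernel of that space in
   l_2(w); then the sum of w K is at most n, and Bessel's inequality makes W_k
   and F_k almost orthogonal for some k, which contradicts their closeness. The
   weight w = 1 needs N of order n and errors of order M^(1/2-1/p); an approximate
   Lewis weight, w = K^(-(1-p/2)) up to a factor 2, needs N of order n^(2/p) and
   constant errors. These yield the exponents alpha and 2 alpha beta. *)
Require Import Defs.
From mathcomp Require Import all_boot all_order all_algebra.
From mathcomp Require Import complex.
From mathcomp Require Import all_classical all_reals all_analysis.
From mathcomp Require Import measurable_realfun.
From mathcomp Require Import ring lra zify.
Import Order.TTheory GRing.Theory Num.Theory.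
Import numFieldNormedType.Exports.
Set Implicit Arguments.
Unset Strict Implicit.
Unset Printing Implicit Defensive.
Local Open Scope classical_set_scope.
Local Open Scope ring_scope.

(** * Complex modulus and exponential *)

(** Upper bound. F^4 = n^2 saves only a quarter of the rank, whereas a splitting along digits leaves
    twiddle phases whose rank grows like C^J. Coprime moduli leave no phases; they serve to build
    one order b at which the rank lies below b by a prescribed factor, and only then are digits in
    base b taken. With (b/2)^J of order n and c = ln 2 / ln (b/2), 2^-J is of order n^-c and b^J of
    order n^(1+c). So the intermediate frequencies cost n^(-beta-c) and the tail n^(-beta(1+c)),
    which is the origin of min(1, beta).

    Lower bound. Elements of L_p have no point values, hence cell averages, which do not increase
    p-th means. Since (1+k)^-beta e_k lies in the ball, a width eps approximates e_k within eps
    N^beta for all k < N. For w = 1 the obstacle is the comparison of the l_p and l_2 norms on M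
    points, and N of order n gives n^(-beta-alpha). With the Lewis weight N^-beta is of order n^(-2
    beta/p) = n^(-beta-2 alpha beta), because 2/p = 1 + 2 alpha. *)

Section ComplexModulus.
Context {R : realType}.
Local Notation C := R[i].
Local Notation nc := (@Normc.normc R).
Implicit Types (z w : C) (x : R).

Lemma ncE z : nc z = Num.sqrt (complex.Re z ^+ 2 + complex.Im z ^+ 2).
Proof. by case: z. Qed.

Lemma nc_ge0 z : 0 <= nc z.
Proof. by rewrite ncE sqrtr_ge0. Qed.
Hint Resolve nc_ge0 : core.

Lemma nc0 : nc 0 = 0.
Proof. by rewrite ncE /= expr0n /= addr0 sqrtr0. Qed.

Lemma nc1 : nc 1 = 1.
Proof. by rewrite ncE /= expr0n /= addr0 expr1n sqrtr1. Qed.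

Lemma nc_sqr z : nc z ^+ 2 = complex.Re z ^+ 2 + complex.Im z ^+ 2.
Proof. by rewrite ncE sqr_sqrtr // addr_ge0 // sqr_ge0. Qed.

Lemma nc_eq0 z : (nc z == 0) = (z == 0).
Proof.
apply/eqP/eqP => [|->]; last exact: nc0.
exact: Normc.eq0_normc.
Qed.

Lemma nc_real x : nc x%:C%C = `|x|.
Proof. by rewrite ncE /= expr0n /= addr0 sqrtr_sqr. Qed.

Lemma nc_Re z : `|complex.Re z| <= nc z.
Proof.
rewrite ncE -sqrtr_sqr ler_wsqrtr // lerDl sqr_ge0 //.
Qed.

Lemma nc_Im z : `|complex.Im z| <= nc z.
Proof.
rewrite ncE -sqrtr_sqr ler_wsqrtr // lerDr sqr_ge0 //.
Qed.

Lemma nc_le_ReIm z : nc z <= `|complex.Re z| + `|complex.Im z|.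
Proof.
rewrite -(@ler_pXn2r _ 2) ?nnegrE ?nc_ge0 ?addr_ge0 //.
rewrite nc_sqr sqrrD !real_normK ?num_real // lerD2r lerDl mulrn_wge0 //.
Qed.

Lemma ncM z w : nc (z * w) = nc z * nc w.
Proof. exact: Normc.normcM. Qed.

Lemma ncD z w : nc (z + w) <= nc z + nc w.
Proof. exact: le_normcD. Qed.

Lemma ncN z : nc (- z) = nc z.
Proof. exact: normcN. Qed.

Lemma ncB z w : nc (z - w) <= nc z + nc w.
Proof. by rewrite -(ncN w) ncD. Qed.

Lemma ncJ z : nc (z^*)%C = nc z.
Proof. by case: z => a b; rewrite !ncE /= sqrrN. Qed.

Lemma nc_sum I (r : seq I) (P : pred I) (F : I -> C) :
  nc (\sum_(i <- r | P i) F i) <= \sum_(i <- r | P i) nc (F i).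
Proof.
elim/big_ind2: _ => //; first by rewrite nc0.
by move=> x1 x2 y1 y2 h1 h2; apply: le_trans (ncD _ _) (lerD h1 h2).
Qed.

Lemma nc_prod I (r : seq I) (P : pred I) (F : I -> C) :
  nc (\prod_(i <- r | P i) F i) = \prod_(i <- r | P i) nc (F i).
Proof. by elim/big_ind2: _ => //; [rewrite nc1|move=> x1 x2 y1 y2 <- <-; rewrite ncM]. Qed.

Lemma mulcJ z : z * (z^*)%C = (nc z ^+ 2)%:C%C.
Proof.
rewrite nc_sqr; case: z => a b /=; apply/eqP; rewrite eq_complex /=.
by apply/andP; split; apply/eqP; ring.
Qed.

Lemma Re_add z w : complex.Re (z + w) = complex.Re z + complex.Re w.
Proof. by case: z => ? ?; case: w => ? ?. Qed.
Lemma Im_add z w : complex.Im (z + w) = complex.Im z + complex.Im w.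
Proof. by case: z => ? ?; case: w => ? ?. Qed.
Lemma Re_sum I (r : seq I) (P : pred I) (F : I -> C) :
  complex.Re (\sum_(i <- r | P i) F i) = \sum_(i <- r | P i) complex.Re (F i).
Proof. by rewrite (big_morph _ Re_add (erefl _)). Qed.

Lemma Im_sum I (r : seq I) (P : pred I) (F : I -> C) :
  complex.Im (\sum_(i <- r | P i) F i) = \sum_(i <- r | P i) complex.Im (F i).
Proof. by rewrite (big_morph _ Im_add (erefl _)). Qed.

Lemma Re_opp z : complex.Re (- z) = - complex.Re z.
Proof. by case: z. Qed.
Lemma Im_opp z : complex.Im (- z) = - complex.Im z.
Proof. by case: z. Qed.
Lemma Re_mul z w :
  complex.Re (z * w) = complex.Re z * complex.Re w - complex.Im z * complex.Im w.
Proof. by case: z => ? ?; case: w => ? ?. Qed.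
Lemma Im_mul z w :
  complex.Im (z * w) = complex.Re z * complex.Im w + complex.Im z * complex.Re w.
Proof. by case: z => ? ?; case: w => ? ?. Qed.

Lemma real_complexM x y : (x * y)%:C%C = x%:C%C * y%:C%C :> C.
Proof. exact: rmorphM. Qed.

End ComplexModulus.
#[global] Hint Resolve nc_ge0 : core.

Section Exponential.
Context {R : realType}.
Local Notation C := R[i].
Local Notation nc := (@Normc.normc R).

Definition ee (t : R) : C := expi (2 * pi * t).

Lemma expi0 : expi 0 = 1 :> C.
Proof. by rewrite /expi cos0 sin0. Qed.

Lemma expiD (s t : R) : expi (s + t) = expi s * expi t.
Proof.
rewrite /expi cosD sinD; apply/eqP; rewrite eq_complex /=.
by apply/andP; split; apply/eqP => //; ring.
Qed.

Lemma nc_expi (t : R) : nc (expi t) = 1.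
Proof. by rewrite ncE /= cos2Dsin2 sqrtr1. Qed.

Lemma expiN (t : R) : expi (- t) = ((expi t)^*)%C.
Proof. by rewrite /expi cosN sinN. Qed.

Lemma ee0 : ee 0 = 1.
Proof. by rewrite /ee mulr0 expi0. Qed.

Lemma eeD (s t : R) : ee (s + t) = ee s * ee t.
Proof. by rewrite /ee mulrDr expiD. Qed.

Lemma nc_ee (t : R) : nc (ee t) = 1.
Proof. exact: nc_expi. Qed.

Lemma eeN (t : R) : ee (- t) = ((ee t)^*)%C.
Proof. by rewrite /ee mulrN expiN. Qed.

Lemma ee1 : ee 1 = 1.
Proof. by rewrite /ee /expi mulr1 mulr_natl cos2pi sin2pi. Qed.

Lemma ee_nat n : ee n%:R = 1.
Proof.
elim: n => [|n IH]; first exact: ee0.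
by rewrite -natr1 eeD IH ee1 mulr1.
Qed.

Lemma ee_int (k : int) : ee k%:~R = 1.
Proof.
case: k => n; first exact: ee_nat.
by rewrite NegzE mulrNz eeN [X in (X^*)%C]ee_nat conjc1.
Qed.

Lemma eeDn (t : R) n : ee (t + n%:R) = ee t.
Proof. by rewrite eeD ee_nat mulr1. Qed.

Lemma eeDz (t : R) (n : int) : ee (t + n%:~R) = ee t.
Proof. by rewrite eeD ee_int mulr1. Qed.

Lemma ee_neq1 (t : R) : 0 < t < 1 -> ee t != 1.
Proof.
move=> /andP[t0 t1]; apply/eqP => /(congr1 (@complex.Re R)) /= h.
have : sin (pi * t) = 0.
  have : sin (pi * t) ^+ 2 = 0.
    rewrite sin2cos2; move: h; rewrite -mulrA mulr_natl cosD.
    rewrite -!expr2 sin2cos2 => h; lra.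
  by move/eqP; rewrite expf_eq0 /= => /eqP.
apply/eqP; rewrite gt_eqF // sin_gt0_pi //.
by rewrite mulr_gt0 ?pi_gt0 //= gtr_pMr ?pi_gt0.
Qed.

End Exponential.

(** * Low rank approximation of the discrete Fourier matrix *)

Section RankCalculus.
Context {K : comPzRingType}.

(** Rank is expressed by a factorization through a finite type, for kernels on arbitrary index
    types: sums and pointwise products become sum and product types, and relabelling of rows or
    columns is composition. *)
Definition rk (X Y : Type) (f : X -> Y -> K) (n : nat) : Prop :=
  exists2 T : finType, (#|T| <= n)%N &
  exists (A : X -> T -> K) (B : T -> Y -> K),
    forall x y, f x y = \sum_t A x t * B t y.

Lemma rk_le X Y (f : X -> Y -> K) m n : (m <= n)%N -> rk f m -> rk f n.
Proof. by move=> mn [T Tm AB]; exists T => //; apply: leq_trans mn. Qed.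

Lemma rk_ext X Y (f g : X -> Y -> K) n :
  (forall x y, f x y = g x y) -> rk f n -> rk g n.
Proof.
by move=> fg [T Tn [A [B h]]]; exists T => //; exists A, B => x y; rewrite -fg.
Qed.

Lemma rk_comp X Y X' Y' (f : X -> Y -> K) n (a : X' -> X) (b : Y' -> Y) :
  rk f n -> rk (fun x y => f (a x) (b y)) n.
Proof.
case=> T Tn [A [B h]]; exists T => //.
by exists (fun x => A (a x)), (fun t y => B t (b y)) => x y; rewrite h.
Qed.

Lemma rk_tensor X Y (u : X -> K) (v : Y -> K) : rk (fun x y => u x * v y) 1.
Proof.
exists unit; first by rewrite card_unit.
exists (fun x _ => u x), (fun _ y => v y) => x y.
by rewrite (bigD1 tt) //= big1 ?addr0 // => -[].
Qed.

Lemma rk_mul X Y (f g : X -> Y -> K) m n :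
  rk f m -> rk g n -> rk (fun x y => f x y * g x y) (m * n).
Proof.
case=> T Tm [A [B h]] [T' Tn [A' [B' h']]].
exists (T * T')%type; first by rewrite card_prod leq_mul.
exists (fun x t => A x t.1 * A' x t.2), (fun t y => B t.1 y * B' t.2 y) => x y.
rewrite h h' big_distrlr /= pair_big /=.
by apply: eq_bigr => t _; rewrite mulrACA.
Qed.

Lemma rk_add X Y (f g : X -> Y -> K) m n :
  rk f m -> rk g n -> rk (fun x y => f x y + g x y) (m + n).
Proof.
case=> T Tm [A [B h]] [T' Tn [A' [B' h']]].
exists (T + T')%type; first by rewrite card_sum leq_add.
exists (fun x t => match t with inl t => A x t | inr t => A' x t end),
  (fun t y => match t with inl t => B t y | inr t => B' t y end) => x y.
by rewrite h h' big_sumType.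
Qed.

Lemma rk_0 X Y : rk (fun (_ : X) (_ : Y) => 0) 0.
Proof.
exists void; first by rewrite card_void.
by exists (fun _ _ => 0), (fun _ _ => 0) => x y; rewrite big1 // => -[].
Qed.

Lemma rk_sum X Y I (r : seq I) (P : pred I) (f : I -> X -> Y -> K) (n : I -> nat) :
  (forall i, P i -> rk (f i) (n i)) ->
  rk (fun x y => \sum_(i <- r | P i) f i x y) (\sum_(i <- r | P i) n i).
Proof.
move=> h; elim: r => [|i r IH].
  by rewrite big_nil; apply: rk_ext (rk_0 X Y) => x y; rewrite big_nil.
rewrite big_cons; case: ifP => Pi; last first.
  by apply: rk_ext IH => x y; rewrite big_cons Pi.
by apply: rk_ext (rk_add (h i Pi) IH) => x y; rewrite [RHS]big_cons Pi.
Qed.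

Lemma rk_prod X Y I (r : seq I) (P : pred I) (f : I -> X -> Y -> K) (n : I -> nat) :
  (forall i, P i -> rk (f i) (n i)) ->
  rk (fun x y => \prod_(i <- r | P i) f i x y) (\prod_(i <- r | P i) n i)%N.
Proof.
move=> h; elim: r => [|i r IH].
  rewrite big_nil; apply: rk_ext (rk_tensor (fun _ : X => 1) (fun _ : Y => 1)) => x y.
  by rewrite big_nil mul1r.
rewrite big_cons; case: ifP => Pi; last first.
  by apply: rk_ext IH => x y; rewrite big_cons Pi.
by apply: rk_ext (rk_mul (h i Pi) IH) => x y; rewrite [RHS]big_cons Pi.
Qed.

Lemma rk_scale X Y (f : X -> Y -> K) n (u : X -> K) :
  rk f n -> rk (fun x y => u x * f x y) n.
Proof.
case=> T Tn [A [B h]]; exists T => //.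
exists (fun x t => u x * A x t), B => x y.
by rewrite h mulr_sumr; apply: eq_bigr => t _; rewrite mulrA.
Qed.

(** A kernel with at most [b] distinct rows: the row number serves as inner index. *)
Lemma rk_fin X Y (f : X -> Y -> K) b (a : X -> nat) (g : nat -> Y -> K) :
  (forall x, (a x < b)%N) -> (forall x y, f x y = g (a x) y) -> rk f b.
Proof.
move=> ab fg; exists 'I_b; first by rewrite card_ord.
exists (fun x (t : 'I_b) => (t == a x :> nat)%:R), (fun (t : 'I_b) y => g t y) => x y.
rewrite (bigD1 (Ordinal (ab x))) //= eqxx mul1r fg big1 ?addr0 // => i.
by rewrite -val_eqE /= => /negbTE ->; rewrite mul0r.
Qed.

End RankCalculus.

Lemma rk_mx (F : fieldType) m n (A : 'M[F]_(m.+1, n.+1)) :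
  rk (fun (i j : nat) => A (inord i) (inord j)) (\rank A).
Proof.
exists 'I_(\rank A); first by rewrite card_ord.
exists (fun i t => col_base A (inord i) t), (fun t j => row_base A t (inord j)) => i j.
by rewrite -{1}(mulmx_base A) mxE.
Qed.

Section PowerMeans.
Context {R : realType}.
Implicit Types (a b p : R).

Lemma powR_mono a b p : 0 <= p -> 0 <= a -> a <= b -> a `^ p <= b `^ p.
Proof. by move=> p0 a0 ab; apply: ge0_ler_powR => //; rewrite nnegrE // (le_trans a0). Qed.

Lemma powR_le2 (K : R) p : 1 <= K -> p <= 2 -> K `^ p <= K ^+ 2.
Proof.
by move=> K1 p2; rewrite -powR_mulrn ?(le_trans ler01 K1) //; apply: ler_powR.
Qed.

(** Each [a i] is at most s^(1/p), with s the sum of the p-th powers, so the sum is at most N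
    s^(1/p); N^p <= N^2 makes the constant independent of [p]. *)
Lemma powR_sum_le p I (r : seq I) (P : pred I) (a : I -> R) (N : nat) :
  0 < p -> p <= 2 -> (count P r <= N)%N -> (0 < N)%N ->
  (forall i, P i -> 0 <= a i) ->
  (\sum_(i <- r | P i) a i) `^ p <= N%:R ^+ 2 * \sum_(i <- r | P i) a i `^ p.
Proof.
move=> p0 p2 cN N0 a0.
set s := \sum_(i <- r | P i) a i `^ p.
have s0 : 0 <= s by apply: sumr_ge0 => i _; apply: powR_ge0.
have as_ : \sum_(i <- r | P i) a i <= N%:R * s `^ p^-1.
  apply: (@le_trans _ _ (\sum_(i <- r | P i) s `^ p^-1)).
    have : forall r', (forall i, P i -> 0 <= a i) ->
       \sum_(i <- r' | P i) a i `^ p <= s ->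
       \sum_(i <- r' | P i) a i <= \sum_(i <- r' | P i) s `^ p^-1.
      elim=> [|i r' IH] h hs; first by rewrite !big_nil.
      move: hs; rewrite !big_cons; case: ifP => Pi hs; last exact: IH.
      have t0 : 0 <= \sum_(j <- r' | P j) a j `^ p.
        by apply: sumr_ge0 => j _; apply: powR_ge0.
      apply: lerD.
        have -> : a i = (a i `^ p) `^ p^-1.
          by rewrite -powRrM divff ?gt_eqF // powRr1 // h.
        apply: powR_mono; rewrite ?invr_ge0 ?powR_ge0 ?(ltW p0) //.
        by apply: le_trans hs; rewrite lerDl.
      apply: IH => //; apply: le_trans hs; rewrite lerDr powR_ge0 //.
    by apply.
  rewrite big_const_seq iter_addr_0 -[leLHS]mulr_natl.
  by apply: ler_wpM2r; rewrite ?powR_ge0 // ler_nat.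
apply: le_trans (powR_mono (ltW p0) _ as_) _; first exact: sumr_ge0.
rewrite powRM ?powR_ge0 // -powRrM mulVf ?gt_eqF // powRr1 //.
by apply: ler_wpM2r => //; apply: powR_le2; rewrite // ler1n.
Qed.

Lemma powR_add_le p a b : 0 < p -> p <= 2 -> 0 <= a -> 0 <= b ->
  (a + b) `^ p <= 4 * (a `^ p + b `^ p).
Proof.
move=> p0 p2 a0 b0.
have := @powR_sum_le p bool [:: true; false] xpredT (fun i => if i then a else b) 2 p0 p2.
rewrite !big_cons !big_nil /= !addr0 => /(_ isT isT) h.
apply: le_trans (h _) _; first by case.
by rewrite -natrX.
Qed.

End PowerMeans.

Section DFT.
Context {R : realType}.
Local Notation C := R[i].
Local Notation nc := (@Normc.normc R).

Definition dft (n k x : nat) : C := ee (k%:R * x%:R / n%:R : R).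

Lemma nc_dft n k x : nc (dft n k x) = 1.
Proof. exact: nc_ee. Qed.

Lemma dftC n k x : dft n k x = dft n x k.
Proof. by rewrite /dft [k%:R * _]mulrC. Qed.

Lemma dft_modr n k x : (0 < n)%N -> dft n k (x %% n) = dft n k x.
Proof.
move=> n0; rewrite /dft [in RHS](divn_eq x n) natrD natrM.
have nn : n%:R != 0 :> R by rewrite pnatr_eq0 -lt0n.
have -> : k%:R * ((x %/ n)%:R * n%:R + (x %% n)%:R) / n%:R =
  k%:R * (x %% n)%:R / n%:R + (k * (x %/ n))%:R :> R by rewrite natrM; field.
by rewrite eeDn.
Qed.

Lemma dft_modl n k x : (0 < n)%N -> dft n (k %% n) x = dft n k x.
Proof. by move=> n0; rewrite dftC dft_modr // dftC. Qed.

Lemma dftDl n k l x : dft n (k + l) x = dft n k x * dft n l x.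
Proof. by rewrite /dft natrD !mulrDl eeD. Qed.

Lemma dft_nl n x : (0 < n)%N -> dft n n x = 1.
Proof. by move=> n0; rewrite -dft_modl // modnn /dft !mul0r ee0. Qed.

Lemma dft_X n m l : dft n l m = dft n 1 m ^+ l.
Proof.
elim: l => [|l IH]; first by rewrite /dft !mul0r ee0.
by rewrite -addn1 dftDl IH addn1 exprSr.
Qed.

Lemma dft_sum n m : (0 < n)%N ->
  \sum_(l < n) dft n l m = (if (n %| m)%N then n%:R else 0).
Proof.
move=> n0; case: ifP => [/dvdnP[q ->]|nm].
  rewrite (eq_bigr (fun=> 1)); first by rewrite sumr_const card_ord.
  by move=> i _; rewrite -dft_modr // modnMl /dft mulr0 mul0r ee0.
have z1 : dft n 1 m != 1.
  rewrite -dft_modr // /dft mul1r; apply: ee_neq1.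
  rewrite divr_gt0 ?ltr0n //=; last by rewrite lt0n; move/negbT: nm.
  by rewrite ltr_pdivrMr ?ltr0n // mul1r ltr_nat ltn_mod.
under eq_bigr do rewrite dft_X.
apply/eqP; rewrite -(@mulrI_eq0 _ (dft n 1 m - 1)); last first.
  by apply/lregP; rewrite subr_eq0.
by rewrite -subrX1 -dft_X dft_nl // subrr.
Qed.

Definition dftmx n : 'M[C]_n.+1 := \matrix_(i, j) dft n.+1 i j.

(** The square of the matrix is its order times the permutation k -> -k, an involution. *)
Lemma dftmx4 n : dftmx n *m dftmx n *m (dftmx n *m dftmx n) = (n.+1%:R ^+ 2)%:M.
Proof.
have sq i j : (dftmx n *m dftmx n) i j = if (n.+1 %| i + j)%N then n.+1%:R else 0.
  rewrite mxE -dft_sum //; apply: eq_bigr => l _.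
  by rewrite !mxE (dftC _ l (i + j)) dftDl (dftC _ j).
apply/matrixP => i j; rewrite mxE.
under eq_bigr do rewrite !sq.
have li : ((n.+1 - i) %% n.+1 < n.+1)%N by rewrite ltn_mod.
have dvd_eq (l : 'I_n.+1) : (n.+1 %| i + l)%N = (l == Ordinal li).
  rewrite -val_eqE /=; have := ltn_ord i; have := ltn_ord l.
  case: (nat_of_ord i) => [|i'] ll ii.
    by rewrite add0n subn0 modnn /dvdn modn_small.
  rewrite modn_small ?subSS; last by lia.
  apply/idP/eqP => [/dvdnP[[|[|q]]]|]; try lia.
  by move=> ->; apply/dvdnP; exists 1%N; lia.
rewrite (bigD1 (Ordinal li)) //= big1 ?addr0; last first.
  by move=> l /negbTE ll; rewrite dvd_eq ll mul0r.
rewrite -/(nat_of_ord (Ordinal li)) dvd_eq eqxx mxE.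
have -> : (n.+1 %| Ordinal li + j)%N = (i == j).
  have := ltn_ord i; have := ltn_ord j; rewrite /= -val_eqE /=.
  case: (nat_of_ord i) => [|i'] jj ii.
    by rewrite subn0 modnn add0n /dvdn modn_small // eq_sym.
  rewrite modn_small ?subSS; last by lia.
  apply/idP/eqP => [/dvdnP[[|[|q]]]|]; try lia.
  by move=> <-; apply/dvdnP; exists 1%N; lia.
by case: ifP => _; rewrite ?mulr1n ?mulr0n ?mulr0 ?expr2.
Qed.

(* The fourth power of the DFT matrix is scalar, so one of its four
   eigenspaces has dimension at least a quarter of the order. *)
Lemma dft_rank n : (0 < n)%N -> exists2 lam : C, nc lam ^+ 2 = n%:R &
  exists2 d : nat, (4 * d <= 3 * n)%N &
  rk (fun k x : 'I_n => dft n k x - lam * (k == x)%:R) d.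
Proof.
case: n => // n _.
pose M := dftmx n; pose a : C := (Num.sqrt n.+1%:R)%:C%C.
have a2 : a ^+ 2 = n.+1%:R.
  rewrite /a -rmorphXn /= sqr_sqrtr ?ler0n //.
  by rewrite rmorph_nat.
have na : nc a ^+ 2 = n.+1%:R by rewrite nc_real real_normK ?num_real // sqr_sqrtr // ler0n.
pose b : C := ('i)%C * a.
have b2 : b ^+ 2 = - n.+1%:R by rewrite exprMn a2 sqr_i mulN1r.
have nb : nc b ^+ 2 = n.+1%:R.
  by rewrite ncM exprMn na nc_sqr /= expr0n add0r expr1n mul1r.
have fac (c : C) : (M - c%:M) *m (M + c%:M) = M *m M - (c ^+ 2)%:M.
  rewrite mulmxDr !mulmxBl scalar_mxC -!scalar_mxM -expr2.
  by rewrite addrA subrK.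
have prod0 : (M - a%:M) *m (M + a%:M) *m ((M - b%:M) *m (M + b%:M)) = 0.
  rewrite !fac a2 b2 rmorphN opprK mulmxDr !mulmxBl -scalar_mxC.
  rewrite addrA subrK dftmx4 -scalar_mxM expr2 subrr //.
have mN (c : C) : (M - (- c)%:M) = M + c%:M by rewrite rmorphN opprK.
have key : exists2 lam : C, nc lam ^+ 2 = n.+1%:R &
    (4 * \rank (M - lam%:M)%R <= 3 * n.+1)%N.
  (* The four factors have product M^4 - (n+1)^2 = 0. Three uses of Sylvester's inequality bound the
     sum of their ranks by 3(n+1), so one rank is at most 3(n+1)/4. *)
  have := mxrank_mul_min (M - a%:M) (M + a%:M).
  have := mxrank_mul_min (M - b%:M) (M + b%:M).
  have := mxrank_mul_min ((M - a%:M) *m (M + a%:M)) ((M - b%:M) *m (M + b%:M)).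
  rewrite prod0 mxrank0 => h1 h2 h3.
  case: (leqP (4 * \rank (M - a%:M)%R) (3 * n.+1)) => ha; first by exists a.
  case: (leqP (4 * \rank (M - b%:M)%R) (3 * n.+1)) => hb; first by exists b.
  case: (leqP (4 * \rank (M + a%:M)%R) (3 * n.+1)) => ha'.
    by exists (- a); rewrite ?ncN // mN.
  exists (- b); rewrite ?ncN // mN.
  have arith (x y z t A B N : nat) : (A + B - N <= 0 -> z + t - N <= B ->
      x + y - N <= A -> 3 * N < 4 * x -> 3 * N < 4 * z -> 3 * N < 4 * y ->
      4 * t <= 3 * N)%N by lia.
  exact: (arith _ _ _ _ _ _ _ h1 h2 h3 ha hb ha').
case: key => lam nl rl; exists lam => //; exists (\rank (M - lam%:M)%R) => //.
apply: rk_ext (rk_comp (@nat_of_ord n.+1) (@nat_of_ord n.+1) (rk_mx (M - lam%:M))).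
by move=> k x /=; rewrite !inord_val !mxE mulr_natr.
Qed.

End DFT.

(** * Amplification of the rank gain over coprime moduli *)

Lemma sum_crt {R : realType} (b c : nat) (f g : nat -> R) : coprime b c ->
  (0 < b)%N -> (0 < c)%N ->
  \sum_(x < b * c) f (x %% b)%N * g (x %% c)%N =
  (\sum_(x < b) f x) * (\sum_(x < c) g x).
Proof.
move=> bc b0 c0; rewrite big_distrlr /= pair_big /=.
have bc0 : (0 < b * c)%N by rewrite muln_gt0 b0.
pose h (u : 'I_b * 'I_c) : 'I_(b * c) :=
  Ordinal (ltn_pmod (chinese b c u.1 u.2) bc0).
pose h' (x : 'I_(b * c)) : 'I_b * 'I_c :=
  (Ordinal (ltn_pmod x b0), Ordinal (ltn_pmod x c0)).
have hh' : cancel h' h.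
  move=> x; apply/val_inj => /=.
  by rewrite -chinese_mod // modn_small.
have h'h : cancel h h'.
  move=> [i j]; apply/eqP; rewrite -pair_eqE /= /pair_eq -!val_eqE /=.
  rewrite modn_dvdm ?dvdn_mulr // chinese_modl // modn_small // eqxx.
  by rewrite modn_dvdm ?dvdn_mull // chinese_modr // modn_small // eqxx.
rewrite (reindex h); last by apply: onW_bij; exists h'.
apply: eq_bigr => u _ /=.
rewrite modn_dvdm ?dvdn_mulr // chinese_modl // modn_small //.
by rewrite modn_dvdm ?dvdn_mull // chinese_modr // modn_small.
Qed.

Section NonRigidSite.
Context {R : realType} (p : R).
Hypotheses (p1 : 1 <= p) (p2 : p < 2).
Local Notation C := R[i].
Local Notation nc := (@Normc.normc R).

Let p0 : 0 < p. Proof. exact: lt_le_trans p1. Qed.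

(** The p-th mean of the error is bounded in every row [k], not on average over the rows, since each
    exponential has to be approximated; [k] is unrestricted so that rows may be relabelled
    freely. *)
Definition low_rank_approx (b d : nat) (sigma : R) : Prop :=
  exists2 L : nat -> nat -> C, rk L d &
  forall k, \sum_(x < b) nc (dft b k x - L k x) `^ p <= sigma * b%:R.

Lemma low_rank_approx_base (sigma : R) : 0 < sigma ->
  exists n0 : nat, forall n, (n0 <= n)%N -> (0 < n)%N ->
  exists2 d : nat, (4 * d <= 3 * n)%N & low_rank_approx n d sigma.
Proof.
move=> s0; pose e : R := 1 - p / 2.
have e0 : 0 < e by move: p2 => hp2; rewrite /e; lra.
(* The threshold from which n^(-e), the p-th mean of a discarded row, is at most [sigma]. *)
exists (Num.bound (sigma^-1 `^ e^-1)) => n nb n0.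
have [lam nl [d dn rkd]] := @dft_rank R n n0.
exists d => //.
pose m (k : nat) : 'I_n := Ordinal (ltn_pmod k n0).
exists (fun k x => dft n (m k) (m x) - lam * (m k == m x)%:R).
  exact: (rk_comp m m rkd).
move=> k.
rewrite (eq_bigr (fun x : 'I_n => (if x == m k then nc lam `^ p else 0))); last first.
  move=> x _; rewrite /= dft_modl // dft_modr // opprB addrC subrK.
  have -> : m x = x by apply/val_inj; rewrite /= modn_small.
  rewrite eq_sym; case: eqP => _; first by rewrite mulr1.
  by rewrite mulr0 nc0 powR0 // gt_eqF.
rewrite -big_mkcond /= big_pred1_eq.
have nR : 0 < n%:R :> R by rewrite ltr0n.
have -> : nc lam `^ p = n%:R `^ (p / 2).
  rewrite -nl -[nc lam ^+ 2]powR_mulrn ?nc_ge0 // -powRrM.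
  by congr (_ `^ _); field.
have -> : p / 2 = 1 - e by rewrite /e; ring.
rewrite powRB; last by rewrite (gt_eqF nR) implybT.
rewrite powRr1 ?ler0n // ler_pdivrMr ?powR_gt0 //.
rewrite mulrAC -[leLHS]mul1r ler_wpM2r ?ler0n //.
rewrite -ler_pdivrMl // mulr1.
have {1}-> : sigma^-1 = (sigma^-1 `^ e^-1) `^ e.
  by rewrite -powRrM mulVf ?gt_eqF // powRr1 // invr_ge0 ltW.
apply: powR_mono; rewrite ?powR_ge0 ?(ltW e0) //.
apply: le_trans (ltW (archi_boundP _)) _; first exact: powR_ge0.
by rewrite ler_nat.
Qed.

(** As c - b q = 1, one has 1/(b c) = 1/b - q/c. The multiplier -q is replaced by [c - q], which is
    natural and agrees with it modulo c; it goes into the row index, and no phase remains. *)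
Lemma dft_crt (b q k x : nat) : (0 < b)%N -> let c := (b * q).+1 in
  dft (b * c) k x = dft b k x * (dft c (k * (c - q)) x : C).
Proof.
move=> b0 c; rewrite /dft -eeD.
have qc : (q <= c)%N by rewrite /c; nia.
rewrite -[in RHS](@eeDz _ _ (- (k * x)%:Z)); congr ee.
have cE : c%:R = b%:R * q%:R + 1 :> R by rewrite /c -natr1 natrM.
have -> : (- (k * x)%:Z)%:~R = - (k%:R * x%:R) :> R by rewrite mulrNz -natrM.
rewrite !natrM natrB //.
have b0' : b%:R != 0 :> R by rewrite pnatr_eq0 -lt0n.
have c0' : c%:R != 0 :> R by rewrite pnatr_eq0.
have -> : q%:R = (c%:R - 1) / b%:R :> R by rewrite cE addrK mulrC mulKf.
by field; rewrite b0' c0'.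
Qed.

(** F F' - L L' = F (F' - L') + (F - L) L' with |F| = 1. The p-th mean of L' is at most 4 (1 +
    sigma') <= 8, and the column sums factorize by the Chinese remainder theorem; the triangle
    inequality for p-th powers costs another 4. *)
Lemma low_rank_approx_crt (b d q d' : nat) (sigma sigma' : R) :
  (0 < b)%N -> 0 <= sigma -> 0 <= sigma' -> sigma' <= 1 ->
  low_rank_approx b d sigma -> low_rank_approx (b * q).+1 d' sigma' ->
  low_rank_approx (b * (b * q).+1) (d * d') (4 * sigma' + 32 * sigma).
Proof.
set c := (b * q).+1 => b0 s0 s0' s1' [L rL hL] [L' rL' hL'].
have c0 : (0 < c)%N by [].
have cop : coprime b c by rewrite /c /coprime -addn1 mulnC gcdnMDl gcdn1.
exists (fun k x => L k (x %% b)%N * L' (k * (c - q))%N (x %% c)%N).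
  apply: rk_mul.
    exact: (rk_comp id (fun x => (x %% b)%N) rL).
  exact: (rk_comp (fun k => (k * (c - q))%N) (fun x => (x %% c)%N) rL').
move=> k; set k' := (k * (c - q))%N.
have bound x : nc (dft (b * c) k x - L k (x %% b)%N * L' k' (x %% c)%N) `^ p <=
  4 * (1 * nc (dft c k' (x %% c)%N - L' k' (x %% c)%N) `^ p) +
  4 * (nc (dft b k (x %% b)%N - L k (x %% b)%N) `^ p * nc (L' k' (x %% c)%N) `^ p).
  rewrite dft_crt // -/c -/k' -(@dft_modr _ b) // -(@dft_modr _ c k') //.
  set F := dft b _ _; set F' := dft c _ _; set l := L _ _; set l' := L' _ _.
  have -> : F * F' - l * l' = F * (F' - l') + (F - l) * l' by ring.
  rewrite -mulrDr; apply: le_trans (powR_mono (ltW p0) (nc_ge0 _) (ncD _ _)) _.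
  apply: le_trans (powR_add_le p0 (ltW p2) (nc_ge0 _) (nc_ge0 _)) _.
  by rewrite !ncM nc_dft mul1r powRM ?nc_ge0 // mul1r.
apply: le_trans; first by apply: ler_sum => i _; exact: bound.
rewrite big_split /= -!mulr_sumr.
have e1 := @sum_crt R b c (fun=> 1)
  (fun y => nc (dft c k' y - L' k' y) `^ p) cop b0 c0.
have e2 := @sum_crt R b c (fun y => nc (dft b k y - L k y) `^ p)
  (fun y => nc (L' k' y) `^ p) cop b0 c0.
rewrite /= -mulr_sumr in e1; rewrite /= in e2; rewrite e1 e2.
have hb := hL k; have hc := hL' k'.
have hl' : \sum_(x < c) nc (L' k' x) `^ p <= 8 * c%:R.
  apply: (@le_trans _ _ (\sum_(x < c) 4 * (1 + nc (dft c k' x - L' k' x) `^ p))).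
    apply: ler_sum => x _.
    have eL : L' k' x = dft c k' x - (dft c k' x - L' k' x) by ring.
    rewrite {1}eL.
    apply: le_trans (powR_mono (ltW p0) (nc_ge0 _) (ncB _ _)) _.
    apply: le_trans (powR_add_le p0 (ltW p2) (nc_ge0 _) (nc_ge0 _)) _.
    by rewrite nc_dft powR1.
  rewrite -mulr_sumr big_split /= sumr_const card_ord.
  have : sigma' * c%:R <= 1 * c%:R by rewrite ler_wpM2r // ler0n.
  move: hc; set s := \sum_(_ < _) _; set cc := c%:R; lra.
rewrite sumr_const card_ord natrM.
set S := \sum_(_ < b) _ in hb *; set S' := \sum_(_ < c) _ in hc *.
set T := \sum_(_ < c) _ in hl' *.
have S0 : 0 <= S by apply: sumr_ge0 => *; apply: powR_ge0.
have T0 : 0 <= T by apply: sumr_ge0 => *; apply: powR_ge0.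
have bR : 0 <= b%:R :> R by [].
have cR : 0 <= c%:R :> R by [].
have h1 : b%:R * S' <= b%:R * (sigma' * c%:R) by rewrite ler_wpM2l.
have h2 : S * T <= (sigma * b%:R) * (8 * c%:R) by apply: ler_pM.
lra.
Qed.

Lemma low_rank_approx_iter (r : nat) (sigma : R) : 0 < sigma ->
  exists b d : nat, [/\ (0 < b)%N, (d * 4 ^ r <= 3 ^ r * b)%N &
    low_rank_approx b d sigma].
Proof.
elim: r sigma => [|r IH] sigma s0.
  exists 1%N, 1%N; split => //; exists (fun _ _ => 1).
    by apply: rk_ext (rk_tensor (fun _ => 1) (fun _ => 1)) => x y; rewrite mulr1.
  move=> k; rewrite big_ord1 /dft mulr0 mul0r ee0 subrr nc0 powR0 ?gt_eqF //.
  by rewrite mulr1 ltW.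
(* The errors are split so that 4 (sigma / 8) + 32 (sigma / 64) = sigma. *)
have [b [d [b0 bd gd]]] := IH (sigma / 64) ltac:(by apply: divr_gt0).
have s1 : 0 < Num.min 1 (sigma / 8) by rewrite lt_min ltr01 divr_gt0.
have [n0 hn0] := low_rank_approx_base s1.
(* The new order is 1 modulo [b], hence coprime to it, and at least [n0]. *)
have [||d' d'n g'] := hn0 (b * n0).+1 => //; first by nia.
exists (b * (b * n0).+1)%N, (d * d')%N; split.
- by rewrite muln_gt0 b0.
- rewrite !expnS.
  have := leq_mul bd d'n; set X := (4 ^ r)%N; set Y := (3 ^ r)%N; nia.
have m1 : Num.min 1 (sigma / 8) <= 1 by rewrite ge_min lexx.
have s640 : 0 <= sigma / 64 by rewrite divr_ge0 // ltW.
have [L rL hL] := low_rank_approx_crt b0 s640 (ltW s1) m1 gd g'.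
exists L => // k; apply: le_trans (hL k) _.
rewrite ler_wpM2r ?ler0n //.
have : Num.min 1 (sigma / 8) <= sigma / 8 by rewrite ge_min lexx orbT.
lra.
Qed.

(** Each round multiplies the ratio of rank to order by 3/4, and (4/3)^m >= 1 + m/3, so 3 G rounds
    reach the gain G. *)
Lemma nonrigid_site (G : nat) (sigma : R) : 0 < sigma ->
  exists b d : nat, [/\ (0 < b)%N, (d * G <= b)%N & low_rank_approx b d sigma].
Proof.
move=> s0.
have [r hr] : exists r, (G * 3 ^ r <= 4 ^ r)%N.
  have bern m : (m * 3 ^ m + 3 * 3 ^ m <= 3 * 4 ^ m)%N.
    by elim: m => // m; rewrite !expnS; set X := (4 ^ m)%N; set Y := (3 ^ m)%N; nia.
  by exists (3 * G)%N; move: (bern (3 * G)%N); lia.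
have [b [d [b0 bd g]]] := low_rank_approx_iter r s0.
exists b, d; split => //.
have x0 : (0 < 3 ^ r)%N by rewrite expn_gt0.
move: hr bd x0; set X := (4 ^ r)%N; set Y := (3 ^ r)%N => hr bd x0.
have : (d * G * Y <= b * Y)%N by nia.
by rewrite leq_pmul2r.
Qed.

End NonRigidSite.

(** * Taylor polynomials for the phases *)

Section Taylor.
Context {R : realType}.
Local Notation C := R[i].
Local Notation nc := (@Normc.normc R).

Lemma exp_partial_le (t : R) n : 0 <= t -> \sum_(s < n) t ^+ s / s`!%:R <= expR t.
Proof.
move=> t0; have := @nondecreasing_cvgn_le R (series (exp_coeff t)) _ _ n.
rewrite /series /= big_mkord; apply; last exact: is_cvg_series_exp_coeff.
apply/nondecreasing_seqP => m; rewrite !/(series _ _) /= big_nat_recr //=.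
by rewrite lerDl exp_coeff_ge0.
Qed.

(** D! s! divides (D+s)!, so t^(D+s) / (D+s)! is at most t^D / D! times t^s / s!; the last factors
    sum to at most e^t. *)
Lemma exp_dominated_tail (u : R^nat) (t : R) D : 0 <= t ->
  cvgn (series u) -> (forall s, `|u s| <= t ^+ s / s`!%:R) ->
  `|limn (series u) - \sum_(s < D) u s| <= t ^+ D / D`!%:R * expR t.
Proof.
move=> t0 cu ub.
have h : (fun n => `|series u n - \sum_(s < D) u s|) @ \oo -->
    `|limn (series u) - \sum_(s < D) u s|.
  by apply: cvg_norm; apply: cvgB => //; apply: cvg_cst.
apply: (cvgr_to_le h); exists D => // n /= Dn.
have -> : \sum_(s < D) u s = series u D by rewrite /series /= big_mkord.
rewrite sub_series_geq //.
apply: le_trans (ler_norm_sum _ _ _) _.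
apply: (@le_trans _ _ (t ^+ D / D`!%:R * \sum_(s < n - D) t ^+ s / s`!%:R)); last first.
  by rewrite ler_wpM2l ?exp_partial_le // divr_ge0 ?exprn_ge0.
rewrite -[D in \sum_(D <= _ < _) _]add0n big_addn big_mkord mulr_sumr.
apply: ler_sum => s _; apply: le_trans (ub _) _.
rewrite exprD mulrACA [t ^+ s * _]mulrC ler_wpM2l ?mulr_ge0 ?exprn_ge0 //.
rewrite -invfM lef_pV2 ?posrE ?mulr_gt0 ?ltr0n ?fact_gt0 // -natrM ler_nat.
rewrite -(@bin_fact (s + D) D) ?leq_addl // addnK leq_pmull // bin_gt0 leq_addl //.
Qed.

Lemma ee_taylor D : exists alpha : nat -> C, forall y : R, 0 <= y ->
  nc (ee y - \sum_(s < D) alpha s * (y ^+ s)%:C%C) <=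
  2 * ((2 * pi * y) ^+ D / D`!%:R * expR (2 * pi * y)).
Proof.
pose ac s : R := (~~ odd s)%:R * (-1) ^+ s./2 * (2 * pi) ^+ s / s`!%:R.
pose as_ s : R := (odd s)%:R * (-1) ^+ s.-1./2 * (2 * pi) ^+ s / s`!%:R.
exists (fun s => (ac s +i* as_ s)%C) => y y0.
have t0 : 0 <= 2 * pi * y by rewrite !mulr_ge0 // pi_ge0.
have hc : `|cos (2 * pi * y) - \sum_(s < D) ac s * y ^+ s| <=
    (2 * pi * y) ^+ D / D`!%:R * expR (2 * pi * y).
  have -> : \sum_(s < D) ac s * y ^+ s = \sum_(s < D) cos_coeff (2 * pi * y) s.
    by apply: eq_bigr => s _; rewrite /ac /cos_coeff /= -?exprnP !exprMn; ring.
  rewrite unlock; apply: exp_dominated_tail => //; first exact: is_cvg_series_cos_coeff.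
  move=> s; move: t0; set t := 2 * pi * y => t0; rewrite /cos_coeff /= !normrM normfV !normr_nat !normrX normrN normr1.
  rewrite expr1n mulr1 (ger0_norm t0).
  by case: odd; rewrite ?mul0r ?mul1r // divr_ge0 ?exprn_ge0.
have hs : `|sin (2 * pi * y) - \sum_(s < D) as_ s * y ^+ s| <=
    (2 * pi * y) ^+ D / D`!%:R * expR (2 * pi * y).
  have -> : \sum_(s < D) as_ s * y ^+ s = \sum_(s < D) sin_coeff (2 * pi * y) s.
    by apply: eq_bigr => s _; rewrite /as_ /sin_coeff /= -?exprnP !exprMn; ring.
  rewrite unlock; apply: exp_dominated_tail => //; first exact: is_cvg_series_sin_coeff.
  move=> s; move: t0; set t := 2 * pi * y => t0; rewrite /sin_coeff /= !normrM normfV !normr_nat !normrX normrN normr1.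
  rewrite expr1n mulr1 (ger0_norm t0).
  by case: odd; rewrite ?mul0r ?mul1r // divr_ge0 ?exprn_ge0.
rewrite mulr_natl mulr2n; apply: le_trans (nc_le_ReIm _) _.
rewrite Re_add Im_add Re_opp Im_opp Re_sum Im_sum /=.
apply: lerD.
  rewrite (eq_bigr (fun s : 'I_D => ac s * y ^+ s)) // => s _.
  by rewrite mulr0 subr0.
rewrite (eq_bigr (fun s : 'I_D => as_ s * y ^+ s)) // => s _.
by rewrite mulr0 add0r.
Qed.

(** The degree is linear in the length m of the interval: with K = 2 pi and D = c m, (K m)^D / D! <=
    (K e / c)^D <= 2^-D and e^(K m) <= 2^((c-1) m), and the product is at most 2^-m. *)
Lemma ee_taylor_geometric : exists c : nat, forall m : nat,
  exists alpha : nat -> C, forall y : R, 0 <= y <= m%:R ->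
  nc (ee y - \sum_(s < c * m) alpha s * (y ^+ s)%:C%C) <= 2 * 2^-1 ^+ m.
Proof.
pose K : R := 2 * pi.
have K0 : 0 < K by rewrite mulr_gt0 // pi_gt0.
have e0 : 0 < expR 1 :> R := expR_gt0 _.
(* The first bound gives K e / c <= 1/2, the second 2 e^K <= c <= 2^c; the 1 keeps [c] positive. *)
pose c := (Num.bound (2 * K * expR 1) + Num.bound (2 * expR K) + 1)%N.
have c1 : 2 * K * expR 1 <= c%:R.
  rewrite /c -addnA natrD; apply: le_trans (ltW (archi_boundP _)) _.
    by rewrite mulr_ge0 ?expR_ge0 // mulr_ge0 // ltW.
  by rewrite lerDl.
have c2 : 2 * expR K <= 2 ^+ c.
  apply: (@le_trans _ _ c%:R).
    rewrite /c addnAC natrD; apply: le_trans (ltW (archi_boundP _)) _.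
      by rewrite mulr_ge0 ?expR_ge0.
    by rewrite lerDr.
  by rewrite -natrX ler_nat ltnW // ltn_expl.
have c0 : 0 < c%:R :> R by rewrite ltr0n /c addn1.
exists c => m; have [alpha ha] := ee_taylor (c * m).
exists alpha => y /andP[y0 ym]; apply: le_trans (ha y y0) _.
rewrite ler_pM2l // -/K.
have Ky0 : 0 <= K * y by rewrite mulr_ge0 // ltW.
have Kym : K * y <= K * m%:R by rewrite ler_pM2l.
set D := (c * m)%N.
have DD : D%:R ^+ D / D`!%:R <= expR 1 ^+ D :> R.
  rewrite -expRM_natr mul1r; case: D => [|n]; first by rewrite expR0 expr0 fact0 divr1.
  by apply: le_trans (expR_ge1Dxn n _); rewrite // lerDr.
have h1 : (K * m%:R) ^+ D / D`!%:R <= 2^-1 ^+ D :> R.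
  have -> : K * m%:R = K / c%:R * D%:R :> R.
    by rewrite /D natrM mulrA divfK ?gt_eqF.
  rewrite exprMn -mulrA.
  apply: (@le_trans _ _ ((K / c%:R) ^+ D * expR 1 ^+ D)).
    by rewrite ler_wpM2l // exprn_ge0 // divr_ge0 // ltW.
  have q : K / c%:R * expR 1 <= 2^-1.
    by rewrite mulrAC ler_pdivrMr // ler_pdivlMl // [leLHS]mulrA.
  have q0 : 0 <= K / c%:R * expR 1 by rewrite mulr_ge0 ?expR_ge0 // divr_ge0 // ltW.
  by rewrite -exprMn; apply: lerXn2r; rewrite ?nnegrE ?invr_ge0.
have h2 : expR (K * y) <= (2 ^+ c / 2) ^+ m :> R.
  apply: (@le_trans _ _ (expR K ^+ m)).
    by rewrite -expRM_natr ler_expR.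
  apply: lerXn2r; rewrite ?nnegrE ?expR_ge0 ?divr_ge0 ?exprn_ge0 //.
  by rewrite ler_pdivlMr // mulrC.
apply: (@le_trans _ _ (2^-1 ^+ D * (2 ^+ c / 2) ^+ m)).
  apply: ler_pM; rewrite ?expR_ge0 ?divr_ge0 ?exprn_ge0 //.
  apply: le_trans h1; rewrite ler_wpM2r ?invr_ge0 // lerXn2r ?nnegrE //.
  by apply: le_trans Ky0 _.
rewrite /D exprM -exprMn exprVn mulrA mulVf ?mul1r //.
Qed.

End Taylor.

(** * Digit expansions and twiddle phases *)

Lemma rk_map (K K' : comPzRingType) (h : {rmorphism K -> K'}) X Y
    (f : X -> Y -> K) n : rk f n -> rk (fun x y => h (f x y)) n.
Proof.
case=> T Tn [A [B hf]]; exists T => //.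
exists (fun x t => h (A x t)), (fun t y => h (B t y)) => x y.
by rewrite hf rmorph_sum; apply: eq_bigr => t _; rewrite rmorphM.
Qed.

Lemma sum_ord_mul (V : nmodType) (b M : nat) (f : nat -> V) :
  \sum_(j < b * M) f j = \sum_(a < b) \sum_(c < M) f (a * M + c)%N.
Proof.
elim: b => [|b IH]; first by rewrite mul0n !big_ord0.
rewrite big_ord_recr /= -IH mulSnr.
rewrite big_split_ord /=; congr (_ + _).
Qed.

Lemma sum_pow2_le J s : (\sum_(i < s.+1) 2 ^ (J + (s - i)) <= 2 ^ (J.+1 + s))%N.
Proof.
elim: s => [|s IH].
  by rewrite big_ord_recl big_ord0 !addn0 expnS; lia.
rewrite big_ord_recl /= subn0.
under eq_bigr do rewrite /bump /= add1n subSS.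
apply: leq_trans (leq_add (leqnn _) IH) _.
by rewrite -addSnnS addnS expnS mul2n addnn.
Qed.

Section Digits.
Context {R : realType}.
Local Notation C := R[i].
Local Notation nc := (@Normc.normc R).

(** All powers are treated at once so that the estimate can be iterated over the digits. In the
    binomial expansion the powers of [g] have rank one, and the ranks 2^(J + s - i) sum to at most
    2^(J + 1 + s). *)
Lemma rk_pow_add X Y (f g : X -> Y -> R) (J : nat) :
  (forall s, rk (fun x y => f x y ^+ s) (2 ^ (J + s))) ->
  (forall s, rk (fun x y => g x y ^+ s) 1) ->
  forall s, rk (fun x y => (f x y + g x y) ^+ s) (2 ^ (J.+1 + s)).
Proof.
move=> hf hg s; apply: rk_le (sum_pow2_le J s) _.
apply: rk_ext (rk_sum (index_enum 'I_s.+1) (P := xpredT)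
  (f := fun (i : 'I_s.+1) x y => 'C(s, i)%:R * (f x y ^+ (s - i) * g x y ^+ i)) _).
  by move=> x y; rewrite exprDn; apply: eq_bigr => i _; rewrite mulr_natl.
move=> i _; apply: rk_scale; rewrite -[X in rk _ X]muln1.
exact: rk_mul (hf _) (hg _).
Qed.

(* In base b write k = k_0 + b k' and let a be the leading digit of j; then
   k j / b^(J+1) = k_0 a / b + (k_0 / b) (j' / b^J) + k' j' / b^J modulo 1. The
   middle terms have bounded size and are collected in y. *)
Lemma digit_factorization (b Q J : nat) : (0 < b)%N -> (0 < Q)%N ->
  exists (kap dig : nat -> nat -> nat) (y : nat -> nat -> R),
  [/\ (forall k i, (kap k i < b)%N),
      (forall j i, (dig j i < b)%N),
      (forall k j, (k < b ^ J)%N -> (j < b ^ J * Q)%N ->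
        0 <= y k j <= J%:R /\
        dft (b ^ J * Q) k j =
          (\prod_(i < J) dft b (kap k i) (dig j i)) * ee (y k j)),
      (forall s, rk (fun k j => y k j ^+ s) (2 ^ (J + s))) &
      (forall g : 'I_J -> nat -> R,
        \sum_(j < b ^ J * Q) \prod_(i < J) g i (dig j i) =
        Q%:R * \prod_(i < J) \sum_(c < b) g i c)].
Proof.
move=> b0 Q0; elim: J => [|J [kap [dig [y [kapb digb fact rky sumg]]]]].
  exists (fun _ _ => 0%N), (fun _ _ => 0%N), (fun _ _ => 0); split => //.
  - move=> k j; rewrite expn0 ltnS leqn0 => /eqP -> _; split; first by rewrite lexx.
    by rewrite big_ord0 mul1r /dft !mul0r.
  - move=> s; apply: (@rk_le _ _ _ _ 1); first by rewrite expn_gt0.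
    by apply: rk_ext (rk_tensor (fun _ => 0 ^+ s) (fun _ => 1)) => *; rewrite mulr1.
  - move=> g; under eq_bigr do rewrite big_ord0.
    by rewrite sumr_const card_ord expn0 mul1n big_ord0 mulr1.
set M := (b ^ J * Q)%N in fact sumg *.
have M0 : (0 < M)%N by rewrite muln_gt0 expn_gt0 b0.
have bM : (b ^ J.+1 * Q = b * M)%N by rewrite expnS mulnA.
clearbody M.
(* The middle term is a function of [k] times a function of [j], so its powers have rank one, and it
   lies in [0, 1]. *)
pose t (k j : nat) : R := (k %% b)%:R / b%:R * ((j %% M)%:R / M%:R).
exists (fun k i => if i is i'.+1 then kap (k %/ b)%N i' else k %% b)%N,
  (fun j i => if i is i'.+1 then dig (j %% M)%N i' else ((j %/ M) %% b)%N),
  (fun k j => y (k %/ b)%N (j %% M)%N + t k j); split.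
- by move=> k [|i] //; rewrite ltn_mod.
- by move=> j [|i] //; rewrite ltn_mod.
- move=> k j kb; rewrite bM => jb.
  have kb' : (k %/ b < b ^ J)%N by rewrite ltn_divLR // -expnSr.
  have jM : (j %% M < M)%N by rewrite ltn_mod.
  have [/andP[y0 yJ] yE] := fact _ _ kb' jM.
  have t01 : 0 <= t k j <= 1.
    have h (u v : nat) : (0 < v)%N -> 0 <= ((u %% v)%:R / v%:R : R) <= 1.
      move=> v0; apply/andP; split; first by rewrite divr_ge0.
      by rewrite ler_pdivrMr ?ltr0n // mul1r ler_nat ltnW // ltn_mod.
    have /andP[h1 h2] := h k b b0; have /andP[h3 h4] := h j M M0.
    by rewrite /t mulr_ge0 //= mulr_ile1.
  split.
    case/andP: t01 => t0 t1; rewrite addr_ge0 //= -natr1 lerD //.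
  rewrite big_ord_recl /= (modn_small (m := (j %/ M)%N)); last by rewrite ltn_divLR.
  under eq_bigr do rewrite /bump /= ?add1n.
  set P := \prod_(_ < _) _; rewrite eeD -mulrA (mulrA P) -yE.
  (* The integer dropped modulo 1 is the product of the two quotients. *)
  rewrite /dft -!eeD -[RHS](@eeDn _ _ ((k %/ b) * (j %/ M))); congr ee.
  have bR : b%:R != 0 :> R by rewrite pnatr_eq0 -lt0n.
  have MR : M%:R != 0 :> R by rewrite pnatr_eq0 -lt0n.
  rewrite {1}(divn_eq k b) {1}(divn_eq j M) /t !natrM !natrD !natrM.
  by field; rewrite bR MR.
- apply: rk_pow_add => s.
    exact: (rk_comp (fun k => (k %/ b)%N) (fun j => (j %% M)%N) (rky s)).
  apply: rk_ext (rk_tensor (fun k => ((k %% b)%:R / b%:R) ^+ s)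
    (fun j => ((j %% M)%:R / M%:R) ^+ s)) => k j.
  by rewrite -exprMn.
- move=> g; rewrite bM.
  rewrite (sum_ord_mul b M (fun j => \prod_(i < J.+1)
    g i (if (i : nat) is i'.+1 then dig (j %% M)%N i' else ((j %/ M) %% b)%N))).
  rewrite [in RHS]big_ord_recl mulrCA -(sumg (fun i => g (lift ord0 i))) mulr_suml.
  apply: eq_bigr => a _; rewrite mulr_sumr; apply: eq_bigr => c _.
  rewrite big_ord_recl /= divnMDl // (divn_small (ltn_ord c)) addn0.
  rewrite (modn_small (ltn_ord a)) modnMDl (modn_small (ltn_ord c)).
  by congr (_ * _); apply: eq_bigr => i _; rewrite /bump /= add1n.
Qed.

End Digits.

(** * Tensor powers of one low-rank site *)

Lemma prod_if_card (V : comPzSemiRingType) (I : finType) (T : {set I}) (u v : V) :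
  \prod_i (if i \in T then u else v) = u ^+ #|T| * v ^+ #|~: T|.
Proof.
rewrite big_if /= prodr_const; congr (_ * _).
by rewrite -prodr_const; apply: eq_bigl => i; rewrite inE.
Qed.

Section DigitApprox.
Context {R : realType} (p : R).
Hypotheses (p1 : 1 <= p) (p2 : p < 2).
Local Notation C := R[i].
Local Notation nc := (@Normc.normc R).

Let p0 : 0 < p. Proof. exact: lt_le_trans p1. Qed.

(** A gain H^2 at half of the sites or more amounts to a gain of H per site. *)
Lemma prod_if_nat_le (J b d H : nat) (T : {set 'I_J}) : (0 < H)%N ->
  (d * H ^ 2 <= b)%N -> (J <= 2 * #|T|)%N ->
  ((\prod_(i < J) (if i \in T then d else b)) * H ^ J <= b ^ J)%N.
Proof.
move=> H0 dH JT.
have -> : (\prod_(i < J) (if i \in T then d else b) = d ^ #|T| * b ^ #|~: T|)%N.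
  rewrite big_if /= prod_nat_const; congr (_ * _)%N.
  by rewrite -prod_nat_const; apply: eq_bigl => i; rewrite inE.
have cJ : (#|T| + #|~: T| = J)%N by rewrite cardsC card_ord.
rewrite -[in X in (_ <= X)%N]cJ expnD mulnAC leq_mul2r; apply/orP; right.
apply: (@leq_trans (d ^ #|T| * H ^ (2 * #|T|))%N).
  by rewrite leq_mul2l leq_pexp2l // orbT.
by rewrite expnM -expnMn; case: #|T| => // n; rewrite leq_exp2r.
Qed.

Lemma powR_prod I (r : seq I) (P : pred I) (F : I -> R) :
  (forall i, P i -> 0 <= F i) ->
  (\prod_(i <- r | P i) F i) `^ p = \prod_(i <- r | P i) F i `^ p.
Proof.
move=> F0; elim: r => [|i r IH]; first by rewrite !big_nil powR1.
rewrite !big_cons; case: ifP => Pi //.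
by rewrite powRM ?IH ?F0 // prodr_ge0.
Qed.

Lemma sum_pow2_shift J n : (\sum_(s < n) 2 ^ (J + s) <= 2 ^ (J + n))%N.
Proof.
elim: n => [|n IH]; first by rewrite big_ord0.
by rewrite big_ord_recr /= addnS expnS mul2n -addnn leq_add2r.
Qed.

Section Tensor.
Variables (b d J : nat) (L : nat -> nat -> C) (tau : R).
Variables (kap dig : nat -> nat -> nat).
Hypotheses (b0 : (0 < b)%N) (tau0 : 0 <= tau) (tau1 : tau <= 1).
Hypothesis kapb : forall k i, (kap k i < b)%N.
Hypothesis rL : rk L d.
Hypothesis hL : forall k, \sum_(x < b) nc (dft b k x - L k x) `^ p <= tau ^+ 2 * b%:R.

(** The product over the sites of [dft] = [L] + ([dft] - [L]) is expanded; [T] is the set of sites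
    at which the low-rank part is taken. Terms in which [T] contains at least half of the sites have
    small rank and are kept; every other term has the small factor at more than half of the
    sites. *)
Let term (T : {set 'I_J}) (k j : nat) : C :=
  \prod_(i < J) (if i \in T then L (kap k i) (dig j i)
                 else dft b (kap k i) (dig j i) - L (kap k i) (dig j i)).

Let Wmain k j : C := \sum_(T : {set 'I_J} | (J <= 2 * #|T|)%N) term T k j.

Lemma rk_main (H : nat) : (0 < H)%N -> (d * H ^ 2 <= b)%N ->
  exists2 r, rk Wmain r & (r * H ^ J <= 2 ^ J * b ^ J)%N.
Proof.
move=> H0 dH.
exists (\sum_(T : {set 'I_J} | (J <= 2 * #|T|)%N)
    \prod_(i < J) (if i \in T then d else b))%N.
  apply: rk_sum => T _; apply: rk_prod => i _; case: ifP => _.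
    exact: (rk_comp (fun k => kap k i) (fun j => dig j i) rL).
  (* At these sites only the trivial rank bound [b] is available: [kap k i] takes at most [b]
     values. *)
  exact: (@rk_fin _ _ _ _ b (fun k => kap k i)
    (fun a j => dft b a (dig j i) - L a (dig j i))).
rewrite big_distrl /=.
apply: (@leq_trans (\sum_(T : {set 'I_J} | (J <= 2 * #|T|)%N) b ^ J)%N).
  by apply: leq_sum => T hT; apply: prod_if_nat_le.
rewrite big_const iter_addn_0 mulnC leq_mul2r; apply/orP; right.
rewrite -[X in (_ <= 2 ^ X)%N]card_ord -cardsT -card_powerset.
by rewrite powersetT cardsT max_card.
Qed.

(** For a single term the sum over [j] factorizes over the sites, with mean at most 8 where [L]
    occurs and tau^2 at the more than J/2 others, hence (8 tau)^J. There are at most 2^J terms;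
    [powR_sum_le] costs (2^J)^2 and the summation another 2^J, whence the constant 64. *)
Lemma Wmain_error Q k :
  (forall g : 'I_J -> nat -> R,
     \sum_(j < b ^ J * Q) \prod_(i < J) g i (dig j i) =
     Q%:R * \prod_(i < J) \sum_(c < b) g i c) ->
  \sum_(j < b ^ J * Q)
     nc (\prod_(i < J) dft b (kap k i) (dig j i) - Wmain k j) `^ p <=
  (64 * tau) ^+ J * (b ^ J * Q)%:R.
Proof.
move=> sumg.
have hL8 k' : \sum_(x < b) nc (L k' x) `^ p <= 8 * b%:R.
  apply: (@le_trans _ _ (\sum_(x < b) 4 * (1 + nc (dft b k' x - L k' x) `^ p))).
    apply: ler_sum => x _.
    have eL : L k' x = dft b k' x - (dft b k' x - L k' x) by ring.
    rewrite {1}eL; apply: le_trans (powR_mono (ltW p0) (nc_ge0 _) (ncB _ _)) _.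
    apply: le_trans (powR_add_le p0 (ltW p2) (nc_ge0 _) (nc_ge0 _)) _.
    by rewrite nc_dft powR1.
  rewrite -mulr_sumr big_split /= sumr_const card_ord.
  have : tau ^+ 2 * b%:R <= 1 * b%:R by rewrite ler_wpM2r ?ler0n // expr_le1.
  move: (hL k'); set s := \sum_(_ < _) _; set cc := b%:R; set tt := tau ^+ 2.
  lra.
have WE j : \prod_(i < J) dft b (kap k i) (dig j i) = \sum_T term T k j.
  rewrite /term -bigA_distr; apply: eq_bigr => i _.
  by rewrite [RHS]addrC subrK.
have diff j : \prod_(i < J) dft b (kap k i) (dig j i) - Wmain k j =
    \sum_(T : {set 'I_J} | ~~ (J <= 2 * #|T|)%N) term T k j.
  rewrite WE (bigID (fun T : {set 'I_J} => (J <= 2 * #|T|)%N)) /=.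
  by rewrite /Wmain addrAC subrr add0r.
have card2 (P : pred {set 'I_J}) : (#|P| <= 2 ^ J)%N.
  rewrite -[X in (_ <= 2 ^ X)%N]card_ord -cardsT -card_powerset.
  by rewrite powersetT cardsT max_card.
apply: (@le_trans _ _ (\sum_(j < b ^ J * Q) (2 ^ J)%:R ^+ 2 *
   \sum_(T : {set 'I_J} | ~~ (J <= 2 * #|T|)%N) nc (term T k j) `^ p)).
  apply: ler_sum => j _; rewrite diff.
  apply: le_trans (powR_mono (ltW p0) (nc_ge0 _) (nc_sum _ _ _)) _.
  apply: powR_sum_le => //.
  - exact: ltW.
  - apply: leq_trans (count_size _ _) _.
    by apply: leq_trans (card2 predT); rewrite cardT enumT.
  - by rewrite expn_gt0.
  - by move=> T _; apply: nc_ge0.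
have termP (T : {set 'I_J}) : ~~ (J <= 2 * #|T|)%N ->
    \sum_(j < b ^ J * Q) nc (term T k j) `^ p <=
    (8 * tau) ^+ J * (b ^ J * Q)%:R.
  move=> hT.
  pose g (i : 'I_J) (c : nat) : R :=
    nc (if i \in T then L (kap k i) c
        else dft b (kap k i) c - L (kap k i) c) `^ p.
  have gE j : nc (term T k j) `^ p = \prod_(i < J) g i (dig j i).
    by rewrite /term nc_prod powR_prod // => i _; apply: nc_ge0.
  under eq_bigr do rewrite gE.
  have -> : (8 * tau) ^+ J * (b ^ J * Q)%:R = Q%:R * ((8 * tau) ^+ J * (b ^ J)%:R).
    by rewrite natrM mulrA mulrC.
  rewrite sumg; apply: ler_wpM2l; first exact: ler0n.
  apply: (@le_trans _ _ (\prod_(i < J) (if i \in T then 8 * b%:R else tau ^+ 2 * b%:R))).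
    apply: ler_prod => i _; rewrite sumr_ge0 /=; last by move=> *; apply: powR_ge0.
    by rewrite /g; case: ifP => _.
  have cJ : (#|T| + #|~: T| = J)%N by rewrite cardsC card_ord.
  have uJ : (J <= 2 * #|~: T|)%N by move: hT cJ; lia.
  rewrite prod_if_card (exprMn #|T| 8 b%:R) (exprMn #|~: T| (tau ^+ 2) b%:R).
  rewrite mulrACA -(exprD b%:R) cJ natrX (exprMn J 8 tau).
  apply: ler_wpM2r; first by rewrite exprn_ge0.
  apply: ler_pM; rewrite ?exprn_ge0 //.
    rewrite ler_weXn2l ?ler1n //; move: cJ; lia.
  by rewrite -exprM; apply: ler_wiXn2l.
rewrite -mulr_sumr exchange_big /=.
apply: (@le_trans _ _ ((2 ^ J)%:R ^+ 2 *
   \sum_(T : {set 'I_J} | ~~ (J <= 2 * #|T|)%N) (8 * tau) ^+ J * (b ^ J * Q)%:R)).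
  by rewrite ler_wpM2l ?exprn_ge0 ?ler0n //; apply: ler_sum.
rewrite sumr_const -[_ *+ #|_|]mulr_natl.
have X0 : 0 <= (8 * tau) ^+ J * (b ^ J * Q)%:R.
  by rewrite mulr_ge0 ?exprn_ge0 ?mulr_ge0 ?ler0n.
apply: (@le_trans _ _ ((2 ^ J)%:R ^+ 2 * ((2 ^ J)%:R * ((8 * tau) ^+ J * (b ^ J * Q)%:R)))).
  rewrite ler_wpM2l ?exprn_ge0 ?ler0n // ler_wpM2r // ler_nat; exact: card2.
rewrite !mulrA -exprSr natrX -exprM mulnC exprM -exprMn.
suff -> : (2 ^+ 3 * (8 * tau) : R) = 64 * tau by [].
by ring.
Qed.

End Tensor.

(* The twiddle phases cost a rank factor exp(O(J)) whose rate does not depend on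
   the base, so a site with a large enough gain compensates for it. *)
Lemma low_rank_digits : exists2 b : nat, (2 < b)%N &
  forall J Q, (0 < Q)%N -> exists r (U : nat -> nat -> C),
  [/\ rk U r, (r * 2 ^ J <= b ^ J)%N &
    forall k, (k < b ^ J)%N ->
    \sum_(j < b ^ J * Q) nc (dft (b ^ J * Q) k j - U k j) `^ p <=
    52 * (b ^ J * Q)%:R * (2^-1 ^+ J) `^ p].
Proof.
have [c tay] := @ee_taylor_geometric R.
(* H^J = 2^J 2^(J + c J) 2^J pays for the number of sets [T], for the rank of the Taylor polynomial
   of the phases, and for the gain 2^J that is claimed. *)
pose H := (2 ^ (3 + c))%N.
have H0 : (0 < H)%N by rewrite expn_gt0.
(* 64 tau = 2^-2, so that the site error becomes (2^-J)^2 <= (2^-J)^p. *)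
pose tau : R := 256^-1.
have tau0 : 0 < tau by rewrite invr_gt0 ltr0n.
have tau1 : tau <= 1 by rewrite invf_le1 ?ltr0n // ler1n.
have [b [d [b0 dH [L rL hL]]]] := nonrigid_site p1 p2 (H ^ 2) (exprn_gt0 2 tau0).
exists b.
  apply: leq_trans dH.
  (* Rank 0 would force [L] = 0 and a mean error 1 > tau^2; hence the rank is positive and b >=
     H^2. *)
  case: d rL => [|d] rL.
    have L0 k x : L k x = 0.
      case: rL => T T0 [A [B ->]]; rewrite big1 // => t _.
      have : (0 < #|T|)%N by apply/card_gt0P; exists t.
      by rewrite ltnNge T0.
    have := hL 0%N; under eq_bigr do rewrite L0 subr0 nc_dft powR1.
    rewrite sumr_const card_ord; have : 0 < b%:R :> R by rewrite ltr0n.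
    move=> bR; rewrite -{1}[b%:R]mul1r ler_pM2r // leNgt.
    by rewrite exprn_ilt1 ?(ltW tau0) // invf_lt1 ?ltr1n.
  apply: leq_trans (_ : H ^ 2 <= _)%N; last by rewrite leq_pmull.
  have h4 : (2 ^ 2 <= 2 ^ ((3 + c) * 2))%N by rewrite leq_exp2l //; lia.
  by rewrite /H -expnM; apply: leq_trans h4.
move=> J Q Q0.
have [kap [dig [y [kapb digb fact rky sumg]]]] := @digit_factorization R b Q J b0 Q0.
have [alpha ha] := tay J.
have [r1 rk1 r1H] := rk_main J dig kapb rL H0 dH.
pose E k j : C := \sum_(s < c * J) alpha s * (y k j ^+ s)%:C%C.
have rkE : rk E (2 ^ (J + c * J)).
  apply: rk_le (sum_pow2_shift J (c * J)) _.
  apply: rk_sum => s _; apply: (rk_scale (fun _ => alpha s)).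
  exact: (rk_map (real_complex R) (rky s)).
eexists; eexists; split; first exact: (rk_mul rk1 rkE).
  have HJ : (0 < H ^ J)%N by rewrite expn_gt0 H0.
  have HE : (H ^ J = 2 ^ J * 2 ^ (J + c * J) * 2 ^ J)%N.
    by rewrite /H -expnM -!expnD; congr (2 ^ _)%N; lia.
  rewrite -(leq_pmul2r HJ).
  apply: (@leq_trans (2 ^ J * b ^ J * (2 ^ (J + c * J) * 2 ^ J))%N); last first.
    by rewrite HE; set X := (2 ^ J)%N; set Y := (2 ^ _)%N; set Z := (b ^ J)%N; lia.
  apply: leq_trans (_ : (r1 * H ^ J) * (2 ^ (J + c * J) * 2 ^ J) <= _)%N; last first.
    by rewrite leq_mul2r r1H orbT.
  by set X := (2 ^ J)%N; set Y := (2 ^ (J + _))%N; set Z := (H ^ J)%N; lia.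
move=> k kb; set N := (b ^ J * Q)%N in fact sumg *.
set e := 2^-1 ^+ J in ha *.
have e0 : 0 <= e by rewrite exprn_ge0 // invr_ge0.
have e1 : e <= 1 by rewrite exprn_ile1 ?invr_ge0 // invf_le1 ?ltr0n // ler1n.
pose W j : C := \prod_(i < J) dft b (kap k i) (dig j i).
pose W' j : C := \sum_(T : {set 'I_J} | (J <= 2 * #|T|)%N)
  \prod_(i < J) (if i \in T then L (kap k i) (dig j i)
                 else dft b (kap k i) (dig j i) - L (kap k i) (dig j i)).
(* [W] and the phase have modulus 1 and |E| <= 3; with 2^p <= 4 and 3^p <= 9 the final constant is
   52 = 4 (4 + 9). *)
have pointwise (j : 'I_N) : nc (dft N k j - W' j * E k j) `^ p <=
    4 * (4 * e `^ p + 9 * nc (W j - W' j) `^ p).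
  have [yJ ->] := fact k j kb (ltn_ord j).
  have Ee := ha _ yJ; rewrite -/(E k j) in Ee.
  rewrite -/(W j).
  have -> : W j * ee (y k j) - W' j * E k j =
    W j * (ee (y k j) - E k j) + (W j - W' j) * E k j by ring.
  have W1 : nc (W j) = 1 by rewrite /W nc_prod big1 // => i _; rewrite nc_dft.
  have E3 : nc (E k j) <= 3.
    have -> : E k j = ee (y k j) - (ee (y k j) - E k j) by ring.
    apply: le_trans (ncB _ _) _; rewrite nc_ee.
    by move: Ee e1; lra.
  apply: le_trans (_ : (2 * e + 3 * nc (W j - W' j)) `^ p <= _).
    apply: powR_mono; rewrite ?nc_ge0 ?(ltW p0) //.
    apply: le_trans (ncD _ _) _; rewrite !ncM W1 mul1r; apply: lerD => //.
    by rewrite mulrC; apply: ler_wpM2r => //; apply: nc_ge0.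
  apply: le_trans (powR_add_le p0 (ltW p2) _ _) _.
  - by rewrite mulr_ge0.
  - by rewrite mulr_ge0 // nc_ge0.
  rewrite !powRM ?nc_ge0 //; apply: ler_wpM2l => //; apply: lerD.
    apply: ler_wpM2r; first exact: powR_ge0.
    by have := @powR_le2 R 2 p (ler1n _ 2) (ltW p2); rewrite -natrX.
  apply: ler_wpM2r; first exact: powR_ge0.
  by have := @powR_le2 R 3 p (ler1n _ 3) (ltW p2); rewrite -natrX.
apply: le_trans; first by apply: ler_sum => j _; exact: pointwise.
rewrite -mulr_sumr big_split /= -!mulr_sumr sumr_const card_ord.
have hW := Wmain_error kap b0 (ltW tau0) tau1 hL k sumg.
rewrite -/N in hW.
have -> : 52 * N%:R * e `^ p = 4 * (4 * (e `^ p *+ N) + 9 * (e `^ p * N%:R)).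
  by rewrite -[_ *+ N]mulr_natr; ring.
apply: ler_wpM2l => //; rewrite lerD2l; apply: ler_wpM2l => //.
apply: le_trans hW _; apply: ler_wpM2r; first exact: ler0n.
have -> : 64 * tau = 2^-1 ^+ 2 by rewrite /tau; field.
rewrite -exprM mulnC exprM -/e -[e ^+ 2]powR_mulrn //.
by apply: ger_powR; [rewrite e1 andbT /e exprn_gt0 // invr_gt0 | exact: ltW].
Qed.

End DigitApprox.

(** * Integration on the circle *)

Section TorusMeasure.
Context {R : realType}.
Local Notation C := R[i].
Local Notation nc := (@Normc.normc R).
Local Notation mT := (torus_measure R).
Local Notation T := (Real.sort R).

Definition unit_itv : set T := `[0, 1[%classic.

Definition cell (M j : nat) : set T := `[j%:R / M%:R, j.+1%:R / M%:R[%classic.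

Lemma measurable_unit_itv : measurable unit_itv.
Proof. exact: measurable_itv. Qed.

Lemma measurable_cell M j : measurable (cell M j).
Proof. exact: measurable_itv. Qed.
Hint Resolve measurable_unit_itv measurable_cell : core.

Lemma torus_measureE (A : set T) : mT A = lebesgue_measure (A `&` unit_itv).
Proof. by []. Qed.

Lemma torus_setT : mT setT = 1%:E.
Proof.
by rewrite torus_measureE setTI lebesgue_measure_itv /= lte_fin ltr01 oppr0 adde0.
Qed.

Lemma cell_sub M j : (j < M)%N -> cell M j `<=` unit_itv.
Proof.
move=> jM x; rewrite /cell /unit_itv /= !in_itv /= => /andP[h1 h2].
have M0 : 0 < M%:R :> R by rewrite ltr0n (leq_ltn_trans _ jM).
apply/andP; split; first by apply: le_trans h1; rewrite divr_ge0.
apply: (lt_le_trans h2); rewrite ler_pdivrMr // mul1r ler_nat //.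
Qed.

Lemma torus_cell M j : (j < M)%N -> mT (cell M j) = (M%:R^-1)%:E.
Proof.
move=> jM; rewrite torus_measureE setIidl; last exact: cell_sub.
have M0 : 0 < M%:R :> R by rewrite ltr0n (leq_ltn_trans _ jM).
rewrite lebesgue_measure_itv /= lte_fin ltr_pM2r ?invr_gt0 // ltr_nat ltnSn.
by rewrite -EFinB -mulrBl -natr1 addrAC subrr add0r mul1r.
Qed.

Lemma cellP M (x : T) : (0 < M)%N -> unit_itv x ->
  (Num.truncn (M%:R * x) < M)%N /\ cell M (Num.truncn (M%:R * x)) x.
Proof.
move=> M0; rewrite /unit_itv /= in_itv /= => /andP[x0 x1].
have MR : 0 < M%:R :> R by rewrite ltr0n.
have Mx0 : 0 <= M%:R * x by rewrite mulr_ge0 // ltW.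
have /andP[h1 h2] := truncn_itv Mx0.
split; first by rewrite truncn_lt_nat // -[ltRHS]mulr1 ltr_pM2l.
by rewrite /cell /= in_itv /= ler_pdivrMr // ltr_pdivlMr // [x * _]mulrC h1 h2.
Qed.

Lemma cell_truncn M j (x : T) : (0 < M)%N -> cell M j x -> Num.truncn (M%:R * x) = j.
Proof.
move=> M0; have MR : 0 < M%:R :> R by rewrite ltr0n.
rewrite /cell /= in_itv /= ler_pdivrMr // ltr_pdivlMr // [x * _]mulrC => h.
exact: truncn_def.
Qed.

Lemma ge0_torus_integralE (f : T -> \bar R) :
  measurable_fun setT f -> (forall x, (0 <= f x)%E) ->
  (\int[mT]_x f x = \int[lebesgue_measure]_(x in unit_itv) f x)%E.
Proof.
move=> mf f0.
have mC : measurable (~` unit_itv) by exact: measurableC.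
rewrite (@ge0_negligible_integral _ (measurableTypeR R) R mT setT (~` unit_itv) f) //; last first.
  by rewrite torus_measureE setICl measure0.
rewrite setTD setCK; apply: eq_measure_integral => A mA AD.
by rewrite torus_measureE setIidl.
Qed.

Lemma torus_integral_cells M (f : T -> \bar R) : (0 < M)%N ->
  measurable_fun setT f -> (forall x, (0 <= f x)%E) ->
  (\int[mT]_x f x = \sum_(j < M) \int[mT]_(x in cell M j) f x)%E.
Proof.
move=> M0 mf f0; rewrite ge0_torus_integralE //.
have UE : unit_itv = \big[setU/set0]_(j <- index_enum 'I_M) cell M j.
  apply/seteqP; split => x.
    move=> /(cellP M0)[h1 h2].
    by rewrite -bigcup_seq; exists (Ordinal h1) => //=; rewrite mem_index_enum.
  by rewrite -bigcup_seq => -[j _]; apply: cell_sub.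
rewrite UE ge0_integral_bigsetU.
- apply: eq_bigr => j _; apply: eq_measure_integral => A mA AD.
  by rewrite torus_measureE setIidl //; apply: subset_trans AD _; apply: cell_sub.
- by move=> j; apply: measurable_cell.
- exact: index_enum_uniq.
- move=> i j _ _ [x [xi xj]]; apply/val_inj => /=.
  by rewrite -(cell_truncn M0 xi) -(cell_truncn M0 xj).
- exact: measurable_funTS.
- by [].
Qed.

Definition cmeasurable (f : T -> C) : Prop :=
  measurable_fun setT (fun x => complex.Re (f x)) /\
  measurable_fun setT (fun x => complex.Im (f x)).

Lemma cmeas_nc f : cmeasurable f -> measurable_fun setT (fun x => nc (f x)).
Proof.
move=> [fR fI].
rewrite (_ : (fun x => nc (f x)) =
  (fun x => Num.sqrt (complex.Re (f x) ^+ 2 + complex.Im (f x) ^+ 2))).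
  apply: measurableT_comp; first by apply: continuous_measurable_fun; exact: sqrt_continuous.
  by apply: measurable_funD; apply: measurable_funX.
by apply/funext => x; rewrite ncE.
Qed.

Lemma cmeas_cst c : cmeasurable (fun=> c).
Proof. by split; apply: measurable_cst. Qed.

Lemma cmeasD f g : cmeasurable f -> cmeasurable g -> cmeasurable (fun x => f x + g x).
Proof.
move=> [fR fI] [gR gI]; split.
  by under eq_fun do rewrite Re_add; exact: measurable_funD.
by under eq_fun do rewrite Im_add; exact: measurable_funD.
Qed.

Lemma cmeasM f g : cmeasurable f -> cmeasurable g -> cmeasurable (fun x => f x * g x).
Proof.
move=> [fR fI] [gR gI]; split.
  under eq_fun do rewrite Re_mul.
  by apply: measurable_funB; apply: measurable_funM.
under eq_fun do rewrite Im_mul.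
by apply: measurable_funD; apply: measurable_funM.
Qed.

Lemma cmeasN f : cmeasurable f -> cmeasurable (fun x => - f x).
Proof.
move=> mf; rewrite (_ : (fun x => - f x) = (fun x => -1 * f x)).
  by apply: cmeasM => //; apply: cmeas_cst.
by apply/funext => x; rewrite mulN1r.
Qed.

Lemma cmeasB f g : cmeasurable f -> cmeasurable g -> cmeasurable (fun x => f x - g x).
Proof. by move=> mf mg; apply: cmeasD => //; apply: cmeasN. Qed.

Lemma cmeas_sum I (r : seq I) (P : pred I) (F : I -> T -> C) :
  (forall i, P i -> cmeasurable (F i)) ->
  cmeasurable (fun x => \sum_(i <- r | P i) F i x).
Proof.
move=> h; elim: r => [|i r IH].
  rewrite (_ : (fun x => _) = (fun=> 0)); first exact: cmeas_cst.
  by apply/funext => x; rewrite big_nil.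
case Pi: (P i); last first.
  rewrite (_ : (fun x => _) = (fun x => \sum_(i <- r | P i) F i x)) //.
  by apply/funext => x; rewrite big_cons Pi.
rewrite (_ : (fun x => _) = (fun x => F i x + \sum_(i <- r | P i) F i x)).
  by apply: cmeasD => //; apply: h.
by apply/funext => x; rewrite big_cons Pi.
Qed.

Lemma cmeas_ee (a : R) : cmeasurable (fun x => ee (a * x) : C).
Proof.
have m : measurable_fun [set: T] (fun x : T => 2 * pi * (a * x)).
  by do 2 apply: measurable_funM => //.
split => /=.
  apply: (measurableT_comp (f := @cos R)) m.
  by apply: continuous_measurable_fun; exact: continuous_cos.
apply: (measurableT_comp (f := @sin R)) m.
by apply: continuous_measurable_fun; exact: continuous_sin.
Qed.

End TorusMeasure.
#[global] Hint Resolve measurable_unit_itv measurable_cell : core.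

(** * L_p norms on the circle *)

Section LpNorm.
Context {R : realType}.
Local Notation C := R[i].
Local Notation nc := (@Normc.normc R).
Local Notation mT := (torus_measure R).
Local Notation T := (Real.sort R).
Implicit Types (p : R) (f g : T -> C).

Lemma cmeas_powR p f : cmeasurable f ->
  measurable_fun setT (fun x => (nc (f x) `^ p)%:E).
Proof.
move=> mf; apply/measurable_EFinP.
by apply: (measurableT_comp (f := @powR R ^~ p)) => //; apply: cmeas_nc.
Qed.

Lemma Lp_normE p f :
  Lp_norm p f = ((\int[mT]_x (nc (f x) `^ p)%:E) `^ p^-1)%E.
Proof.
rewrite /Lp_norm unlock /Lnorm; congr (_ `^ _)%E; apply: eq_integral => x _.
by rewrite abse_EFin poweR_EFin ger0_norm ?nc_ge0.
Qed.

Lemma int_powR_ge0 p f : (0 <= \int[mT]_x (nc (f x) `^ p)%:E)%E.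
Proof. by apply: integral_ge0 => x _; rewrite lee_fin powR_ge0. Qed.

Lemma Lp_norm_ge0 p f : (0 <= Lp_norm p f)%E.
Proof. exact: Lnorm_ge0. Qed.

Lemma Lp_norm_leP p f (kappa : R) : 0 < p -> 0 <= kappa ->
  (Lp_norm p f <= kappa%:E)%E =
  (\int[mT]_x (nc (f x) `^ p)%:E <= (kappa `^ p)%:E)%E.
Proof.
move=> p0 k0; rewrite Lp_normE.
have p1 : 0 < p^-1 by rewrite invr_gt0.
have := int_powR_ge0 p f; case: (\int[mT]_x _)%E => [r| |] // r0.
  rewrite poweR_EFin !lee_fin; rewrite lee_fin in r0; apply/idP/idP => h.
    have -> : r = (r `^ p^-1) `^ p by rewrite -powRrM mulVf ?gt_eqF // powRr1.
    by apply: powR_mono h; rewrite ?powR_ge0 // ltW.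
  have -> : kappa = (kappa `^ p) `^ p^-1 by rewrite -powRrM divff ?gt_eqF // powRr1.
  by apply: powR_mono h => //; rewrite ltW.
by rewrite poweRyr ?gt_eqF.
Qed.

Lemma Lp_norm_mono p f g : 0 < p -> cmeasurable f -> cmeasurable g ->
  (forall x, nc (f x) <= nc (g x)) -> (Lp_norm p f <= Lp_norm p g)%E.
Proof.
move=> p0 mf mg fg; rewrite !Lp_normE.
apply: gt0_ler_poweR; rewrite ?invr_ge0 ?(ltW p0) //.
- by rewrite in_itv /= int_powR_ge0 leey.
- by rewrite in_itv /= int_powR_ge0 leey.
apply: ge0_le_integral => //; try exact: cmeas_powR.
- by move=> x _; rewrite lee_fin powR_ge0.
- by move=> x _; rewrite lee_fin powR_mono ?nc_ge0 // ltW.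
Qed.

Lemma Lp_normD p f g : 1 <= p -> cmeasurable f -> cmeasurable g ->
  (Lp_norm p (fun x => f x + g x)%R <= Lp_norm p f + Lp_norm p g)%E.
Proof.
move=> p1 mf mg.
have p0 : 0 < p := lt_le_trans ltr01 p1.
have m := @minkowski_EFin _ _ _ mT (fun x => nc (f x)) (fun x => nc (g x)) p
   (cmeas_nc mf) (cmeas_nc mg) p1.
apply: le_trans m.
have mr : cmeasurable (fun x => (nc (f x) + nc (g x))%:C%C : C).
  by split => //=; apply: measurable_funD; apply: cmeas_nc.
apply: le_trans (Lp_norm_mono p0 (cmeasD mf mg) mr _) _.
  move=> x; rewrite nc_real ger0_norm ?addr_ge0 ?nc_ge0 //; exact: ncD.
rewrite /Lp_norm le_eqVlt; apply/orP; left; apply/eqP; congr Lnorm.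
by apply/funext => x; rewrite nc_real ger0_norm // addr_ge0 ?nc_ge0.
Qed.

Lemma Lp_normZ p c f : 0 < p -> cmeasurable f ->
  (Lp_norm p (fun x => c * f x)%R = (nc c)%:E * Lp_norm p f)%E.
Proof.
move=> p0 mf; rewrite !Lp_normE.
under eq_integral do rewrite ncM powRM ?nc_ge0 // EFinM.
rewrite ge0_integralZl //; first last.
- by rewrite lee_fin powR_ge0.
- by move=> x _; rewrite lee_fin powR_ge0.
- exact: cmeas_powR.
rewrite poweRM ?lee_fin ?powR_ge0 ?int_powR_ge0 // poweR_EFin -powRrM divff ?gt_eqF //.
by rewrite powRr1 // nc_ge0.
Qed.

Lemma Lp_norm0 p : 0 < p -> Lp_norm p (fun=> 0 : C) = 0%E.
Proof.
move=> p0; apply/eqP; rewrite eq_le Lp_norm_ge0 andbT Lp_norm_leP //.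
under eq_integral do rewrite nc0 powR0 ?gt_eqF //.
by rewrite integral0 powR0 ?gt_eqF.
Qed.

Lemma Lp_norm_sum p I (r : seq I) (P : pred I) (F : I -> T -> C) : 1 <= p ->
  (forall i, P i -> cmeasurable (F i)) ->
  (Lp_norm p (fun x => \sum_(i <- r | P i) F i x)%R <=
   \sum_(i <- r | P i) Lp_norm p (F i))%E.
Proof.
move=> p1 mF; have p0 : 0 < p := lt_le_trans ltr01 p1.
elim: r => [|i r IH].
  rewrite big_nil (_ : (fun x => _) = (fun=> 0)) ?Lp_norm0 //.
  by apply/funext => x; rewrite big_nil.
rewrite big_cons; case Pi: (P i); last first.
  apply: le_trans IH; rewrite le_eqVlt; apply/orP; left; apply/eqP; congr Lp_norm.
  by apply/funext => x; rewrite big_cons Pi.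
apply: le_trans (leeD (le_refl _) IH).
apply: le_trans (Lp_normD p1 (mF i Pi) (cmeas_sum r (P := P) mF)).
rewrite le_eqVlt; apply/orP; left; apply/eqP; congr Lp_norm.
by apply/funext => x; rewrite big_cons Pi.
Qed.

Lemma Lp_norm_ae_le p f (tau : R) : 0 < p -> 0 <= tau -> cmeasurable f ->
  {ae mT, forall x, nc (f x) <= tau} -> (Lp_norm p f <= tau%:E)%E.
Proof.
move=> p0 t0 mf fle; rewrite Lp_norm_leP //.
apply: (@le_trans _ _ (\int[mT]_x (cst (tau `^ p)%:E) x)%E).
  apply: ae_ge0_le_integral => //.
  - by move=> x _; rewrite lee_fin powR_ge0.
  - exact: cmeas_powR.
  - by move=> x _; rewrite lee_fin powR_ge0.
  apply: (@filterS _ _ (ae_filter_ringOfSetsType mT) _ _ _ fle) => x h _.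
  by rewrite lee_fin powR_mono ?nc_ge0 // ltW.
by rewrite integral_cst // [X in (_ * X)%E]torus_setT mule1.
Qed.

Lemma Lp_norm_le_bound p f (B : R) : 0 < p -> cmeasurable f ->
  (forall x, nc (f x) <= B) -> (Lp_norm p f <= B%:E)%E.
Proof.
move=> p0 mf fB; apply: Lp_norm_ae_le => //; last exact: aeW.
exact: le_trans (nc_ge0 _) (fB 0).
Qed.

Lemma Lp_bounded p f (B : R) : 0 < p -> periodic f 1 -> cmeasurable f ->
  (forall x, nc (f x) <= B) -> Lp p f.
Proof.
move=> p0 pf mf fB; case: (mf) => mR mI; split => //.
by apply: le_lt_trans (Lp_norm_le_bound p0 mf fB) _; rewrite ltry.
Qed.

Lemma Lp_cmeas p f : Lp p f -> cmeasurable f.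
Proof. by case. Qed.

Lemma Lp_lin p (a : C) f g : 1 <= p -> Lp p f -> Lp p g ->
  Lp p (fun x => a * f x + g x).
Proof.
move=> p1 Lf Lg; have p0 : 0 < p := lt_le_trans ltr01 p1.
have mf := Lp_cmeas Lf; have mg := Lp_cmeas Lg.
have maf : cmeasurable (fun x => a * f x) by apply: cmeasM => //; apply: cmeas_cst.
have [mR mI] := cmeasD maf mg.
case: Lf => pf _ _ ff; case: Lg => pg _ _ fg.
split => //; first by move=> u; rewrite pf pg.
apply: le_lt_trans (Lp_normD p1 maf mg) _.
rewrite lte_add_pinfty // Lp_normZ // lte_mul_pinfty ?lee_fin ?nc_ge0 //.
Qed.

Lemma Lp_zero p : 1 <= p -> Lp p (fun=> 0 : C).
Proof.
move=> p1; apply: (@Lp_bounded _ _ 0).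
- exact: lt_le_trans p1.
- by move=> u.
- exact: cmeas_cst.
- by move=> x; rewrite nc0.
Qed.

Lemma Lp_sum p I (r : seq I) (P : pred I) (a : I -> C) (F : I -> T -> C) : 1 <= p ->
  (forall i, P i -> Lp p (F i)) ->
  Lp p (fun x => \sum_(i <- r | P i) a i * F i x).
Proof.
move=> p1 h; elim: r => [|i r IH].
  rewrite (_ : (fun x => _) = (fun=> 0)); first exact: Lp_zero.
  by apply/funext => x; rewrite big_nil.
case Pi: (P i); last first.
  rewrite (_ : (fun x => _) = (fun x => \sum_(i <- r | P i) a i * F i x)) //.
  by apply/funext => x; rewrite big_cons Pi.
rewrite (_ : (fun x => _) = (fun x => a i * F i x + \sum_(i <- r | P i) a i * F i x)).
  by apply: Lp_lin => //; apply: h.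
by apply/funext => x; rewrite big_cons Pi.
Qed.

Lemma int_powR_cells_le p f M (delta : nat -> R) : 0 < p -> (0 < M)%N ->
  cmeasurable f ->
  (forall j x, (j < M)%N -> cell M j x -> nc (f x) <= delta j) ->
  (\int[mT]_x (nc (f x) `^ p)%:E <=
   (M%:R^-1 * \sum_(j < M) delta j `^ p)%:E)%E.
Proof.
move=> p0 M0 mf fd.
rewrite (torus_integral_cells M0 (cmeas_powR p mf)); last first.
  by move=> x; rewrite lee_fin powR_ge0.
rewrite mulr_sumr -sumEFin; apply: lee_sum => j _.
apply: (@le_trans _ _ (\int[mT]_(x in cell M j) (cst (delta j `^ p)%:E) x)%E).
  apply: ge0_le_integral => //.
  - exact: measurable_cell.
  - by move=> x _; rewrite lee_fin powR_ge0.
  - by apply: measurable_funTS; apply: cmeas_powR.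
  - by move=> x jx; rewrite lee_fin powR_mono ?nc_ge0 ?fd // ltW.
rewrite integral_cst; last exact: measurable_cell.
by rewrite [X in (_ * X)%E](torus_cell (ltn_ord j)) -EFinM mulrC.
Qed.

End LpNorm.

Section Lipschitz.
Context {R : realType}.
Local Notation C := R[i].
Local Notation nc := (@Normc.normc R).

Lemma ee_lipschitz : exists2 K : R, 0 < K &
  forall s t : R, nc (ee s - ee t) <= K * `|s - t|.
Proof.
have [alpha ha] := @ee_taylor R 1.
(* The coefficients of [ee_taylor] are only known to exist; evaluation at 0 identifies the constant
   one. *)
have a0 : alpha 0%N = 1.
  have := ha 0 (lexx _).
  rewrite big_ord1 expr0 mulr1 ee0 mulr0 expr0n /= mul0r mul0r mulr0 => h.
  have /eqP : nc (1 - alpha 0%N) == 0 by rewrite eq_le h nc_ge0.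
  by move/eqP; rewrite nc_eq0 subr_eq0 => /eqP.
pose K : R := 2 * (2 * pi * expR 1).
have K0 : 0 < K by rewrite !mulr_gt0 ?pi_gt0 ?expR_gt0.
exists K => //.
have pos y : 0 <= y -> nc (ee y - 1) <= K * y.
  move=> y0; case: (leP (2 * pi * y) 1) => hy.
    have := ha y y0; rewrite big_ord1 expr0 mulr1 a0 expr1 (factS 0) fact0 muln1 divr1.
    move/le_trans; apply; rewrite /K -!mulrA ler_pM2l // !mulrA mulrAC.
    rewrite ler_wpM2r // ler_wpM2l ?mulr_ge0 ?pi_ge0 // ler_expR //.
  apply: le_trans (ncB _ _) _; rewrite nc_ee nc1.
  have e1 : 1 <= expR 1 :> R by rewrite -[leLHS]expR0 ler_expR.
  have h1 : 1 <= (2 * pi * y) * expR 1 by rewrite mulr_ege1 // ltW.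
  have -> : K * y = 2 * ((2 * pi * y) * expR 1) by rewrite /K; ring.
  by move: h1; lra.
have sym s t : t <= s -> nc (ee s - ee t) <= K * `|s - t|.
  move=> ts; have -> : ee s - ee t = ee t * (ee (s - t) - 1).
    by rewrite mulrBr -eeD mulr1 subrKC.
  by rewrite ncM nc_ee mul1r ger0_norm ?subr_ge0 // pos ?subr_ge0.
move=> s t; case: (leP t s) => ts; first exact: sym.
by rewrite -ncN opprB distrC; apply: sym; apply: ltW.
Qed.

(** The tangent of t^p at 1, from Young's inequality for the product of t and 1. Suitably scaled, it
    replaces convexity in the Jensen and power mean inequalities below. *)
Lemma powR_bernoulli (p t : R) : 1 <= p -> 0 <= t -> 1 + p * (t - 1) <= t `^ p.
Proof.
move=> p1 t0; have p0 : 0 < p := lt_le_trans ltr01 p1.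
move: p1; rewrite le_eqVlt => /predU1P[<-|p1].
  by rewrite powRr1 // mul1r addrC subrK.
have q0 : 0 < p / (p - 1) by rewrite divr_gt0 // subr_gt0.
have pn : p != 0 by rewrite gt_eqF.
have pn1 : p - 1 != 0 by rewrite gt_eqF // subr_gt0.
have := @conjugate_powR R t 1 p (p / (p - 1)) t0 ler01 p0 q0.
rewrite powR1 mulr1 => h.
have {}h : t <= t `^ p / p + 1 / (p / (p - 1)).
  by apply: h; field; rewrite pn1 pn.
have : p * t <= p * (t `^ p / p + 1 / (p / (p - 1))) by rewrite ler_pM2l.
have -> : p * (t `^ p / p + 1 / (p / (p - 1))) = t `^ p + (p - 1).
  by field; rewrite pn1 pn.
lra.
Qed.

End Lipschitz.

(** * Complex integrals and cell averages *)

Section ComplexIntegral.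
Context {R : realType}.
Local Notation C := R[i].
Local Notation nc := (@Normc.normc R).
Local Notation mT := (torus_measure R).
Local Notation T := (measurableTypeR R).
Implicit Types (D : set T) (f g : T -> C).

Definition cintegrable D f : Prop :=
  mT.-integrable D (fun x => (complex.Re (f x))%:E) /\
  mT.-integrable D (fun x => (complex.Im (f x))%:E).

Definition cint D f : C :=
  ((\int[mT]_(x in D) complex.Re (f x)) +i* (\int[mT]_(x in D) complex.Im (f x)))%C.

Lemma torus_integralE f : torus_integral f = cint setT f.
Proof. by []. Qed.

Lemma cintegrable_sub D f : measurable D -> cintegrable setT f -> cintegrable D f.
Proof. by move=> mD [h1 h2]; split; apply: (integrableS (E := setT)). Qed.

Lemma cintegrableZ D a f : measurable D -> cintegrable D f ->
  cintegrable D (fun x => a * f x).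
Proof.
move=> mD [h1 h2]; split.
  rewrite (_ : (fun x => _) = (fun x => (complex.Re a)%:E * (complex.Re (f x))%:E
     + (- complex.Im a)%:E * (complex.Im (f x))%:E)%E).
    by apply: integrableD => //; apply: integrableZl.
  by apply/funext => x; rewrite Re_mul -!EFinM -EFinD mulNr.
rewrite (_ : (fun x => _) = (fun x => (complex.Re a)%:E * (complex.Im (f x))%:E
     + (complex.Im a)%:E * (complex.Re (f x))%:E)%E).
  by apply: integrableD => //; apply: integrableZl.
by apply/funext => x; rewrite Im_mul -!EFinM -EFinD.
Qed.

Lemma cintegrableD D f g : measurable D -> cintegrable D f -> cintegrable D g ->
  cintegrable D (fun x => f x + g x).
Proof.
move=> mD [h1 h2] [h3 h4]; split.
  rewrite (_ : (fun x => _) = (fun x => (complex.Re (f x))%:E + (complex.Re (g x))%:E)%E).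
    exact: integrableD.
  by apply/funext => x; rewrite Re_add EFinD.
rewrite (_ : (fun x => _) = (fun x => (complex.Im (f x))%:E + (complex.Im (g x))%:E)%E).
  exact: integrableD.
by apply/funext => x; rewrite Im_add EFinD.
Qed.

Lemma cint_ext D f g : (forall x, D x -> f x = g x) -> cint D f = cint D g.
Proof.
move=> fg; rewrite /cint; congr (_ +i* _)%C; apply: eq_Rintegral => x /set_mem xD;
  by rewrite fg.
Qed.

Lemma cintZ D a f : measurable D -> cintegrable D f ->
  cint D (fun x => a * f x) = a * cint D f.
Proof.
move=> mD [h1 h2]; apply/eqP; rewrite eq_complex Re_mul Im_mul /=.
have hZ (r : R) (u : T -> R) : mT.-integrable D (EFin \o u) ->
    mT.-integrable D (EFin \o (fun x => r * u x)).
  move=> hu; rewrite (_ : EFin \o _ = (fun x => r%:E * (u x)%:E)%E) //.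
  exact: integrableZl.
apply/andP; split; apply/eqP.
  under eq_Rintegral do rewrite Re_mul.
  by rewrite RintegralB ?RintegralZl //; apply: hZ.
under eq_Rintegral do rewrite Im_mul.
by rewrite RintegralD ?RintegralZl //; apply: hZ.
Qed.

Lemma cintD D f g : measurable D -> cintegrable D f -> cintegrable D g ->
  cint D (fun x => f x + g x) = cint D f + cint D g.
Proof.
move=> mD [h1 h2] [h3 h4]; apply/eqP; rewrite eq_complex /=.
apply/andP; split; apply/eqP.
  by under eq_Rintegral do rewrite Re_add; rewrite RintegralD.
by under eq_Rintegral do rewrite Im_add; rewrite RintegralD.
Qed.

Lemma cintegrable0 D : cintegrable D (fun=> 0).
Proof. by split; apply: integrable0. Qed.

Lemma cintegrable_sum D I (r : seq I) (a : I -> C) (F : I -> T -> C) :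
  measurable D -> (forall i, cintegrable D (F i)) ->
  cintegrable D (fun x => \sum_(i <- r) a i * F i x).
Proof.
move=> mD h; elim: r => [|i r IH].
  by under eq_fun do rewrite big_nil; exact: cintegrable0.
rewrite (_ : (fun x => _) = (fun x => a i * F i x + \sum_(i <- r) a i * F i x)).
  by apply: cintegrableD => //; apply: cintegrableZ.
by apply/funext => x; rewrite big_cons.
Qed.

Lemma cint_sum D I (r : seq I) (a : I -> C) (F : I -> T -> C) :
  measurable D -> (forall i, cintegrable D (F i)) ->
  cint D (fun x => \sum_(i <- r) a i * F i x) = \sum_(i <- r) a i * cint D (F i).
Proof.
move=> mD h; elim: r => [|i r IH].
  rewrite big_nil (cint_ext (g := fun=> 0)); last by move=> x _; rewrite big_nil.
  by rewrite /cint /= /Rintegral integral0.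
rewrite big_cons -IH -cintZ // -cintD //.
- by apply: cint_ext => x _; rewrite big_cons.
- exact: cintegrableZ.
- exact: cintegrable_sum.
Qed.

Lemma cintegrable_nc D f : measurable D -> cintegrable D f ->
  mT.-integrable D (fun x => (nc (f x))%:E).
Proof.
move=> mD [h1 h2].
have m1 : measurable_fun D (fun x => complex.Re (f x)).
  by apply/measurable_EFinP; apply: measurable_int h1.
have m2 : measurable_fun D (fun x => complex.Im (f x)).
  by apply/measurable_EFinP; apply: measurable_int h2.
apply: (@le_integrable _ _ _ mT D mD _
  (fun x => `|(complex.Re (f x))%:E| + `|(complex.Im (f x))%:E|)%E).
- apply/measurable_EFinP.
  rewrite (_ : (fun x => nc (f x)) =
    (fun x => Num.sqrt (complex.Re (f x) ^+ 2 + complex.Im (f x) ^+ 2))).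
    apply: measurableT_comp; first by apply: continuous_measurable_fun; exact: sqrt_continuous.
    by apply: measurable_funD; apply: measurable_funX.
  by apply/funext => x; rewrite ncE.
- move=> x _; rewrite /= lee_fin ger0_norm ?nc_ge0 //.
  by rewrite ger0_norm ?addr_ge0 // nc_le_ReIm.
- by apply: integrableD => //; apply: integrable_abse.
Qed.

(** With z the integral, |z|^2 is the integral of the real part of conj(z) f, which is at most |z|
    times the integral of |f|. *)
Lemma nc_cint_le D f : measurable D -> cintegrable D f ->
  nc (cint D f) <= \int[mT]_(x in D) nc (f x).
Proof.
move=> mD fi; have ni := cintegrable_nc mD fi.
set z := cint D f; have [->|z0] := eqVneq (nc z) 0.
  by apply: Rintegral_ge0 => x _; apply: nc_ge0.
have zp : 0 < nc z by rewrite lt_neqAle eq_sym z0 nc_ge0.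
rewrite -(ler_pM2l zp) -expr2 nc_sqr.
have [h1 h2] := fi.
have -> : complex.Re z ^+ 2 + complex.Im z ^+ 2 =
   \int[mT]_(x in D) (complex.Re z * complex.Re (f x) + complex.Im z * complex.Im (f x)).
  rewrite RintegralD // ?RintegralZl // -?expr2 //.
  - by rewrite (_ : EFin \o _ = (fun x => (complex.Re z)%:E * (complex.Re (f x))%:E)%E) //; apply: integrableZl.
  - by rewrite (_ : EFin \o _ = (fun x => (complex.Im z)%:E * (complex.Im (f x))%:E)%E) //; apply: integrableZl.
rewrite -RintegralZl //; apply: le_Rintegral => //.
- rewrite (_ : EFin \o _ = (fun x => (complex.Re z)%:E * (complex.Re (f x))%:E +
     (complex.Im z)%:E * (complex.Im (f x))%:E)%E) //.
  by apply: integrableD => //; apply: integrableZl.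
- rewrite (_ : EFin \o _ = (fun x => (nc z)%:E * (nc (f x))%:E)%E) //.
  exact: integrableZl.
move=> x _.
have ReJ (u w : C) : complex.Re u * complex.Re w + complex.Im u * complex.Im w =
   complex.Re ((u^*)%C * w) by case: u => a b; rewrite Re_mul /= mulNr opprK.
rewrite ReJ.
by apply: le_trans (ler_norm _) _; apply: le_trans (nc_Re _) _; rewrite ncM ncJ.
Qed.

End ComplexIntegral.

Section Integrability.
Context {R : realType}.
Local Notation C := R[i].
Local Notation nc := (@Normc.normc R).
Local Notation mT := (torus_measure R).
Local Notation T := (measurableTypeR R).

Lemma torus_integrable_cst (D : set T) (r : R) : measurable D ->
  mT.-integrable D (cst r%:E).
Proof.
move=> mD; apply: (integrableS (E := setT)) => //.
apply/integrableP; split; first exact: measurable_cst.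
rewrite (_ : (fun x => _) = cst `|r|%:E); last by apply/funext.
by rewrite integral_cst // [X in (_ * X)%E]torus_setT mule1 ltry.
Qed.

Lemma cintegrable_bounded (D : set T) (f : T -> C) (B : R) : measurable D ->
  cmeasurable f -> (forall x, D x -> nc (f x) <= B) -> cintegrable D f.
Proof.
move=> mD [m1 m2] fB; split.
  apply: (@le_integrable _ _ _ mT D mD _ (cst `|B|%:E)) => //.
  - by apply/measurable_EFinP; apply: measurable_funTS.
  - move=> x Dx /=; rewrite lee_fin normr_id.
    by apply: le_trans (nc_Re _) _; apply: le_trans (fB x Dx) (ler_norm _).
  - exact: torus_integrable_cst.
apply: (@le_integrable _ _ _ mT D mD _ (cst `|B|%:E)) => //.
- by apply/measurable_EFinP; apply: measurable_funTS.
- move=> x Dx /=; rewrite lee_fin normr_id.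
  by apply: le_trans (nc_Im _) _; apply: le_trans (fB x Dx) (ler_norm _).
- exact: torus_integrable_cst.
Qed.

Lemma Lp_int_lty (p : R) (f : T -> C) : 0 < p -> Lp p f ->
  (\int[mT]_x (nc (f x) `^ p)%:E < +oo)%E.
Proof.
move=> p0 [_ _ _]; rewrite Lp_normE; case: (\int[mT]_x _)%E => [r| |] //.
  by move=> _; rewrite ltry.
by rewrite poweRyr // invr_eq0 gt_eqF.
Qed.

Lemma Lp_integrable_powR (p : R) (f : T -> C) : 0 < p -> Lp p f ->
  mT.-integrable setT (fun x => (nc (f x) `^ p)%:E).
Proof.
move=> p0 Lf; apply/integrableP; split; first exact: cmeas_powR (Lp_cmeas Lf).
under eq_integral do rewrite abse_EFin ger0_norm ?powR_ge0 //.
exact: Lp_int_lty Lf.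
Qed.

Lemma Lp_cintegrable (p : R) (f : T -> C) : 1 <= p -> Lp p f -> cintegrable setT f.
Proof.
move=> p1 Lf; have p0 : 0 < p := lt_le_trans ltr01 p1.
have [m1 m2] := Lp_cmeas Lf.
have ig : mT.-integrable setT (fun x => (1%:E + (nc (f x) `^ p)%:E)%E).
  apply: integrableD => //; first exact: torus_integrable_cst.
  exact: Lp_integrable_powR.
have le1 (x : T) : nc (f x) <= 1 + nc (f x) `^ p.
  case: (leP (nc (f x)) 1) => h; first by rewrite (le_trans h) // lerDl powR_ge0.
  apply: le_trans (_ : nc (f x) `^ p <= _); last by rewrite lerDr.
  by apply: le1r_powR => //; apply: ltW.
split.
  apply: (le_integrable _ _ _ ig) => //; first exact/measurable_EFinP.
  move=> x _ /=; rewrite lee_fin [leRHS]ger0_norm ?addr_ge0 ?powR_ge0 //.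
  exact: le_trans (nc_Re _) (le1 x).
apply: (le_integrable _ _ _ ig) => //; first exact/measurable_EFinP.
move=> x _ /=; rewrite lee_fin [leRHS]ger0_norm ?addr_ge0 ?powR_ge0 //.
exact: le_trans (nc_Im _) (le1 x).
Qed.

Lemma cell_bigsetU M : (0 < M)%N ->
  unit_itv = \big[setU/set0]_(j <- index_enum 'I_M) cell M j :> set R.
Proof.
move=> M0; apply/seteqP; split => x.
  move=> /(cellP M0)[h1 h2].
  by rewrite -bigcup_seq; exists (Ordinal h1) => //=; rewrite mem_index_enum.
by rewrite -bigcup_seq => -[j _]; apply: cell_sub.
Qed.

Lemma Rintegral_cells M (u : T -> R) : (0 < M)%N ->
  mT.-integrable setT (EFin \o u) ->
  \int[mT]_x u x = \sum_(j < M) \int[mT]_(x in cell M j) u x.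
Proof.
move=> M0 iu.
have mC : measurable (~` unit_itv : set T).
  by apply: measurableC; exact: measurable_unit_itv.
have mu_ : measurable_fun setT (EFin \o u) by apply: measurable_int iu.
have e1 : (\int[mT]_x (u x)%:E = \sum_(j < M) \int[mT]_(x in cell M j) (u x)%:E)%E.
  rewrite (negligible_integral mC measurableT iu); last first.
    by rewrite torus_measureE setICl measure0.
  rewrite setTD setCK (cell_bigsetU M0) integral_bigsetU_EFin //.
  - by move=> j; apply: measurable_cell.
  - exact: index_enum_uniq.
  - move=> i j _ _ [x [xi xj]]; apply/val_inj => /=.
    by rewrite -(cell_truncn M0 xi) -(cell_truncn M0 xj).
  - exact: measurable_funTS.
rewrite /Rintegral e1.
have fin j : (\int[mT]_(x in cell M j) (u x)%:E)%E \is a fin_num.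
  apply: integrable_fin_num; first exact: measurable_cell.
  by apply: (integrableS (E := setT)) => //; exact: measurable_cell.
rewrite (eq_bigr (fun j : 'I_M => (fine (\int[mT]_(x in cell M j) (u x)%:E)%E)%:E)).
  by rewrite sumEFin.
by move=> j _; rewrite fineK.
Qed.

Lemma cint_cells M (f : T -> C) : (0 < M)%N -> cintegrable setT f ->
  cint setT f = \sum_(j < M) cint (cell M j) f.
Proof.
move=> M0 [h1 h2]; apply/eqP; rewrite eq_complex Re_sum Im_sum /=.
by rewrite (Rintegral_cells M0 h1) (Rintegral_cells M0 h2) !eqxx.
Qed.

Lemma cint_cell_cst M j (c : C) : (j < M)%N ->
  cint (cell M j) (fun=> c) = c * (M%:R^-1)%:C%C.
Proof.
move=> jM; have mc : measurable (cell M j : set T) by exact: measurable_cell.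
rewrite /cint !Rintegral_cst //.
have -> : fine (mT (cell M j)) = M%:R^-1 by rewrite [mT _]torus_cell.
by apply/eqP; rewrite eq_complex Re_mul Im_mul /= !mulr0 subr0 add0r !eqxx.
Qed.

Lemma cint_cell_close M j (f : T -> C) (c : C) (eta : R) : (j < M)%N ->
  cintegrable (cell M j) f ->
  (forall x, cell M j x -> nc (f x - c) <= eta) ->
  nc (cint (cell M j) f - c * (M%:R^-1)%:C%C) <= eta * M%:R^-1.
Proof.
move=> jM fi fc; have mc : measurable (cell M j : set T) by exact: measurable_cell.
have ci : cintegrable (cell M j) (fun=> - c).
  by apply: (@cintegrable_bounded _ _ (nc (- c))) => //; apply: cmeas_cst.
rewrite -(cint_cell_cst c jM).
have -> : cint (cell M j) f - cint (cell M j) (fun=> c) =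
    cint (cell M j) (fun x => f x + - c).
  by rewrite cintD // !cint_cell_cst // mulNr.
apply: le_trans (nc_cint_le mc (cintegrableD mc fi ci)) _.
apply: (@le_trans _ _ (\int[mT]_(x in cell M j) eta)).
  apply: le_Rintegral => //.
  - exact: cintegrable_nc (cintegrableD mc fi ci).
  - exact: torus_integrable_cst.
rewrite Rintegral_cst //.
by have -> : fine (mT (cell M j)) = M%:R^-1 by rewrite [mT _]torus_cell.
Qed.

(* Jensen's inequality on each cell. *)
Lemma cell_average_contract (p : R) M (f : T -> C) (eps : R) : 1 <= p -> (0 < M)%N ->
  Lp p f -> (\int[mT]_x (nc (f x) `^ p)%:E <= eps%:E)%E ->
  \sum_(j < M) nc (M%:R%:C%C * cint (cell M j) f) `^ p <= M%:R * eps.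
Proof.
move=> p1 M0 Lf feps; have p0 : 0 < p := lt_le_trans ltr01 p1.
have MR : 0 < M%:R :> R by rewrite ltr0n.
have ip := Lp_integrable_powR p0 Lf; have ci := Lp_cintegrable p1 Lf.
have key (j : 'I_M) : nc (M%:R%:C%C * cint (cell M j) f) `^ p <=
    M%:R * \int[mT]_(x in cell M j) (nc (f x) `^ p).
  have mc : measurable (cell M j : set T) by exact: measurable_cell.
  have cic := cintegrable_sub mc ci.
  have ic := cintegrable_nc mc cic.
  have icp : mT.-integrable (cell M j) (EFin \o (fun x => nc (f x) `^ p)).
    exact: (integrableS (E := setT)).
  set a := M%:R * \int[mT]_(x in cell M j) nc (f x).
  have na : nc (M%:R%:C%C * cint (cell M j) f) <= a.
    by rewrite ncM nc_real ger0_norm ?ler0n // ler_pM2l // nc_cint_le.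
  apply: le_trans (powR_mono (ltW p0) (nc_ge0 _) na) _.
  have a0 : 0 <= a := le_trans (nc_ge0 _) na.
  have [az|anz] := eqVneq a 0.
    rewrite az powR0 ?gt_eqF // mulr_ge0 //.
    by apply: Rintegral_ge0 => x _; apply: powR_ge0.
  have ap : 0 < a by rewrite lt_neqAle eq_sym anz.
  have app : 0 < a `^ p by apply: powR_gt0.
  (* Bernoulli's inequality at |f| / a, with a the mean of |f| over the cell; integrated over the
     cell, the left side becomes a^p / M. *)
  have low (x : T) : a `^ p * (1 - p) + (a `^ p * p / a) * nc (f x) <= nc (f x) `^ p.
    have := powR_bernoulli p1 (divr_ge0 (nc_ge0 (f x)) a0).
    rewrite -(ler_pM2l app) -powRM ?divr_ge0 ?nc_ge0 //.
    have -> : a * (nc (f x) / a) = nc (f x) by field.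
    move/(le_trans _); apply; rewrite le_eqVlt; apply/orP; left; apply/eqP; field.
    by [].
  have il : mT.-integrable (cell M j)
      (EFin \o (fun x => (a `^ p * p / a) * nc (f x))).
    by rewrite (_ : EFin \o _ = (fun x => (a `^ p * p / a)%:E * (nc (f x))%:E)%E) //;
       apply: integrableZl.
  have ik : mT.-integrable (cell M j) (EFin \o (fun x => a `^ p * (1 - p))).
    exact: torus_integrable_cst.
  have := le_Rintegral mc (integrableD mc ik il) icp (fun x _ => low x).
  rewrite RintegralD // [X in X + _ <= _]Rintegral_cst // RintegralZl //.
  have -> : fine (mT (cell M j)) = M%:R^-1 by rewrite [mT _]torus_cell.
  rewrite -(ler_pM2l MR); apply: le_trans.
  have -> : \int[mT]_(x in cell M j) nc (f x) = a / M%:R by rewrite /a mulrC mulKf // gt_eqF.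
  rewrite le_eqVlt; apply/orP; left; apply/eqP; field.
  by rewrite anz gt_eqF.
apply: le_trans; first by apply: ler_sum => j _; exact: key.
rewrite -mulr_sumr -Rintegral_cells // ler_pM2l // -lee_fin /Rintegral fineK //.
exact: integrable_fin_num.
Qed.

End Integrability.

(** * The trigonometric system *)

Section TrigonometricSystem.
Context {R : realType}.
Local Notation C := R[i].
Local Notation nc := (@Normc.normc R).
Local Notation mT := (torus_measure R).
Local Notation T := (measurableTypeR R).

Definition ek (k : int) (x : R) : C := ee (k%:~R * x).

Lemma nc_ek k x : nc (ek k x) = 1.
Proof. exact: nc_ee. Qed.

Lemma ek_periodic k : periodic (ek k) 1.
Proof. by move=> x; rewrite /ek mulrDr mulr1 eeDz. Qed.

Lemma cmeas_ek k : cmeasurable (ek k).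
Proof. exact: cmeas_ee. Qed.

Lemma ekD k l x : ek (k + l) x = ek k x * ek l x.
Proof. by rewrite /ek rmorphD /= mulrDl eeD. Qed.

Lemma ek0 x : ek 0 x = 1.
Proof. by rewrite /ek mul0r ee0. Qed.

Lemma ekN k x : ek (- k) x = ((ek k x)^*)%C.
Proof. by rewrite /ek rmorphN /= mulNr eeN. Qed.

Lemma ek_Lp p k : 0 < p -> Lp p (ek k).
Proof.
move=> p0; apply: (@Lp_bounded _ _ _ 1) => //.
- exact: ek_periodic.
- exact: cmeas_ek.
- by move=> x; rewrite nc_ek.
Qed.

Lemma fourierE (f : R -> C) k : fourier f k = cint setT (fun x => f x * ek (- k) x).
Proof.
rewrite /fourier torus_integralE; congr cint; apply/funext => x.
by rewrite /ek /ee rmorphN /=; congr (_ * expi _); ring.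
Qed.

Lemma cintegrable_mul_bounded (D : set T) (f g : T -> C) (B : R) : measurable D ->
  cmeasurable f -> cintegrable D f -> cmeasurable g -> (forall x, nc (g x) <= B) ->
  cintegrable D (fun x => f x * g x).
Proof.
move=> mD mf fi mg gB; have [m1 m2] := cmeasM mf mg.
have B0 : 0 <= B := le_trans (nc_ge0 _) (gB 0).
have ni : mT.-integrable D (fun x => B%:E * (nc (f x))%:E)%E.
  by apply: integrableZl => //; exact: cintegrable_nc.
have h (x : T) : nc (f x * g x) <= B * nc (f x).
  by rewrite ncM mulrC ler_wpM2r ?nc_ge0.
split.
  apply: (le_integrable _ _ _ ni) => //.
    by apply/measurable_EFinP; apply: measurable_funTS.
  move=> x _ /=; rewrite lee_fin [leRHS]ger0_norm ?mulr_ge0 ?nc_ge0 //.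
  exact: le_trans (nc_Re _) (h x).
apply: (le_integrable _ _ _ ni) => //.
  by apply/measurable_EFinP; apply: measurable_funTS.
move=> x _ /=; rewrite lee_fin [leRHS]ger0_norm ?mulr_ge0 ?nc_ge0 //.
exact: le_trans (nc_Im _) (h x).
Qed.

Lemma cintegrable_ek (D : set T) k : measurable D -> cintegrable D (ek k).
Proof.
move=> mD; apply: (@cintegrable_bounded _ _ _ 1) => //; first exact: cmeas_ek.
by move=> x _; rewrite nc_ek.
Qed.

Lemma cint_ek_cell : exists2 K : R, 0 < K & forall (k : int) M j, (j < M)%N ->
  nc (cint (cell M j) (ek k) - ek k (j%:R / M%:R) * (M%:R^-1)%:C%C) <=
  K * `|k%:~R| / M%:R * M%:R^-1.
Proof.
have [K K0 lip] := @ee_lipschitz R; exists K => // k M j jM.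
have mc : measurable (cell M j : set T) by exact: measurable_cell.
apply: cint_cell_close => //; first exact: cintegrable_ek.
move=> x; rewrite /cell /= in_itv /= => /andP[h1 h2].
have MR : 0 < M%:R :> R by rewrite ltr0n (leq_ltn_trans _ jM).
apply: le_trans (lip _ _) _; rewrite -mulrBr normrM mulrA.
apply: ler_wpM2l; first by rewrite mulr_ge0 // ltW.
rewrite ger0_norm ?subr_ge0 // lerBlDr ltW //.
by apply: lt_le_trans h2 _; rewrite -natr1 mulrDl mul1r addrC.
Qed.

Lemma sum_ek_grid (k : int) M : (0 < M)%N -> k != 0 -> (`|k| < M)%N ->
  \sum_(j < M) ek k (j%:R / M%:R) = 0.
Proof.
move=> M0; wlog: k / exists n : nat, k = n => [hw k0 kM|[n ->] k0 kM].
  case: k k0 kM => [n|n] k0 kM; first by apply: hw => //; exists n.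
  have e : Negz n = - (n.+1 : int) by [].
  have := hw n.+1; rewrite /= => h.
  have {}h : \sum_(j < M) ek n.+1 (j%:R / M%:R) = 0 by apply: h => //; exists n.+1.
  rewrite e; under eq_bigr do rewrite ekN.
  by rewrite -rmorph_sum h rmorph0.
have := @dft_sum R M n M0; rewrite /dvdn modn_small //.
have -> : (n == 0%N) = false by apply/negbTE.
move=> /= h; rewrite -[RHS]h; apply: eq_bigr => j _; by rewrite dftC /ek /dft mulrA.
Qed.

(** By Riemann sums: for k != 0 the sum of [ek k] over a grid of M > |k| points vanishes, and the
    mean over the grid differs from the integral by O(|k| / M), which tends to 0. *)
Lemma cint_ek (k : int) : cint setT (ek k) = (k == 0)%:R.
Proof.
have [->|k0] := eqVneq k 0.
  rewrite (cint_ext (g := fun=> 1)); last by move=> x _; rewrite ek0.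
  rewrite /cint /= !Rintegral_cst // [mT _]torus_setT /= mulr1 mul0r.
  by [].
have [K K0 hK] := cint_ek_cell.
set I := cint _ _.
have bound M : (`|k| < M)%N -> nc I <= K * `|k%:~R| / M%:R.
  move=> kM; have M0 : (0 < M)%N by apply: leq_ltn_trans kM.
  have MR : M%:R != 0 :> R by rewrite pnatr_eq0 -lt0n.
  have -> : I = \sum_(j < M) (cint (cell M j) (ek k) -
      ek k (j%:R / M%:R) * (M%:R^-1)%:C%C).
    rewrite big_split /= sumrN -mulr_suml sum_ek_grid // mul0r subr0.
    by apply: cint_cells => //; apply: cintegrable_ek.
  apply: le_trans (nc_sum _ _ _) _.
  apply: le_trans; first by apply: ler_sum => j _; exact: hK.
  by rewrite sumr_const card_ord -[_ *+ M]mulr_natr divfK.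
have I0 : nc I <= 0.
  rewrite leNgt; apply/negP => Ip.
  set A := K * `|k%:~R| in bound.
  have A0 : 0 <= A by rewrite mulr_ge0 // ltW.
  pose M := maxn `|k|.+1 (Num.bound (A / nc I)).
  have := bound M; rewrite leq_maxl => /(_ isT).
  have M0 : 0 < M%:R :> R by rewrite ltr0n leq_max ltn0Sn.
  rewrite ler_pdivlMr // mulrC -ler_pdivlMr // leNgt.
  have -> // : A / nc I < M%:R.
  apply: lt_le_trans (archi_boundP _) _; first by rewrite divr_ge0 // nc_ge0.
  by rewrite ler_nat leq_maxr.
by apply/eqP; rewrite -nc_eq0 eq_le I0 nc_ge0.
Qed.

Lemma fourier_ek (k l : int) : fourier (ek k) l = (k == l)%:R.
Proof.
rewrite fourierE (cint_ext (g := ek (k - l))) ?cint_ek ?subr_eq0 //.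
by move=> x _; rewrite ekD.
Qed.

End TrigonometricSystem.

(** * Sup norm and absolutely summable Fourier coefficients *)

Section TrigonometricPolynomials.
Context {R : realType}.
Local Notation C := R[i].
Local Notation nc := (@Normc.normc R).
Local Notation mT := (torus_measure R).
Local Notation T := (measurableTypeR R).

(* A frequency may occur several times in s. *)
Definition real_trig (r : R -> R) : Prop :=
  exists s : seq (C * int), forall x, ((r x)%:C)%C = \sum_(q <- s) q.1 * ek q.2 x.

Lemma real_trig_cst c : real_trig (fun=> c).
Proof.
by exists [:: (c%:C%C, 0)] => x; rewrite big_seq1 ek0 mulr1.
Qed.

Lemma real_trigD r1 r2 : real_trig r1 -> real_trig r2 -> real_trig (fun x => r1 x + r2 x).
Proof.
move=> [s1 h1] [s2 h2]; exists (s1 ++ s2) => x.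
by rewrite big_cat /= -h1 -h2 rmorphD.
Qed.

Lemma real_trigM r1 r2 : real_trig r1 -> real_trig r2 -> real_trig (fun x => r1 x * r2 x).
Proof.
move=> [s1 h1] [s2 h2].
exists [seq (q.1 * q'.1, q.2 + q'.2) | q <- s1, q' <- s2] => x.
rewrite big_allpairs_dep /= real_complexM h1 h2 /= big_distrlr /=.
by apply: eq_bigr => q _; apply: eq_bigr => q' _; rewrite ekD mulrACA.
Qed.

Lemma real_trigX r n : real_trig r -> real_trig (fun x => r x ^+ n).
Proof.
move=> hr; elim: n => [|n IH].
  by rewrite (_ : (fun x => _) = (fun=> 1)); [exact: real_trig_cst | apply/funext => x; rewrite expr0].
rewrite (_ : (fun x => _) = (fun x => r x * r x ^+ n)); first exact: real_trigM.
by apply/funext => x; rewrite exprS.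
Qed.

Lemma real_trig_cos (x0 : R) : real_trig (fun x => cos (2 * pi * (x - x0))).
Proof.
exists [:: (ee (- x0) / 2, 1); (ee x0 / 2, -1)] => x.
rewrite big_cons big_seq1 /= /ek mul1r mulN1r.
have -> : ee (- x0) / 2 * ee x = ee (x - x0) / 2 :> C by rewrite mulrAC -eeD addrC.
have -> : ee x0 / 2 * ee (- x) = ee (- (x - x0)) / 2 :> C by rewrite mulrAC -eeD opprB.
rewrite eeN -mulrDl addcJ.
have two (w : C) : 2 * w / 2 = w by rewrite mulrC mulKf ?pnatr_eq0.
by rewrite two.
Qed.

Lemma real_trig_measurable r : real_trig r -> measurable_fun setT r.
Proof.
case=> s h; rewrite (_ : r = (fun x => complex.Re (\sum_(q <- s) q.1 * ek q.2 x))).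
  apply: (proj1 (A := measurable_fun setT (fun x => complex.Re (\sum_(q <- s) q.1 * ek q.2 x))) (B := _) _).
  by apply: cmeas_sum => q _; apply: cmeasM; [exact: cmeas_cst|exact: cmeas_ek].
by apply/funext => x; rewrite -h.
Qed.

Lemma sum_by_frequency (s : seq (C * int)) (Phi : int -> C) :
  \sum_(q <- s) q.1 * Phi q.2 =
  \sum_(j <- undup [seq q.2 | q <- s]) (\sum_(q <- s | q.2 == j) q.1) * Phi j.
Proof.
under [RHS]eq_bigr do rewrite mulr_suml.
rewrite (exchange_big_dep xpredT) //= [in RHS]big_seq [in LHS]big_seq.
apply: eq_bigr => q qs.
rewrite -big_filter (@eq_filter _ _ (pred1 q.2)); last by move=> j /=; rewrite eq_sym.
rewrite filter_pred1_uniq ?undup_uniq // ?mem_undup ?map_f //.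
by rewrite big_seq1.
Qed.

(** The pairing is the sum over the frequencies j of [r] of the coefficient of [r] at j times the
    Fourier coefficient of [g] at -j. As r >= 0, each coefficient of [r] is at most the integral of
    [r] in modulus. *)
Lemma trig_pairing (g : R -> C) (tau : R) (r : R -> R) : Lp 1 g -> 0 <= tau ->
  (forall s : seq int, uniq s -> \sum_(k <- s) nc (fourier g k) <= tau) ->
  real_trig r -> (forall x, 0 <= r x) ->
  nc (cint setT (fun x => g x * ((r x)%:C)%C)) <= tau * \int[mT]_x r x.
Proof.
move=> Lg tau0 hg rt r0; have [s hs] := rt.
have gi := Lp_cintegrable (lexx 1) Lg; have mg := Lp_cmeas Lg.
pose Phi j := fourier g (- j).
have gek k : cintegrable setT (fun x => g x * ek k x).
  apply: (@cintegrable_mul_bounded _ _ _ _ 1) => //; first exact: cmeas_ek.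
  by move=> x; rewrite nc_ek.
have -> : cint setT (fun x => g x * ((r x)%:C)%C) = \sum_(q <- s) q.1 * Phi q.2.
  rewrite (cint_ext (g := fun x => \sum_(q <- s) q.1 * (g x * ek q.2 x))); last first.
    by move=> x _; rewrite hs mulr_sumr; apply: eq_bigr => q _; rewrite mulrCA.
  rewrite (cint_sum s (fun q => q.1) (F := fun q x => g x * ek q.2 x)) //.
  by apply: eq_bigr => q _; rewrite /Phi fourierE opprK.
rewrite sum_by_frequency.
have mr : cmeasurable (fun x => ((r x)%:C)%C : C).
  by split => /=; [exact: real_trig_measurable | exact: measurable_cst].
pose B := \sum_(q <- s) nc q.1.
have rB x : nc (((r x)%:C)%C) <= B.
  rewrite hs; apply: le_trans (nc_sum _ _ _) _; apply: ler_sum => q _.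
  by rewrite ncM nc_ek mulr1.
have ri : cintegrable setT (fun x => ((r x)%:C)%C).
  by apply: (@cintegrable_bounded _ _ _ B).
have Ir : \int[mT]_x r x = \int[mT]_x nc (((r x)%:C)%C).
  by apply: eq_Rintegral => x _; rewrite nc_real ger0_norm.
have coef j : nc (\sum_(q <- s | q.2 == j) q.1) <= \int[mT]_x r x.
  have -> : \sum_(q <- s | q.2 == j) q.1 = cint setT (fun x => ((r x)%:C)%C * ek (- j) x).
    rewrite (cint_ext (g := fun x => \sum_(q <- s) q.1 * ek (q.2 - j) x)); last first.
      by move=> x _; rewrite hs mulr_suml; apply: eq_bigr => q _; rewrite -mulrA -ekD.
    rewrite (cint_sum s (fun q => q.1) (F := fun q x => ek (q.2 - j) x)) //; last first.
      by move=> q; apply: cintegrable_ek.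
    rewrite big_mkcond; apply: eq_bigr => q _; rewrite cint_ek subr_eq0.
    by case: eqP => _; rewrite ?mulr1 ?mulr0.
  apply: le_trans (nc_cint_le _ _) _ => //.
    apply: (@cintegrable_mul_bounded _ _ _ _ 1) => //; first exact: cmeas_ek.
    by move=> x; rewrite nc_ek.
  rewrite Ir le_eqVlt; apply/orP; left; apply/eqP; apply: eq_Rintegral => x _.
  by rewrite ncM nc_ek mulr1.
have I0 : 0 <= \int[mT]_x r x by apply: Rintegral_ge0.
set J := undup _.
apply: le_trans (nc_sum _ _ _) _.
apply: (@le_trans _ _ (\sum_(j <- J) (\int[mT]_x r x) * nc (Phi j))).
  by apply: ler_sum => j _; rewrite ncM ler_wpM2r // nc_ge0.
rewrite -mulr_sumr mulrC ler_wpM2r //.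
have := hg [seq - j | j <- J]; rewrite big_map; apply.
by rewrite map_inj_uniq ?undup_uniq //; apply: oppr_inj.
Qed.

End TrigonometricPolynomials.

(** * Trigonometric polynomials converging to indicators of intervals *)

Section StepLimit.
Context {R : realType}.

Lemma subr1_expr_ge (t : R) m : 0 <= t <= 1 -> 1 - m%:R * t <= (1 - t) ^+ m.
Proof.
move=> /andP[t0 t1]; elim: m => [|m IH]; first by rewrite mul0r subr0 expr0.
rewrite exprS; apply: (@le_trans _ _ ((1 - t) * (1 - m%:R * t))).
  have : 0 <= m%:R * t * t by rewrite !mulr_ge0.
  by rewrite -natr1; nra.
by apply: ler_wpM2l => //; rewrite subr_ge0.
Qed.

Lemma subr1_expr_le (t : R) m : 0 <= t <= 1 -> (1 - t) ^+ m <= (1 + m%:R * t)^-1.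
Proof.
move=> /andP[t0 t1].
have hp k : 0 < 1 + k%:R * t by rewrite ltr_pwDl // mulr_ge0.
rewrite -(ler_pM2r (hp m)) mulVf ?gt_eqF //.
elim: m => [|m IH]; first by rewrite mul0r addr0 expr0 mulr1.
apply: le_trans IH; rewrite exprSr -mulrA ler_wpM2l ?exprn_ge0 ?subr_ge0 //.
have : 0 <= m%:R * t * t by rewrite !mulr_ge0.
by rewrite -natr1; nra.
Qed.

(** 1 - z^n is 1 - z times a geometric sum whose n terms are all at least z^n. *)
Lemma natr_expr_le (z : R) n : 0 <= z < 1 -> n%:R * z ^+ n * (1 - z) <= 1 - z ^+ n.
Proof.
move=> /andP[z0 z1]; elim: n => [|n IH]; first by rewrite expr0 !mul0r subrr.
have zn0 : 0 <= z ^+ n by rewrite exprn_ge0.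
have zn1 : z ^+ n * z <= 1.
  by rewrite -exprSr exprn_ile1 // ltW.
rewrite -natr1 exprSr; nra.
Qed.

Lemma cvg_natr_expr (y : R) : 0 <= y < 1 -> (fun n => n%:R * y ^+ n) @ \oo --> (0 : R).
Proof.
move=> /andP[y0 y1].
(* With y = z^2, one factor z^n absorbs [n] and the other tends to 0. *)
pose z := Num.sqrt y.
have z0 : 0 <= z by apply: sqrtr_ge0.
have yz : y = z ^+ 2 by rewrite sqr_sqrtr.
have z1 : z < 1 by rewrite -(ltr_pXn2r (n := 2)) ?nnegrE // -yz expr1n.
have z1' : 0 < 1 - z by rewrite subr_gt0.
apply: (@squeeze_cvgr _ _ _ _ (cst 0) (fun n => (1 - z)^-1 * z ^+ n)).
- near=> n; rewrite mulr_ge0 ?exprn_ge0 //= yz exprAC expr2 mulrA ler_wpM2r ?exprn_ge0 //.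
  rewrite -(ler_pM2r z1') mulVf ?gt_eqF //.
  apply: le_trans (natr_expr_le n _) _; first by rewrite z0.
  by rewrite gerBl exprn_ge0.
- exact: cvg_cst.
- rewrite -[X in _ --> X](mulr0 ((1 - z)^-1)); apply: cvgMl_tmp.
  by apply: cvg_expr; rewrite ger0_norm.
Unshelve. all: by end_near. Qed.

(* The step is at 1/2 because n 2^n s^n tends to 0 or to infinity according to
   whether s < 1/2 or s >= 1/2. *)
Lemma cvg_step (s : R) : 0 <= s <= 1 ->
  (fun n => (1 - s ^+ n) ^+ (n * 2 ^ n)%N) @ \oo --> ((s < 2^-1)%R%:R : R).
Proof.
move=> /andP[s0 s1].
have sn n : 0 <= s ^+ n <= 1 by rewrite exprn_ge0 // exprn_ile1.
have E n : (n * 2 ^ n)%N%:R * s ^+ n = n%:R * (2 * s) ^+ n :> R.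
  by rewrite natrM natrX exprMn mulrA.
case: ltP => hs /=.
  apply: (@squeeze_cvgr _ _ _ _ (fun n => 1 - n%:R * (2 * s) ^+ n) (cst 1)).
  - near=> n; rewrite -E subr1_expr_ge //=.
    by have /andP[a b] := sn n; rewrite exprn_ile1 ?subr_ge0 // gerBl.
  - rewrite -[X in _ --> X](subr0 1); apply: cvgB; first exact: cvg_cst.
    by apply: cvg_natr_expr; lra.
  - exact: cvg_cst.
apply: (@squeeze_cvgr _ _ _ _ (cst 0) (@harmonic R)).
- near=> n; have /andP[a b] := sn n; rewrite exprn_ge0 ?subr_ge0 //=.
  apply: le_trans (subr1_expr_le _ (sn n)) _.
  have h : 1 <= (2 * s) ^+ n by rewrite exprn_ege1 //; lra.
  have h2 : (n.+1%:R : R) <= 1 + (n * 2 ^ n)%N%:R * s ^+ n.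
    rewrite E -natr1 addrC lerD2l.
    by rewrite -[X in X <= _]mulr1 ler_wpM2l.
  rewrite /harmonic /= lef_pV2 // posrE //.
  exact: lt_le_trans h2.
- exact: cvg_cst.
- exact: cvg_harmonic.
Unshelve. all: by end_near. Qed.

End StepLimit.

Section BallAverage.
Context {R : realType}.
Local Notation C := R[i].
Local Notation nc := (@Normc.normc R).
Local Notation mT := (torus_measure R).
Local Notation T := (measurableTypeR R).

(** The cosine decreases on [0, pi] and is symmetric about pi; |t| <= 1 - rho keeps [t] out of the
    balls around 1 and -1, where the left side would hold too. *)
Lemma cos_lt_cos_ball (rho t : R) : 0 < rho -> `|t| <= 1 - rho -> rho < 2^-1 ->
  (cos (2 * pi * rho) < cos (2 * pi * t)) = (`|t| < rho).
Proof.
move=> r0 t1 rh.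
have p0 : 0 < 2 * pi :> R by rewrite mulr_gt0 // pi_gt0.
rewrite -(cos_norm (2 * pi * t)) normrM (gtr0_norm p0).
have hin (u : R) : 0 <= u -> u <= 2^-1 -> 2 * pi * u \in `[0, pi].
  move=> u0 u1; rewrite in_itv /= mulr_ge0 ?(ltW p0) //=.
  by have := pi_gt0 R; nra.
have [ht|ht] := leP `|t| 2^-1.
  rewrite ltr_cos ?hin //; last exact: ltW; last exact: ltW.
  by rewrite ltr_pM2l.
have -> : cos (2 * pi * `|t|) = cos (2 * pi * (1 - `|t|)).
  rewrite mulrBr mulr1 cosB.
  have -> : cos (2 * pi) = 1 :> R by rewrite mulr_natl cos2pi.
  have -> : sin (2 * pi) = 0 :> R by rewrite mulr_natl sin2pi.
  by rewrite mul1r mul0r addr0.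
rewrite ltr_cos ?hin //; try lra.
by rewrite ltr_pM2l //; apply/idP/idP; lra.
Qed.

(** This is [trig_pairing] for polynomials [P n] with values in [0, 1] that converge to the
    indicator of the ball, in the limit by dominated convergence. *)
Lemma ball_average_le (g : R -> C) (tau x0 rho : R) : Lp 1 g -> 0 <= tau ->
  (forall s : seq int, uniq s -> \sum_(k <- s) nc (fourier g k) <= tau) ->
  0 < rho -> rho < 2^-1 -> rho < x0 -> x0 + rho < 1 ->
  nc (cint (ball x0 rho) g) <= tau * (2 * rho).
Proof.
move=> Lg tau0 hg r0 rh x0l x0r.
have gi := Lp_cintegrable (lexx 1) Lg; have mg := Lp_cmeas Lg.
(* On the unit interval [h] is below 1/2 exactly inside the ball, and the division by 4 keeps its
   values in [0, 1]; so [cvg_step] applies to [P n]. *)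
pose h (x : R) : R := 2^-1 - (cos (2 * pi * (x - x0)) - cos (2 * pi * rho)) / 4.
have h01 x : 0 <= h x <= 1.
  have := cos_le1 (2 * pi * (x - x0)); have := cos_geN1 (2 * pi * (x - x0)).
  have := cos_le1 (2 * pi * rho); have := cos_geN1 (2 * pi * rho).
  by rewrite /h => *; apply/andP; split; lra.
have rth : real_trig h.
  have := real_trigD (real_trig_cst (2^-1 + cos (2 * pi * rho) / 4))
    (real_trigM (real_trig_cst (- 4^-1)) (real_trig_cos x0)).
  by congr real_trig; apply/funext => x; rewrite /h; lra.
pose P n x : R := (1 - h x ^+ n) ^+ (n * 2 ^ n)%N.
have rtP n : real_trig (P n).
  apply: real_trigX.
  have := real_trigD (real_trig_cst 1) (real_trigM (real_trig_cst (- 1)) (real_trigX n rth)).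
  by congr real_trig; apply/funext => x; rewrite mulN1r.
have P01 n x : 0 <= P n x <= 1.
  have /andP[a b] := h01 x.
  have hn1 : h x ^+ n <= 1 by rewrite exprn_ile1.
  have hn0 : 0 <= h x ^+ n by rewrite exprn_ge0.
  by rewrite exprn_ge0 ?subr_ge0 // exprn_ile1 ?subr_ge0 // gerBl.
pose A : set T := ball x0 rho.
have mA : measurable A by apply: measurable_ball.
have Plim x : unit_itv x -> (fun n => P n x) @ \oo --> ((x \in A)%:R : R).
  rewrite /unit_itv /= in_itv /= => /andP[ux0 ux1].
  have -> : (x \in A) = (h x < 2^-1).
    rewrite [RHS](_ : _ = (`|x - x0| < rho)).
      by apply/idP/idP; rewrite inE /A /ball /= distrC.
    rewrite -cos_lt_cos_ball //; last by rewrite ler_norml; lra.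
    by rewrite /h; apply/idP/idP; lra.
  exact: cvg_step.
have lim (u : T -> R) : mT.-integrable setT (EFin \o u) ->
    (fun n => \int[mT]_x (u x * P n x)) @ \oo --> \int[mT]_(x in A) u x.
  move=> ui; have mu' : measurable_fun setT u.
    by apply/measurable_EFinP; apply: measurable_int ui.
  have [] := @dominated_convergence _ T R mT setT measurableT
    (fun n x => (u x * P n x)%:E) (fun x => (u x * (x \in A)%:R)%:E)
    (fun x => `|(u x)%:E|%E).
  - move=> n; apply/measurable_EFinP; apply: measurable_funM => //.
    exact: real_trig_measurable.
  - apply/measurable_EFinP; apply: measurable_funM => //.
    by rewrite (_ : (fun x => _) = \1_A) //; apply: measurable_indic.
  - exists (~` unit_itv); split.
    + by apply: measurableC; apply: measurable_unit_itv.
    + by rewrite torus_measureE setICl measure0.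
    + move=> x /= hx ux; apply: hx => _.
      by apply: cvg_EFin; [exact: nearW | apply: cvgMl_tmp; exact: Plim].
  - exact: integrable_abse.
  - apply: aeW => x n _ /=; rewrite lee_fin normrM.
    have /andP[a b] := P01 n x.
    by rewrite (ger0_norm a) ler_piMr.
  move=> iA _ cv.
  have -> : \int[mT]_(x in A) u x = \int[mT]_x (u x * (x \in A)%:R).
    rewrite Rintegral_mkcond; apply: eq_Rintegral => x _.
    by rewrite patchE; case: ifP => _; rewrite ?mulr1 ?mulr0.
  apply: fine_cvg.
  by rewrite /Rintegral fineK //; apply: integrable_fin_num.
pose z n := cint setT (fun x => g x * ((P n x)%:C)%C).
have zle n : nc (z n) <= tau * \int[mT]_x P n x.
  by apply: trig_pairing => // x; have /andP[] := P01 n x.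
have [g1 g2] := gi.
have cRe : (fun n => complex.Re (z n)) @ \oo --> \int[mT]_(x in A) complex.Re (g x).
  rewrite (_ : (fun n => _) = (fun n => \int[mT]_x (complex.Re (g x) * P n x))); first exact: lim.
  by apply/funext => n; apply: eq_Rintegral => x _; rewrite Re_mul /= mulr0 subr0.
have cIm : (fun n => complex.Im (z n)) @ \oo --> \int[mT]_(x in A) complex.Im (g x).
  rewrite (_ : (fun n => _) = (fun n => \int[mT]_x (complex.Im (g x) * P n x))); first exact: lim.
  by apply/funext => n; apply: eq_Rintegral => x _; rewrite Im_mul /= mulr0 add0r.
have c1 : (fun n => \int[mT]_x P n x) @ \oo --> 2 * rho.
  have := lim (fun=> 1) (torus_integrable_cst 1 measurableT).
  rewrite (_ : \int[mT]_(x in A) 1 = 2 * rho).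
    by under eq_fun do under eq_Rintegral do rewrite mul1r.
  rewrite Rintegral_cst // mul1r [mT A](_ : _ = (rho *+ 2)%:E) /= ?mulr_natl //.
  transitivity (lebesgue_measure A); last exact: lebesgue_measure_ball (ltW r0).
  rewrite torus_measureE; congr (lebesgue_measure _); apply/setIidl => x.
  by rewrite /A /ball /= /unit_itv /= in_itv /= ltr_norml => /andP[? ?]; lra.
have tr0 : 0 <= tau * (2 * rho) by rewrite !mulr_ge0 // ltW.
(* Squares let the limit be taken in the real and imaginary parts separately. *)
rewrite -(ler_pXn2r (n := 2)) ?nnegrE ?nc_ge0 // nc_sqr.
apply: (@ler_cvg_to _ \oo _ R (fun n => complex.Re (z n) ^+ 2 + complex.Im (z n) ^+ 2)
   (fun n => (tau * \int[mT]_x P n x) ^+ 2)).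
- by rewrite !expr2; apply: cvgD; apply: cvgM.
- by rewrite !expr2; apply: cvgM; apply: cvgMl_tmp.
- apply: nearW => n; rewrite -nc_sqr ler_pXn2r ?nnegrE ?nc_ge0 //.
  exact: le_trans (nc_ge0 _) (zle n).

Qed.

End BallAverage.

(** * Pointwise bounds by Lebesgue differentiation *)

Section EssentialBound.
Context {R : realType}.
Local Notation C := R[i].
Local Notation nc := (@Normc.normc R).
Local Notation mT := (torus_measure R).
Local Notation T := (measurableTypeR R).
Local Notation mu := (@lebesgue_measure R).

Lemma torus_integral_sub (A : set T) (f : T -> \bar R) : A `<=` unit_itv ->
  (\int[mT]_(x in A) f x = \int[mu]_(x in A) f x)%E.
Proof.
move=> AU; apply: eq_measure_integral => B mB BA.
by rewrite torus_measureE setIidl //; apply: subset_trans BA AU.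
Qed.

Lemma torus_locally_integrable (u : T -> R) : mT.-integrable setT (EFin \o u) ->
  locally_integrable setT (u \_ unit_itv).
Proof.
move=> ui; apply: open_integrable_locally; first exact: openT.
have mU := @measurable_unit_itv R.
rewrite -restrict_EFin; apply: (@integrable_mkcond _ T R lebesgue_measure unit_itv (EFin \o u) mU).1.
have /integrableP[m1 h1] := ui; apply/integrableP; split; first exact: measurable_funTS.
apply: le_lt_trans h1; rewrite ge0_torus_integralE //.
exact: measurableT_comp.
Qed.

Definition shrinking_radius n : R := 2^-1 / n.+1%:R.

Lemma shrinking_radius_gt0 n : 0 < shrinking_radius n.
Proof. by rewrite divr_gt0. Qed.

Lemma cvg_shrinking_radius : shrinking_radius @ \oo --> (0 : R).
Proof.
rewrite -[X in _ --> X](mulr0 (2^-1)); apply: cvgMl_tmp; exact: cvg_harmonic.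
Qed.

Lemma shrinking_balls (x : R) : nicely_shrinking x (fun n => ball x (shrinking_radius n)).
Proof.
split; first by move=> n; apply: measurable_ball.
exists (1, fun n => PosNum (shrinking_radius_gt0 n)); split => //=.
- exact: cvg_shrinking_radius.
- by move=> n.
- by move=> n; rewrite mul1e.
Qed.

(** Lebesgue differentiation is applied to [u] set to 0 outside the unit interval; around an
    interior point the balls eventually lie inside, where the two measures agree. *)
Lemma torus_differentiation (u : T -> R) : mT.-integrable setT (EFin \o u) ->
  {ae mT, forall x : R, 0 < x < 1 ->
    (fun n => (2 * shrinking_radius n)^-1 *
       \int[mT]_(y in ball x (shrinking_radius n)) u y) @ \oo --> u x}.
Proof.
move=> ui; have li := torus_locally_integrable ui.
have [N [mN N0 hN]] := lebesgue_differentiation li.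
exists N; split => //.
  apply/eqP; rewrite eq_le measure_ge0 andbT torus_measureE -N0.
  by apply: le_measure; rewrite ?inE //; apply: measurableI => //; apply: (@measurable_unit_itv R).
move=> x /= hx; apply: hN => /= lp; apply: hx => /andP[x0 x1].
have := nice_lebesgue_differentiation shrinking_balls li lp.
rewrite patchE mem_set; last by rewrite /unit_itv /= in_itv /= x1 ltW.
move=> /fine_cvg; apply: cvg_trans; apply: near_eq_cvg.
have m0 : 0 < Num.min x (1 - x) by rewrite lt_min x0 subr_gt0.
have /cvgrPdist_lt /(_ _ m0) := cvg_shrinking_radius.
apply: filterS => n; rewrite sub0r normrN gtr0_norm ?shrinking_radius_gt0 // lt_min => /andP[h1 h2].
have AU : ball x (shrinking_radius n) `<=` unit_itv.
  by move=> y; rewrite /ball /= /unit_itv /= in_itv /= ltr_norml => /andP[? ?]; lra.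
set A : set T := ball x _ in AU *.
have mA : measurable A by apply: measurable_ball.
have IE : (\int[mu]_(y in A) ((u \_ unit_itv) y)%:E = (\int[mT]_(y in A) u y)%:E)%E.
  rewrite /Rintegral fineK; last first.
    apply: integrable_fin_num => //.
    by apply: (integrableS (mu := mT) measurableT mA _ ui).
  rewrite torus_integral_sub //; apply: eq_integral => y /set_mem yA.
  by rewrite patchE mem_set //; apply: AU.
rewrite /= -/A IE lebesgue_measure_ball ?(ltW (shrinking_radius_gt0 n)) //.
have r2 : shrinking_radius n *+ 2 != 0 by rewrite mulrn_eq0 /= gt_eqF ?shrinking_radius_gt0.
by rewrite inver (negbTE r2) /= mulr_natl.
Qed.

(** The averages of [g] over shrinking balls are at most [tau] in modulus, and they converge to [g]
    almost everywhere. *)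
Lemma ae_norm_le_fourier (g : T -> C) (tau : R) : Lp 1 g -> 0 <= tau ->
  (forall s : seq int, uniq s -> \sum_(k <- s) nc (fourier g k) <= tau) ->
  {ae mT, forall x, nc (g x) <= tau}.
Proof.
move=> Lg tau0 hg.
have [g1 g2] := Lp_cintegrable (lexx 1) Lg.
have U01 : {ae mT, forall x : R, 0 < x < 1}.
  exists (~` unit_itv `|` [set 0]); split.
  - apply: measurableU; last exact: measurable_set1.
    by apply: measurableC; apply: (@measurable_unit_itv R).
  - apply/eqP; rewrite eq_le measure_ge0 andbT torus_measureE setIUl setICl set0U.
    rewrite -[leRHS](lebesgue_measure_set1 (0 : R)).
    by apply: le_measure; rewrite ?inE //; apply: measurableI => //; apply: (@measurable_unit_itv R).
  - move=> x /= hx; have [-> |x0] := eqVneq x 0; [by right|left].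
    rewrite /unit_itv /= in_itv /= => /andP[h0 h1]; apply: hx.
    by rewrite h1 andbT lt_neqAle eq_sym x0.
have := torus_differentiation g1; have := torus_differentiation g2; move: U01.
apply: filterS3; first exact: (ae_filter_ringOfSetsType mT).
move=> x x01 /(_ x01) cI /(_ x01) cR.
rewrite -(ler_pXn2r (n := 2)) ?nnegrE ?nc_ge0 // nc_sqr.
pose a n := (2 * shrinking_radius n)^-1.
pose wR n := \int[mT]_(y in ball x (shrinking_radius n)) complex.Re (g y).
pose wI n := \int[mT]_(y in ball x (shrinking_radius n)) complex.Im (g y).
apply: (@ler_cvg_to _ \oo _ R (fun n => (a n * wR n) ^+ 2 + (a n * wI n) ^+ 2) (cst (tau ^+ 2))).
- by rewrite !expr2; apply: cvgD; apply: cvgM.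
- exact: cvg_cst.
- have [x0 x1] := andP x01.
  have m0 : 0 < Num.min 2^-1 (Num.min x (1 - x)).
    by rewrite !lt_min invr_gt0 ltr0n x0 subr_gt0.
  have /cvgrPdist_lt /(_ _ m0) := cvg_shrinking_radius.
  apply: filterS => n; rewrite sub0r normrN gtr0_norm ?shrinking_radius_gt0 //.
  rewrite !lt_min => /and3P[h1 h2 h3].
  have r0 := shrinking_radius_gt0 n.
  have := ball_average_le Lg tau0 hg r0 h1 h2.
  have -> : x + shrinking_radius n < 1 by lra.
  move=> /(_ isT) hb.
  have a0 : 0 <= a n by rewrite invr_ge0 mulr_ge0 // ltW.
  rewrite !exprMn -mulrDr.
  have -> : tau ^+ 2 = a n ^+ 2 * (tau * (2 * shrinking_radius n)) ^+ 2.
    by rewrite /a; field; rewrite gt_eqF.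
  rewrite ler_wpM2l ?exprn_ge0 //.
  have t0 : 0 <= tau * (2 * shrinking_radius n) by rewrite !mulr_ge0 // ltW.
  have h2b : nc (cint (ball x (shrinking_radius n)) g) ^+ 2 <= (tau * (2 * shrinking_radius n)) ^+ 2.
    by rewrite ler_pXn2r ?nnegrE ?nc_ge0.
  by move: h2b; rewrite nc_sqr.
Qed.

End EssentialBound.

(** * Upper bound *)

Section StepFunctions.
Context {R : realType}.
Local Notation C := R[i].
Local Notation nc := (@Normc.normc R).
Local Notation mT := (torus_measure R).
Local Notation T := (measurableTypeR R).

Definition frac (x : R) : R := x - (Num.floor x)%:~R.

Lemma frac_id (x : T) : unit_itv x -> frac x = x.
Proof.
rewrite /unit_itv /= in_itv /= => /andP[x0 x1].
by rewrite /frac (@floor_def _ _ 0) ?subr0 // x0 add0r.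
Qed.

Lemma fracD1 x : frac (x + 1) = frac x.
Proof. by rewrite /frac floorDrz ?rpred1 // floor1 rmorphD /= opprD addrACA subrr addr0. Qed.

Lemma measurable_frac : measurable_fun setT (frac : T -> T).
Proof.
apply: measurable_funB; first exact: measurable_id.
by apply: nondecreasing_measurable => // x y xy; rewrite ler_int le_floor.
Qed.

(** The fractional part makes the function 1-periodic on the whole line, as membership in [Lp]
    demands. *)
Definition step M (c : nat -> C) (x : R) : C :=
  \sum_(j < M) c j * ((\1_(cell M j) (frac x))%:C)%C.

Lemma step_periodic M c : periodic (step M c) 1.
Proof. by move=> x; rewrite /step fracD1. Qed.

Lemma cmeas_step M c : cmeasurable (step M c).
Proof.
apply: cmeas_sum => j _; apply: cmeasM; first exact: cmeas_cst.
split => /=; last exact: measurable_cst.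
apply: (measurableT_comp (f := \1_(cell M j) : T -> R)); last exact: measurable_frac.
by apply: measurable_indic; apply: (@measurable_cell R).
Qed.

Lemma step_cell M c j (x : T) : (j < M)%N -> cell M j x -> step M c x = c j.
Proof.
move=> jM xj; have M0 : (0 < M)%N by apply: leq_ltn_trans jM.
have xU : unit_itv x by apply: cell_sub xj.
rewrite /step (frac_id xU) (bigD1 (Ordinal jM)) //= big1 => [|i ij].
  by rewrite indicE mem_set //= mulr1 addr0.
rewrite indicE memNset /= ?mulr0 // => xi.
move: ij; rewrite -(inj_eq val_inj) /=.
by rewrite -(cell_truncn M0 xi) -(cell_truncn M0 xj) eqxx.
Qed.

Lemma step_bounded M c x : nc (step M c x) <= \sum_(j < M) nc (c j).
Proof.
apply: le_trans (nc_sum _ _ _) _; apply: ler_sum => j _.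
by rewrite ncM nc_real ger0_norm // ler_piMr ?nc_ge0.
Qed.

End StepFunctions.

(** * A low-dimensional space near the exponentials *)

Section DigitSpace.
Context {R : realType}.
Local Notation C := R[i].
Local Notation nc := (@Normc.normc R).
Local Notation mT := (torus_measure R).
Local Notation T := (measurableTypeR R).
Variable p : R.
Hypothesis p1 : 1 <= p.
Hypothesis p2 : p < 2.

Lemma low_rank_exponentials : exists b : nat, exists2 K : R, (2 < b)%N /\ 0 < K &
  forall J, exists (I : finType) (e : I -> R -> C),
  [/\ (#|I| * 2 ^ J <= b ^ J)%N, forall i, Lp p (e i) &
  forall k : int, (`|k| < (b ^ J)./2)%N -> exists a : I -> C,
    (Lp_norm p (fun x => ek k x - \sum_i a i * e i x)%R <= (K * 2^-1 ^+ J)%:E)%E].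
Proof.
have hp1 := p1; have hp2 := p2.
have p0 : 0 < p by lra.
have [L L0 lip] := @ee_lipschitz R.
have [b b2 hb] := low_rank_digits p1 p2.
pose K0 := 4 * (L `^ p + 52).
have K00 : 0 < K0 by have := powR_ge0 L p; rewrite /K0; lra.
exists b, (K0 `^ p^-1); first by rewrite b2 powR_gt0.
move=> J; have J0 : (0 < 2 ^ J)%N by rewrite expn_gt0.
(* Oversampling by 2^J: freezing a frequency q < N on cells of length 1/M costs at most L q / M <= L
   2^-J. *)
have [r [U [[I cI [A [B UE]]] rJ hU]]] := hb J _ J0.
pose N := (b ^ J)%N; pose M := (b ^ J * 2 ^ J)%N.
have N0 : (0 < N)%N by rewrite expn_gt0; case: (b) b2.
have M0 : (0 < M)%N by rewrite muln_gt0 N0.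
pose h := (N./2)%N.
(* Modulation by -h moves the rows 0, ..., N - 1 of the matrix to frequencies around 0 without
   changing moduli. *)
exists I, (fun t x => ek (- h%:Z) x * step M (B t) x); split.
- by apply: leq_trans rJ; rewrite leq_mul2r cI orbT.
- move=> t; apply: (@Lp_bounded _ _ _ (\sum_(j < M) nc (B t j))) => //.
  + by move=> x; rewrite ek_periodic step_periodic.
  + by apply: cmeasM; [exact: cmeas_ek | exact: cmeas_step].
  + by move=> x; rewrite ncM nc_ek mul1r step_bounded.
move=> k kh.
have [q qE qN] : exists2 q : nat, (k + h%:Z)%R = q :> int & (q < N)%N.
  by exists (absz (k + h%:Z)%R); move: kh; rewrite -/N -/h /h; lia.
exists (A q).
set f := (fun x => _).
have mf : cmeasurable f.
  apply: cmeasB; first exact: cmeas_ek.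
  apply: cmeas_sum => i _; apply: cmeasM; first exact: cmeas_cst.
  by apply: cmeasM; [exact: cmeas_ek | exact: cmeas_step].
pose e0 : R := L * 2^-1 ^+ J.
have e00 : 0 <= e0 by rewrite mulr_ge0 ?exprn_ge0 ?invr_ge0 // ltW.
have J2 : 0 <= 2^-1 ^+ J :> R by rewrite exprn_ge0 ?invr_ge0.
rewrite Lp_norm_leP // ?mulr_ge0 ?powR_ge0 //.
pose delta j := e0 + nc (dft M q j - U q j).
apply: le_trans (int_powR_cells_le (delta := delta) p0 M0 mf _) _.
  move=> j x jM xj.
  have -> : f x = ek (- h%:Z) x * (ek q x - U q j).
    have kE : ek k x = ek (- h%:Z) x * ek q x.
      by rewrite -ekD -qE; congr (ek _ x); lia.
    rewrite /f kE mulrBr; congr (_ - _).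
    rewrite UE mulr_sumr; apply: eq_bigr => t _.
    by rewrite (step_cell _ jM xj) mulrCA.
  rewrite ncM nc_ek mul1r.
  have -> : ek q x - U q j = (ek q x - dft M q j) + (dft M q j - U q j).
    by rewrite addrA subrK.
  apply: le_trans (ncD _ _) _; rewrite lerD2r.
  apply: le_trans (lip _ _) _.
  move: xj; rewrite /cell /= in_itv /= => /andP[x0 x1].
  have MR : 0 < M%:R :> R by rewrite ltr0n.
  rewrite /e0 ler_pM2l // -pmulrn -mulrA -mulrBr normrM ger0_norm //.
  have h2 : `|x - j%:R / M%:R| <= M%:R^-1.
    rewrite ger0_norm ?subr_ge0 // lerBlDl ltW // (lt_le_trans x1) //.
    by rewrite -natr1 mulrDl mul1r.
  have h1 : q%:R <= N%:R :> R by rewrite ler_nat ltnW.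
  apply: le_trans (ler_pM _ _ h1 h2) _ => //.
  rewrite /M natrM invfM mulrA mulfV ?pnatr_eq0 -?lt0n // mul1r natrX.
  by rewrite exprVn.
rewrite lee_fin powRM ?powR_ge0 // -powRrM mulVf ?gt_eqF // powRr1; last exact: ltW.
rewrite ler_pdivrMl ?ltr0n //.
apply: (@le_trans _ _ (\sum_(j < M) 4 * (e0 `^ p + nc (dft M q j - U q j) `^ p))).
  apply: ler_sum => j _; apply: powR_add_le => //; [exact: ltW | exact: nc_ge0].
rewrite -mulr_sumr big_split /= sumr_const card_ord.
have h3 := hU q qN.
have h4 : e0 `^ p = L `^ p * (2^-1 ^+ J) `^ p by rewrite powRM // ltW.
rewrite h4 /K0 -[_ *+ M]mulr_natl.
apply: le_trans (ler_wpM2l _ (lerD (lexx _) h3)) _ => //.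
by rewrite -/M le_eqVlt; apply/orP; left; apply/eqP; ring.
Qed.

End DigitSpace.

(** * Truncation in the Wiener ball, and spans modulo null sets *)

Section WienerBall.
Context {R : realType}.
Local Notation C := R[i].
Local Notation nc := (@Normc.normc R).
Local Notation mT := (torus_measure R).
Local Notation T := (measurableTypeR R).

Lemma wiener_sum_le (beta : R) (f : R -> C) (s : seq int) : wiener_ball beta f -> uniq s ->
  \sum_(k <- s) (1 + `|k%:~R|) `^ beta * nc (fourier f k) <= 1.
Proof.
move=> [_ h] us; rewrite -lee_fin; apply: le_trans h.
apply: esum_ge; exists [set` s]; first by split; [exact: finite_seq|exact: subsetT].
by rewrite -fsbig_seq // sumEFin.
Qed.

(** The truncated predecessors make the list empty for N = 0, a case that occurs when n = 1. *)
Definition ints_lt N : seq int := [seq (i%:Z - N.-1%:Z)%R | i <- iota 0 (2 * N).-1].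

Lemma mem_ints_lt N (k : int) : (k \in ints_lt N) = (`|k| < N)%N.
Proof.
apply/mapP/idP => [ex | kN]; first by case: ex => i; rewrite mem_iota => /andP[_ h] ->; lia.
by exists (absz (k + N.-1%:Z)%R); [rewrite mem_iota; lia | lia].
Qed.

Lemma uniq_ints_lt N : uniq (ints_lt N).
Proof. by rewrite map_inj_uniq ?iota_uniq // => i j; lia. Qed.

Lemma fourier_sub_trig (f : R -> C) (s : seq int) (a : int -> C) k : Lp 1 f -> uniq s ->
  fourier (fun x => f x - \sum_(l <- s) a l * ek l x) k =
  fourier f k - (if k \in s then a k else 0).
Proof.
move=> Lf us.
have fi := Lp_cintegrable (lexx 1) Lf.
have fk : cintegrable setT (fun x => f x * ek (- k) x).
  apply: (@cintegrable_mul_bounded _ _ _ _ 1) => //; [exact: Lp_cmeas Lf|exact: cmeas_ek|].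
  by move=> x; rewrite nc_ek.
rewrite [LHS]fourierE.
rewrite (cint_ext (g := fun x => f x * ek (- k) x + \sum_(l <- s) (- a l) * ek (l - k) x)); last first.
  move=> x _; rewrite mulrBl mulr_suml -sumrN; congr (_ + _).
  by apply: eq_bigr => l _; rewrite mulNr ekD mulrA.
rewrite cintD //; last by apply: cintegrable_sum => // l; exact: cintegrable_ek.
rewrite -fourierE (cint_sum s (fun l => - a l) (F := fun l x => ek (l - k) x)) //; last first.
  by move=> l; exact: cintegrable_ek.
congr (_ + _); under eq_bigr do rewrite cint_ek subr_eq0.
case: ifPn => ks.
  rewrite (bigD1_seq k) //= eqxx mulr1 big1 ?addr0 // => l lk.
  by rewrite (negbTE lk) mulr0.
rewrite oppr0 big_seq big1 // => l ls.
by case: eqP ls ks => [->->|_ _ _] //; rewrite mulr0.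
Qed.

(** The remainder has coefficients only at |k| >= N, and their moduli sum to at most (1 + N)^-beta
    because the weighted sum is at most 1. On a space of mass 1 an essential sup bound also bounds
    the L_p norm. *)
Lemma wiener_tail (p beta : R) (f : R -> C) N : 0 < p -> 0 < beta -> wiener_ball beta f ->
  (Lp_norm p (fun x => f x - \sum_(k <- ints_lt N) fourier f k * ek k x)%R <=
   ((1 + N%:R) `^ (- beta))%:E)%E.
Proof.
move=> p0 b0 wf; have Lf := wf.1.
set h := (fun x => _).
have Lh : Lp 1 h.
  have := Lp_lin (-1) (lexx 1)
    (Lp_sum (ints_lt N) (P := xpredT) (fourier f) (lexx 1) (fun k _ => ek_Lp k ltr01)) Lf.
  by congr (Lp 1); apply/funext => x; rewrite /h mulN1r addrC.
apply: Lp_norm_ae_le => //; [exact: Lp_cmeas Lh|].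
apply: ae_norm_le_fourier => //.
move=> s us; have hN : 0 < (1 + N%:R) `^ (- beta) :> R by rewrite powR_gt0 // ltr_pwDl.
rewrite -[leRHS]mulr1; apply: le_trans (ler_wpM2l (ltW hN) (wiener_sum_le wf us)).
rewrite mulr_sumr; apply: ler_sum => k _.
rewrite fourier_sub_trig ?uniq_ints_lt // mem_ints_lt.
case: ltnP => kN.
  by rewrite subrr nc0 !mulr_ge0 ?powR_ge0 ?nc_ge0.
rewrite subr0 mulrA ler_peMl ?nc_ge0 // powRN mulrC ler_pdivlMr ?powR_gt0 ?ltr_pwDl // mul1r.
apply: powR_mono; [exact: ltW| by rewrite addr_ge0|].
by rewrite lerD2l -intr_norm -[N%:R]/(N%:Z%:~R) ler_int lez_nat.
Qed.

Lemma ae_eq_ext (f g h : R -> C) : (forall x, g x = h x) ->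
  f = g %[ae mT] -> f = h %[ae mT].
Proof. by move=> /funext ->. Qed.

(** [dim_le] asks for a family of exactly n spanning elements, so a shorter one is padded with
    zeros. *)
Lemma dim_le_add (V : set (R -> C)) m n : V (fun=> 0) -> dim_le V m -> dim_le V (m + n).
Proof.
move=> V0 [e eV h].
exists (fun i : 'I_(m + n) => match fintype.split i with inl j => e j | inr _ => fun=> 0 end).
  by move=> i; case: (fintype.split i).
move=> f /h[a ha]; exists (fun i => match fintype.split i with inl j => a j | inr _ => 0 end).
apply: ae_eq_ext ha => x.
rewrite big_split_ord /= [X in _ = _ + X]big1 ?addr0 => [|i _].
  by apply: eq_bigr => i _; rewrite (unsplitK (inl i)).
by rewrite (unsplitK (inr i)) mulr0.
Qed.

Definition ae_span (p : R) (I : finType) (e : I -> R -> C) : set (R -> C) :=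
  [set f | Lp p f /\ exists a : I -> C, f = (fun x => \sum_i a i * e i x) %[ae mT]].

Lemma ae_span_comb p (I : finType) (e : I -> R -> C) (a : I -> C) : 1 <= p ->
  (forall i, Lp p (e i)) -> ae_span p e (fun x => \sum_i a i * e i x).
Proof.
move=> p1 he; split; first exact: Lp_sum.
by exists a; apply: aeW.
Qed.

Lemma ae_span_subspace p (I : finType) (e : I -> R -> C) : 1 <= p ->
  (forall i, Lp p (e i)) -> Lp_subspace p (ae_span p e).
Proof.
move=> p1 he; split.
- by move=> f [].
- have := ae_span_comb (fun=> 0) p1 he.
  by congr (ae_span p e _); apply/funext => x; rewrite big1 // => i _; rewrite mul0r.
- move=> c f g [Lf [a ha]] [Lg [b hb]]; split; first exact: Lp_lin.
  exists (fun i => c * a i + b i); move: ha hb.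
  apply: filterS2; first exact: (ae_filter_ringOfSetsType mT).
  move=> x h1 h2 _; rewrite h1 // h2 // mulr_sumr -big_split /=.
  by apply: eq_bigr => i _; rewrite mulrDl mulrA.
- move=> f g [Lf [a ha]] Lg fg; split=> //; exists a; move: ha fg.
  apply: filterS2; first exact: (ae_filter_ringOfSetsType mT).
  by move=> x h1 h2 _; rewrite -h2 // h1.
Qed.

Lemma ae_span_dim_le p (I : finType) (e : I -> R -> C) n : 1 <= p ->
  (forall i, Lp p (e i)) -> (#|I| <= n)%N -> dim_le (ae_span p e) n.
Proof.
move=> p1 he cI; rewrite -(subnKC cI).
have [_ V0 _ _] := ae_span_subspace p1 he.
apply: dim_le_add => //; exists (fun i => e (enum_val i)).
  move=> i; have := ae_span_comb (fun j => (j == enum_val i)%:R) p1 he.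
  congr (ae_span p e _); apply/funext => x.
  rewrite (bigD1 (enum_val i)) //= eqxx mul1r big1 ?addr0 // => j ij.
  by rewrite (negbTE ij) mul0r.
move=> f [_ [a ha]]; exists (fun i => a (enum_val i)).
apply: ae_eq_ext ha => x.
by rewrite (reindex_onto enum_val enum_rank) /=; [apply: eq_bigl => i; rewrite enum_valK eqxx|
   move=> i _; rewrite enum_rankK].
Qed.

End WienerBall.

(** * The approximating space and its two error terms *)

Section UpperBound.
Context {R : realType}.
Local Notation C := R[i].
Local Notation nc := (@Normc.normc R).
Local Notation mT := (torus_measure R).
Local Notation T := (measurableTypeR R).
Variable p : R.
Hypothesis p1 : 1 <= p.
Hypothesis p2 : p < 2.

(** [m] is the cut below which frequencies are kept exactly, [J] the depth of the digit space. The
    dimension r of that space is known only through r 2^J <= b^J, whence the form of the hypothesis;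
    its error carries the factor (1 + m)^-beta because only frequencies |k| >= m contribute. *)
Lemma width_le : exists b : nat, exists2 K : R, (2 < b)%N /\ 0 < K &
  forall (beta : R) n m J, 0 < beta ->
  (forall r, (r * 2 ^ J <= b ^ J)%N -> ((2 * m).-1 + r <= n)%N) ->
  (kolmogorov_width p (wiener_ball beta) n <=
   (K * 2^-1 ^+ J * (1 + m%:R) `^ (- beta) + (1 + (b ^ J)./2%:R) `^ (- beta))%R%:E)%E.
Proof.
have hp1 := p1; have p0 : 0 < p by lra.
have [b [K [b2 K0] hb]] := low_rank_exponentials p1 p2.
exists b, K => // beta n m J be0 hn.
have [I [e [/hn cI Le he]]] := hb J.
pose e' (i : 'I_(2 * m).-1 + I) :=
  match i with inl j => ek ((val j)%:Z - m.-1%:Z)%R | inr t => e t end.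
have Le' i : Lp p (e' i) by case: i => [j|t] //=; exact: ek_Lp.
(* The maximum is taken because no order between [m] and [N] is assumed. *)
set N := (b ^ J)./2; pose L := ints_lt (maxn m N).
pose eps (k : int) : R := if (`|k| < m)%N then 0 else K * 2^-1 ^+ J.
have KJ0 : 0 <= K * 2^-1 ^+ J by rewrite mulr_ge0 ?exprn_ge0 ?invr_ge0 // ltW.
have /choice[A hA] : forall k : int, exists a : 'I_(2 * m).-1 + I -> C, (`|k| < maxn m N)%N ->
    (Lp_norm p (fun x => ek k x - \sum_i a i * e' i x)%R <= (eps k)%:E)%E.
  move=> k; rewrite /eps; case: ifPn => km.
    have jm : (absz (k + m.-1%:Z)%R < (2 * m).-1)%N by lia.
    exists (fun i => if i is inl j then (j == Ordinal jm)%:R else 0) => _.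
    rewrite (_ : (fun x => _) = (fun=> 0)) ?Lp_norm0 //; apply/funext => x.
    rewrite big_sumType /= [X in _ - (_ + X)]big1 ?addr0 => [|t _]; last by rewrite mul0r.
    rewrite (bigD1 (Ordinal jm)) //= eqxx mul1r big1 ?addr0 => [|j ij]; last first.
      by rewrite (negbTE ij) mul0r.
    by rewrite (_ : (_ - _)%R = k) ?subrr //; lia.
  have [kN|kN] := ltnP `|k| N; last first.
    by exists (fun=> 0); rewrite leq_max; lia.
  have [a ha] := he k kN; exists (fun i => if i is inr t then a t else 0) => _.
  apply: le_trans ha; rewrite le_eqVlt; apply/orP; left; apply/eqP; congr Lp_norm.
  apply/funext => x; rewrite big_sumType /= big1 ?add0r => [//|j _].
  by rewrite mul0r.
apply: (@le_trans _ _ (ereal_sup [set Lp_dist p f (ae_span p e') | f in wiener_ball beta])).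
  apply: ereal_inf_lbound; exists (ae_span p e') => //; split; first exact: ae_span_subspace.
  by apply: ae_span_dim_le => //; rewrite card_sum card_ord.
apply: ge_ereal_sup => _ [f wf <-].
pose c k := fourier f k.
pose d (k : int) (x : R) : C := ek k x - \sum_i A k i * e' i x.
have Ld k : Lp p (d k).
  have := Lp_lin (-1) p1 (Lp_sum (index_enum _) (P := xpredT) (A k) p1 (fun i _ => Le' i)) (ek_Lp k p0).
  by congr (Lp p); apply/funext => x; rewrite mulN1r addrC.
(* [g] is a partial Fourier sum of [f] with each exponential replaced by its approximant, so f - g
   is the tail plus the sum of the [c k * d k]. *)
pose g (x : R) : C := \sum_i (\sum_(k <- L) c k * A k i) * e' i x.
apply: (@le_trans _ _ (Lp_norm p (fun x => f x - g x)%R)).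
  by apply: ereal_inf_lbound; exists g => //; exact: ae_span_comb.
have -> : (fun x => f x - g x) =
  (fun x => (f x - \sum_(k <- L) c k * ek k x) + \sum_(k <- L) c k * d k x).
  apply/funext => x.
  suff -> : \sum_(k <- L) c k * d k x = \sum_(k <- L) c k * ek k x - g x by rewrite addrA subrK.
  have -> : g x = \sum_(k <- L) c k * \sum_i A k i * e' i x.
    rewrite /g; under eq_bigr do rewrite mulr_suml.
    rewrite exchange_big /=; apply: eq_bigr => k _.
    by rewrite mulr_sumr; apply: eq_bigr => i _; rewrite mulrA.
  by rewrite -sumrB; apply: eq_bigr => k _; rewrite /d mulrBr.
have mf := Lp_cmeas wf.1.
have md k : cmeasurable (fun x => c k * d k x).
  by apply: cmeasM; [exact: cmeas_cst | exact: Lp_cmeas (Ld k)].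
apply: le_trans (Lp_normD p1 _ _) _.
- apply: cmeasB => //; apply: cmeas_sum => k _; apply: cmeasM; [exact: cmeas_cst|exact: cmeas_ek].
- by apply: cmeas_sum.
rewrite addrC EFinD; apply: leeD; last first.
  apply: le_trans (wiener_tail _ p0 be0 wf) _; rewrite lee_fin.
  rewrite !powRN lef_pV2 ?posrE ?powR_gt0 ?ltr_pwDl //.
  by apply: powR_mono; rewrite ?addr_ge0 ?(ltW be0) // lerD2l ler_nat leq_maxr.
apply: le_trans (Lp_norm_sum _ p1 _) _ => //.
apply: (@le_trans _ _ (\sum_(k <- L) (nc (c k) * eps k)%:E)%E).
  rewrite big_seq [leRHS]big_seq; apply: lee_sum => k; rewrite mem_ints_lt => kL.
  rewrite Lp_normZ //; last exact: Lp_cmeas (Ld k).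
  by rewrite EFinM lee_wpmul2l ?lee_fin ?nc_ge0 //; exact: hA.
rewrite sumEFin lee_fin -[leRHS]mulr1.
have h0 : 0 <= K * 2^-1 ^+ J * (1 + m%:R) `^ (- beta) by rewrite mulr_ge0 ?powR_ge0.
apply: le_trans (ler_wpM2l h0 (wiener_sum_le wf (uniq_ints_lt (maxn m N)))).
rewrite mulr_sumr; apply: ler_sum => k _; rewrite /eps.
case: ltnP => km; first by rewrite mulr0 mulr_ge0 // mulr_ge0 ?powR_ge0 ?nc_ge0.
rewrite mulrC -[leRHS]mulrA; apply: ler_wpM2l => //.
rewrite mulrA ler_peMl ?nc_ge0 // powRN mulrC ler_pdivlMr ?powR_gt0 ?ltr_pwDl // mul1r.
apply: powR_mono; [exact: ltW| by rewrite addr_ge0|].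
by rewrite lerD2l -intr_norm -[m%:R]/(m%:Z%:~R) ler_int lez_nat.
Qed.

End UpperBound.

(** * Choice of the depth and of the exponent *)

Section UpperExponent.
Context {R : realType}.
Variable p : R.
Hypothesis p1 : 1 <= p.
Hypothesis p2 : p < 2.

(** J is the least integer with (b/2)^(J+1) > n/2. For J > 0 minimality gives (b/2)^J <= n/2, which
    leaves half of the dimension for the frequencies below n/4; for J = 0 the digit space has
    dimension at most 1. *)
Lemma choose_depth (b n : nat) : (2 < b)%N -> (0 < n)%N -> exists J,
  (forall r, (r * 2 ^ J <= b ^ J)%N -> ((2 * (n %/ 4)).-1 + r <= n)%N) /\
  (n * 2 ^ J.+1 < 2 * b ^ J.+1)%N.
Proof.
move=> b2 n0.
have ex : exists J, (n * 2 ^ J.+1 < 2 * b ^ J.+1)%N.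
  exists n; apply: (@leq_trans (2 * 3 ^ n.+1)); last by rewrite leq_mul2l leq_exp2r.
  elim: (n) => // k IH; rewrite (expnS 2 k.+1) (expnS 3 k.+1).
  have : (2 ^ k.+1 <= 3 ^ k.+1)%N by rewrite leq_exp2r.
  nia.
exists (ex_minn ex); case: ex_minnP => J h hmin; split => // r.
case: J h hmin => [_ _|J h hmin hr].
  by rewrite !expn0 muln1 => r1; lia.
have : ~~ (n * 2 ^ J.+1 < 2 * b ^ J.+1)%N.
  by apply/negP => /hmin; rewrite ltnn.
rewrite -leqNgt => h2.
have J0 : (0 < 2 ^ J.+1)%N by rewrite expn_gt0.
have : (2 * r <= n)%N by rewrite -(leq_pmul2r J0) (leq_trans _ h2) // -mulnA leq_mul2l.
lia.
Qed.

Lemma width_upper : exists2 c : R, 0 < c & forall beta : R, 0 < beta ->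
  lesssim (kolmogorov_width p (wiener_ball beta))
          (fun n => (n%:R `^ (- beta - c * Num.min 1 beta))%:E).
Proof.
have [b [K [b2 K0] hb]] := width_le p1 p2.
pose lam : R := b%:R / 2.
have lam1 : 1 < lam by rewrite /lam ltr_pdivlMr // mul1r ltr_nat.
have lam0 : 0 < lam by lra.
have ln1 : 0 < ln lam by rewrite ln_gt0.
(* [b] is obtained from [p] before [beta] enters, hence so is [c]. *)
pose c := ln 2 / ln lam.
have c0 : 0 < c by rewrite divr_gt0 // ln_gt0 // ltr1n.
have lamc : lam `^ c = 2.
  by rewrite /powR gt_eqF // /c divfK ?gt_eqF // lnK // posrE.
exists c => // beta be0.
(* The constant for which kap n^(1 + c) <= b^J / 2: multiply n < 2 lam^(J+1) by n^c <= 2^c 2^(J+1)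
   and use b = 2 lam. *)
pose kap : R := 2^-1 `^ c / (8 * lam).
have kap0 : 0 < kap by apply: divr_gt0; [rewrite powR_gt0 | apply: mulr_gt0].
exists (K * 2 * 2 `^ c * 4 `^ beta + kap `^ (- beta)).
  by apply: addr_gt0; rewrite ?powR_gt0 //; do !apply: mulr_gt0 => //; rewrite powR_gt0.
move=> n n0; have [J [hJ1 hJ2]] := choose_depth b2 n0.
apply: le_trans (hb beta n (n %/ 4)%N J be0 hJ1) _.
rewrite -EFinM lee_fin mulrDl.
have nR : 0 < n%:R :> R by rewrite ltr0n.
have n1 : 1 <= n%:R :> R by rewrite ler1n.
have J2 : 0 < 2 ^+ J :> R by rewrite exprn_gt0.
have lamJ : n%:R < 2 * lam ^+ J.+1.
  rewrite /lam expr_div_n mulrA ltr_pdivlMr ?exprn_gt0 //.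
  by rewrite -!natrX -!natrM ltr_nat.
(* lam^c = 2 turns the growth of lam^J into a power of n *)
have h2J : n%:R `^ c <= 2 `^ c * 2 ^+ J.+1.
  have <- : (lam ^+ J.+1) `^ c = 2 ^+ J.+1.
    by rewrite -powR_mulrn ?(ltW lam0) // -powRrM mulrC powRrM lamc powR_mulrn.
  rewrite -powRM ?exprn_ge0 ?(ltW lam0) //; apply: powR_mono; last exact: ltW.
  - exact: ltW.
  - exact: ltW.
have m0 : 0 <= Num.min 1 beta.
  by rewrite le_min ler01 ltW.
have m1 : Num.min 1 beta <= 1 by rewrite ge_min lexx.
have m2 : Num.min 1 beta <= beta by rewrite ge_min lexx orbT.
apply: lerD.
  have e1 : 2^-1 ^+ J <= 2 * 2 `^ c * n%:R `^ (- c).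
    rewrite powRN exprVn ler_pdivlMr ?powR_gt0 // ler_pdivrMl //.
    by rewrite mulrCA mulrA -exprS mulrC.
  have e2 : (1 + (n %/ 4)%:R) `^ (- beta) <= 4 `^ beta * n%:R `^ (- beta) :> R.
    have -> : (4 : R) `^ beta = 4^-1 `^ (- beta) by rewrite -powR_inv1 // -powRrM mulN1r opprK.
    rewrite -powRM ?invr_ge0 // !powRN lef_pV2 ?posrE ?powR_gt0 ?mulr_gt0 ?ltr_pwDl //.
    apply: powR_mono; rewrite ?(ltW be0) ?mulr_ge0 //.
    by rewrite mulrC ler_pdivrMr // nat1r -natrM ler_nat; clear; lia.
  apply: (@le_trans _ _ (K * (2 * 2 `^ c * n%:R `^ (- c)) * (4 `^ beta * n%:R `^ (- beta)))).
    apply: ler_pM; rewrite ?mulr_ge0 ?powR_ge0 ?exprn_ge0 ?invr_ge0 ?(ltW K0) //.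
    by rewrite ler_pM2l.
  rewrite [leLHS](_ : _ = K * 2 * 2 `^ c * 4 `^ beta * (n%:R `^ (- beta) * n%:R `^ (- c))); last by ring.
  rewrite ler_wpM2l ?mulr_ge0 ?powR_ge0 ?(ltW K0) // -powRD ?(gt_eqF nR) ?implybT //.
  by apply: ler_powR => //; rewrite lerD2l lerN2 ger_pMr.
have e3 : kap * n%:R `^ (1 + c) <= 1 + (b ^ J)./2%:R.
  apply: (@le_trans _ _ ((b ^ J)%:R / 2)).
    rewrite powRD ?(gt_eqF nR) ?implybT // powRr1 ?(ltW nR) //.
    apply: (@le_trans _ _ (kap * (2 * lam ^+ J.+1 * (2 `^ c * 2 ^+ J.+1)))).
      by rewrite ler_pM2l // ler_pM ?powR_ge0 ?(ltW nR) // ltW.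
    rewrite le_eqVlt; apply/orP; left; apply/eqP.
    have h1 : 2^-1 `^ c * 2 `^ c = 1 :> R by rewrite -powRM ?invr_ge0 // mulVf // powR1.
    have h2 : (b ^ J)%:R = lam ^+ J * 2 ^+ J by rewrite natrX -exprMn /lam divfK.
    rewrite h2 /kap !exprS.
    rewrite [LHS](_ : _ = (2^-1 `^ c * 2 `^ c) * (lam ^+ J * 2 ^+ J / 2)); first by rewrite h1 mul1r.
    by field; rewrite gt_eqF.
  by rewrite ler_pdivrMr // nat1r -natrM ler_nat; clear; lia.
have e4 : 0 < kap * n%:R `^ (1 + c) by rewrite mulr_gt0 ?powR_gt0.
apply: (@le_trans _ _ ((kap * n%:R `^ (1 + c)) `^ (- beta))).
  rewrite !powRN lef_pV2 ?posrE ?powR_gt0 ?ltr_pwDl //.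
  by apply: powR_mono; rewrite ?(ltW be0) ?(ltW e4).
rewrite powRM ?powR_ge0 ?(ltW kap0) // ler_wpM2l ?powR_ge0 // -powRrM.
apply: ler_powR => //.
rewrite mulrN mulrDl mul1r opprD lerD2l lerN2 ler_pM2l //.
Qed.

End UpperExponent.

(** * Reproducing kernels and Lewis weights *)

Section WeightedInnerProduct.
Context {R : realType} (X : finType).
Local Notation C := R[i].
Local Notation nc := (@Normc.normc R).
Implicit Types (w : X -> R) (f g v : X -> C).

(** Lagrange's identity: twice the difference is a double sum of squares. *)
Lemma sum_mul_sqr_le (I : finType) (a b : I -> R) :
  (\sum_i a i * b i) ^+ 2 <= (\sum_i a i ^+ 2) * (\sum_i b i ^+ 2).
Proof.
rewrite -subr_ge0 -(pmulr_rge0 _ (ltr0Sn R 1)).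
have -> : 2 * ((\sum_i a i ^+ 2) * (\sum_i b i ^+ 2) - (\sum_i a i * b i) ^+ 2) =
    \sum_i \sum_j (a i * b j - a j * b i) ^+ 2.
  have e1 : (\sum_i a i ^+ 2) * (\sum_i b i ^+ 2) = \sum_i \sum_j a i ^+ 2 * b j ^+ 2.
    by rewrite mulr_suml; apply: eq_bigr => i _; rewrite mulr_sumr.
  have e2 : (\sum_i a i ^+ 2) * (\sum_i b i ^+ 2) = \sum_i \sum_j a j ^+ 2 * b i ^+ 2.
    by rewrite e1 exchange_big.
  have e3 : (\sum_i a i * b i) ^+ 2 = \sum_i \sum_j (a i * b i) * (a j * b j).
    by rewrite expr2 mulr_suml; apply: eq_bigr => i _; rewrite mulr_sumr.
  rewrite mulrBr mulr_natl mulr2n [X in X + _ - _]e1 [X in _ + X - _]e2 e3.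
  rewrite -!big_split /= mulr_sumr -sumrB; apply: eq_bigr => i _.
  rewrite -!big_split /= mulr_sumr -sumrB; apply: eq_bigr => j _.
  by ring.
by apply: sumr_ge0 => i _; apply: sumr_ge0 => j _; apply: sqr_ge0.
Qed.

Lemma nc_sum_mul_sqr_le (I : finType) (a b : I -> C) :
  nc (\sum_i a i * b i) ^+ 2 <= (\sum_i nc (a i) ^+ 2) * (\sum_i nc (b i) ^+ 2).
Proof.
apply: le_trans (sum_mul_sqr_le (fun i => nc (a i)) (fun i => nc (b i))).
rewrite ler_pXn2r ?nnegrE ?nc_ge0 ?sumr_ge0 // => [|i _]; last by rewrite mulr_ge0 ?nc_ge0.
by apply: le_trans (nc_sum _ _ _) _; apply: ler_sum => i _; rewrite ncM.
Qed.

Definition ip w f g : C := \sum_x ((w x)%:C * (f x * (g x)^*))%C.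

Lemma ip_sqr w f : ip w f f = ((\sum_x w x * nc (f x) ^+ 2)%:C)%C.
Proof.
by rewrite rmorph_sum /=; apply: eq_bigr => x _; rewrite mulcJ -real_complexM.
Qed.

Lemma ipC w f g : ip w g f = ((ip w f g)^*)%C.
Proof.
rewrite /ip rmorph_sum /=; apply: eq_bigr => x _.
rewrite !rmorphM /= conjcK [X in _ = X * _](_ : _ = ((w x)%:C)%C); first by rewrite [_^* * _]mulrC.
by rewrite /= /conjc /= oppr0.
Qed.

Lemma ip_suml w n (d : nat -> C) (u : nat -> X -> C) g :
  ip w (fun x => \sum_(j < n) d j * u j x) g = \sum_(j < n) d j * ip w (u j) g.
Proof.
rewrite /ip; under eq_bigr do rewrite mulr_suml mulr_sumr.
rewrite exchange_big /=; apply: eq_bigr => j _; rewrite mulr_sumr.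
by apply: eq_bigr => x _; rewrite -[in LHS]mulrA mulrCA.
Qed.

Lemma ip_lin w a f g v : ip w (fun x => a * f x + g x) v = a * ip w f v + ip w g v.
Proof.
by rewrite /ip mulr_sumr -big_split /=; apply: eq_bigr => x _; ring.
Qed.

Definition in_span n (e : nat -> X -> C) v : Prop :=
  exists d : nat -> C, forall x, v x = \sum_(i < n) d i * e i x.

Lemma in_span_gen n e i : (i < n)%N -> in_span n e (e i).
Proof.
move=> i_n; exists (fun j => (j == i)%:R) => x.
rewrite (bigD1 (Ordinal i_n)) //= eqxx mul1r big1 ?addr0 // => j ij.
by rewrite (_ : (val j == i) = false) ?mul0r //; apply/negbTE.
Qed.

Lemma in_span0 n e : in_span n e (fun=> 0).
Proof. by exists (fun=> 0) => x; rewrite big1 // => i _; rewrite mul0r. Qed.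

Lemma in_span_lin n e a f g : in_span n e f -> in_span n e g ->
  in_span n e (fun x => a * f x + g x).
Proof.
move=> [c hc] [d hd]; exists (fun i => a * c i + d i) => x.
rewrite hc hd mulr_sumr -big_split /=; apply: eq_bigr => i _.
by rewrite mulrDl mulrA.
Qed.

Lemma in_span_ext n e f g : (forall x, f x = g x) -> in_span n e f -> in_span n e g.
Proof. by move=> fg [d h]; exists d => x; rewrite -fg. Qed.

Lemma in_span_trans m n e (u : nat -> X -> C) v :
  (forall j, (j < m)%N -> in_span n e (u j)) -> in_span m u v -> in_span n e v.
Proof.
move=> h [d hd]; apply: in_span_ext (fun x => esym (hd x)) _.
elim: m h {hd} => [|m IH] h.
  by apply: in_span_ext (in_span0 n e) => x; rewrite big_ord0.
apply: in_span_ext (in_span_lin (d m) (h m (ltnSn m)) (IH _)) => [x|j jm]; last first.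
  by apply: h; apply: ltnW.
by rewrite big_ord_recr /= addrC.
Qed.

Lemma in_spanS n (u u' : nat -> X -> C) v : (forall j, (j < n)%N -> u' j = u j) ->
  in_span n u v -> in_span n.+1 u' v.
Proof.
move=> uu; apply: in_span_trans => j jn; rewrite -uu //.
by apply: in_span_gen; apply: ltnW.
Qed.

Lemma ip_eq0 w f : (forall x, 0 < w x) -> \sum_x w x * nc (f x) ^+ 2 = 0 -> forall x, f x = 0.
Proof.
move=> w0 h x.
have F0 (y : X) : true -> 0 <= w y * nc (f y) ^+ 2 by rewrite mulr_ge0 ?exprn_ge0 ?nc_ge0 // ltW.
move/eqP: h; rewrite psumr_eq0 // => /allP /(_ x (mem_index_enum x)) /=.
by rewrite mulf_eq0 gt_eqF //= expf_eq0 /= nc_eq0 => /eqP.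
Qed.

(* Null vectors are allowed, so that no linear independence has to be assumed. *)
Lemma gram_schmidt w n (e : nat -> X -> C) : (forall x, 0 < w x) ->
  exists u : nat -> X -> C,
  [/\ forall i j, (i < n)%N -> (j < n)%N -> i != j -> ip w (u i) (u j) = 0,
      forall i, (i < n)%N -> (forall x, u i x = 0) \/ ip w (u i) (u i) = 1,
      forall i, (i < n)%N -> in_span n u (e i) &
      forall i, (i < n)%N -> in_span n e (u i)].
Proof.
move=> w0; elim: n => [|n [u [uo un ue eu]]]; first by exists e.
pose c j := ip w (e n) (u j).
pose y x := e n x + \sum_(j < n) (- c j) * u j x.
have yu i : (i < n)%N -> ip w y (u i) = 0.
  move=> i_n.
  have -> : ip w y (u i) = 1 * ip w (e n) (u i) + ip w (fun x => \sum_(j < n) (- c j) * u j x) (u i).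
    by rewrite -ip_lin; congr (ip w _ _); apply/funext => x; rewrite mul1r.
  rewrite mul1r (ip_suml w n (fun j => - c j)) (bigD1 (Ordinal i_n)) //= big1 => [|j ji]; last first.
    by rewrite uo ?mulr0 //; apply: contraNneq ji => /= h; apply/eqP/val_inj.
  rewrite addr0 -/(c i); case: (un i i_n) => [u0|->]; last by rewrite mulr1 subrr.
  have ci0 : c i = 0 by rewrite /c /ip big1 // => x _; rewrite u0 rmorph0 !mulr0.
  by rewrite ci0 oppr0 mul0r addr0.
pose q := \sum_x w x * nc (y x) ^+ 2.
have q0 : 0 <= q by apply: sumr_ge0 => x _; rewrite mulr_ge0 ?exprn_ge0 ?nc_ge0 // ltW.
(* If q = 0, then y = 0 because the weight is positive, and z is the null vector whatever value 0^-1
   has. *)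
pose s : C := (((Num.sqrt q)^-1)%:C)%C.
pose z x := s * y x.
have zE v : ip w z v = s * ip w y v.
  rewrite -[RHS]addr0 -[X in _ + X](_ : ip w (fun=> 0) v = 0); last first.
    by rewrite /ip big1 // => x _; rewrite mul0r mulr0.
  by rewrite -ip_lin; congr (ip w _ _); apply/funext => x; rewrite addr0.
pose u' j := if j == n then z else u j.
have u'l j : (j < n)%N -> u' j = u j by move=> jn; rewrite /u' ltn_eqF.
have u'n : u' n = z by rewrite /u' eqxx.
have enz x : e n x = (((Num.sqrt q)%:C)%C : C) * z x + \sum_(j < n) c j * u j x.
  have -> : (((Num.sqrt q)%:C)%C : C) * z x = y x.
    rewrite /z /s mulrA -real_complexM.
    have [q00|q1] := eqVneq q 0.
      by rewrite (ip_eq0 w0 q00) mulr0.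
    rewrite mulfV ?mul1r // gt_eqF // sqrtr_gt0 lt_neqAle eq_sym q1 //.
  rewrite /y -addrA -big_split /= big1 ?addr0 // => j _.
  by rewrite mulNr addNr.
exists u'; split.
- move=> i j; rewrite !ltnS leq_eqVlt => /predU1P[->|i_n]; rewrite leq_eqVlt => /predU1P[->|jn] ij.
  + by rewrite eqxx in ij.
  + by rewrite u'n u'l // zE yu // mulr0.
  + by rewrite u'n u'l // ipC zE yu // mulr0 rmorph0.
  + by rewrite !u'l // uo.
- move=> i; rewrite ltnS leq_eqVlt => /predU1P[->|i_n]; last by rewrite u'l //; apply: un.
  rewrite u'n; have [q00|q1] := eqVneq q 0.
    by left => x; rewrite /z (ip_eq0 w0 q00) mulr0.
  right; rewrite ip_sqr.
  under eq_bigr do rewrite /z ncM exprMn mulrCA.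
  rewrite -mulr_sumr -/q /s nc_real ger0_norm ?invr_ge0 ?sqrtr_ge0 //.
  by rewrite exprVn sqr_sqrtr // mulVf.
- move=> i; rewrite ltnS leq_eqVlt => /predU1P[->|i_n].
    apply: in_span_ext (fun x => esym (enz x)) _.
    apply: in_span_lin; first by rewrite -u'n; apply: in_span_gen.
    by apply: (in_spanS u'l); exists c.
  by apply: (in_spanS u'l); apply: ue.
- have eS i : (i < n)%N -> in_span n.+1 e (u i) by move=> /eu; apply: in_spanS.
  move=> i; rewrite ltnS leq_eqVlt => /predU1P[->|i_n]; last by rewrite u'l //; apply: eS.
  rewrite u'n; apply: (in_span_ext (f := fun x => s * y x + 0)) => [x|]; first by rewrite addr0.
  apply: in_span_lin; last exact: in_span0.
  apply: (in_span_ext (f := fun x => 1 * e n x + \sum_(j < n) - c j * u j x)) => [x|].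
    by rewrite mul1r.
  apply: in_span_lin; first exact: in_span_gen.
  by apply: in_span_trans eS _; exists (fun j => - c j).
Qed.

End WeightedInnerProduct.

Section ReproducingKernel.
Context {R : realType} (X : finType).
Local Notation C := R[i].
Local Notation nc := (@Normc.normc R).
Implicit Types (w : X -> R) (f g v : X -> C).

(** The pairing carries no weight: the rows of the Fourier matrix are orthogonal for the counting
    measure, whatever weight the approximants are measured in. *)
Definition bessel N (F : nat -> X -> C) (B : R) : Prop :=
  forall y : X -> C, \sum_(k < N) nc (\sum_x y x * ((F k x)^*)%C) ^+ 2 <=
    B * \sum_x nc (y x) ^+ 2.

(** [K] is the diagonal of the reproducing kernel of the span in l_2(w), that is, the sum of |u_j|^2
    over an orthonormal basis. The fields record its trace, the bound on evaluation, an extremal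
    function for that bound, and an estimate for correlations with a Bessel family on a subset
    [S]. *)
Record repro_kernel w n (e : nat -> X -> C) (K : X -> R) : Prop := ReproKernel {
  kernel_ge0 : forall x, 0 <= K x;
  kernel_sum_le : \sum_x w x * K x <= n%:R;
  kernel_sup : forall v x, in_span n e v ->
    nc (v x) ^+ 2 <= K x * \sum_y w y * nc (v y) ^+ 2;
  kernel_att : forall x, exists v, [/\ in_span n e v, nc (v x) = K x &
    \sum_y w y * nc (v y) ^+ 2 = K x];
  kernel_corr : forall N (F W : nat -> X -> C) (B lam : R) (S : pred X),
    0 <= lam -> bessel N F B ->
    (forall k, (k < N)%N -> in_span n e (W k)) ->
    (forall k, (k < N)%N -> \sum_y w y * nc (W k y) ^+ 2 <= lam) ->
    \sum_(k < N) nc (\sum_(x | S x) W k x * ((F k x)^*)%C) ^+ 2 <=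
      lam * (B * \sum_(x | S x) K x) }.

(** For the correlations, each W_k is expanded in the orthonormal system, Cauchy's inequality
    separates its coefficients, and the Bessel bound is applied to each u_j cut off to [S];
    summation over j produces [K]. *)
Lemma repro_kernel_exists w n (e : nat -> X -> C) : (forall x, 0 < w x) ->
  exists K, repro_kernel w n e K.
Proof.
move=> w0; have [u [uo un ue eu]] := gram_schmidt n e w0.
pose K x := \sum_(j < n) nc (u j x) ^+ 2.
have dE (d : nat -> C) (j : 'I_n) :
    ip w (fun x => \sum_(j < n) d j * u j x) (u j) = d j * ip w (u j) (u j).
  rewrite ip_suml (bigD1 j) //= big1 ?addr0 // => i ij.
  by rewrite uo ?mulr0.
have normE (d : nat -> C) : \sum_y w y * nc (\sum_(j < n) d j * u j y) ^+ 2 =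
    \sum_(j < n) nc (d j * ip w (u j) (u j)) ^+ 2.
  suff : ((\sum_y w y * nc (\sum_(j < n) d j * u j y) ^+ 2)%:C)%C =
      ((\sum_(j < n) nc (d j * ip w (u j) (u j)) ^+ 2)%:C)%C :> C by move=> [].
  rewrite -(ip_sqr w (fun y => \sum_(j < n) d j * u j y)) ip_suml rmorph_sum /=.
  apply: eq_bigr => j _; rewrite -mulcJ (ipC _ _ (u j)) dE.
  case: (un j (ltn_ord j)) => [u0|->]; last by rewrite mulr1.
  have -> : ip w (u j) (u j) = 0 by rewrite /ip big1 // => x _; rewrite u0 mul0r mulr0.
  by rewrite mulr0 rmorph0 !mulr0.
have coord v : in_span n e v -> exists c : nat -> C,
    (forall x, v x = \sum_(j < n) c j * u j x) /\
    \sum_y w y * nc (v y) ^+ 2 = \sum_(j < n) nc (c j) ^+ 2.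
  move=> /(in_span_trans ue)[d hd].
  (* The factor [ip w (u j) (u j)] is 0 or 1 and clears the coefficients at null vectors. *)
  exists (fun j => d j * ip w (u j) (u j)); split; last first.
    by rewrite -normE; apply: eq_bigr => y _; rewrite hd.
  move=> x; rewrite hd; apply: eq_bigr => j _.
  by case: (un j (ltn_ord j)) => [->|->]; rewrite ?mulr0 ?mulr1.
have K0 x : 0 <= K x by apply: sumr_ge0 => j _; rewrite exprn_ge0 ?nc_ge0.
exists K; split => //.
- rewrite /K; under eq_bigr do rewrite mulr_sumr.
  rewrite exchange_big /= -[n in n%:R]card_ord -sumr_const.
  apply: ler_sum => j _.
  have : ((\sum_x w x * nc (u j x) ^+ 2)%:C)%C = ip w (u j) (u j) by rewrite ip_sqr.
  case: (un j (ltn_ord j)) => [u0 _|->].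
    by rewrite big1 ?ler01 // => x _; rewrite u0 nc0 expr0n mulr0.
  by move=> [->].
- move=> v x /coord[c [-> ->]].
  by rewrite mulrC; apply: nc_sum_mul_sqr_le.
(* The kernel section at x: its value at x and its squared norm both equal [K x]. *)
- move=> x; exists (fun y => \sum_(j < n) ((u j x)^*)%C * u j y).
  have vspan : in_span n e (fun y => \sum_(j < n) ((u j x)^*)%C * u j y).
    by apply: (in_span_trans eu); exists (fun j => ((u j x)^*)%C).
  have Kx : \sum_(j < n) ((u j x)^*)%C * u j x = ((K x)%:C)%C.
    by rewrite /K rmorph_sum /=; apply: eq_bigr => j _; rewrite -mulcJ mulrC.
  split => //; first by rewrite Kx nc_real ger0_norm.
  rewrite (normE (fun j => ((u j x)^*)%C)); apply: eq_bigr => j _.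
  case: (un j (ltn_ord j)) => [u0|->]; last by rewrite mulr1 ncJ.
  by rewrite u0 rmorph0 mul0r nc0.
- move=> N F W B lam S lam0 hF hW hl.
  pose b k j := \sum_x (if S x then u j x else 0) * ((F k x)^*)%C.
  apply: (@le_trans _ _ (\sum_(k < N) lam * \sum_(j < n) nc (b k j) ^+ 2)).
    apply: ler_sum => k _.
    have [c [cE cn]] := coord _ (hW k (ltn_ord k)).
    have -> : \sum_(x | S x) W k x * ((F k x)^*)%C = \sum_(j < n) c j * b k j.
      rewrite /b; under [RHS]eq_bigr do rewrite mulr_sumr.
      rewrite exchange_big /= big_mkcond; apply: eq_bigr => x _.
      case: (S x); last by rewrite big1 // => j _; rewrite mul0r mulr0.
      by rewrite cE mulr_suml; apply: eq_bigr => j _; rewrite mulrA.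
    apply: le_trans (nc_sum_mul_sqr_le _ _) _.
    rewrite -cn; apply: ler_wpM2r; first by apply: sumr_ge0 => j _; rewrite exprn_ge0 ?nc_ge0.
    exact: hl.
  rewrite -mulr_sumr; apply: ler_wpM2l => //.
  rewrite exchange_big /= [X in B * X](_ : _ = \sum_(j < n) \sum_x nc (if S x then u j x else 0) ^+ 2).
    by rewrite mulr_sumr; apply: ler_sum => j _; apply: hF.
  rewrite /K exchange_big /=; apply: eq_bigr => j _.
  by rewrite big_mkcond /=; apply: eq_bigr => x _; case: (S x); rewrite ?nc0 ?expr0n.
Qed.

End ReproducingKernel.

(** * Approximate Lewis weights *)

Section LewisWeights.
Context {R : realType} (X : finType).
Local Notation C := R[i].
Local Notation nc := (@Normc.normc R).
Implicit Types (w : X -> R) (f g v : X -> C).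

(** The section v of the first kernel at x satisfies K(x)^2 = |v(x)|^2 <= K'(x) t K(x), by the
    evaluation bound for w'. *)
Lemma kernel_mono w w' n (e : nat -> X -> C) K K' (t : R) : 0 <= t ->
  repro_kernel w n e K -> repro_kernel w' n e K' -> (forall x, w' x <= t * w x) ->
  forall x, K x <= t * K' x.
Proof.
move=> t0 hK hK' ww x; have [v [ev vx vn]] := kernel_att hK x.
have K0 := kernel_ge0 hK x; have K'0 := kernel_ge0 hK' x.
have [->|Kx] := eqVneq (K x) 0; first by rewrite mulr_ge0.
have Kp : 0 < K x by rewrite lt_neqAle eq_sym Kx.
rewrite -(ler_pM2r Kp) -expr2 -{1}vx.
apply: le_trans (kernel_sup hK' x ev) _.
rewrite [t * _]mulrC -mulrA; apply: ler_wpM2l => //.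
rewrite -vn mulr_sumr; apply: ler_sum => y _.
by rewrite [leRHS]mulrA ler_wpM2r ?exprn_ge0 ?nc_ge0.
Qed.

(** Evaluation of the constant 1 gives positivity, on which the negative powers of [K] rely; this is
    why constants are later adjoined to the span. *)
Lemma kernel_gt0 w n (e : nat -> X -> C) K : repro_kernel w n e K ->
  in_span n e (fun=> 1) -> forall x, 0 < K x.
Proof.
move=> hK e1 x; have := kernel_sup hK x e1.
rewrite nc1 expr1n lt_neqAle (kernel_ge0 hK) andbT; case: eqP => // <-.
by rewrite mul0r ler10.
Qed.

(** For theta = 1 - p/2 and t = 1 this is the exact Lewis weight, w = K^(-theta). *)
Definition almost_lewis n (e : nat -> X -> C) (theta t : R) w K : Prop :=
  [/\ forall x, 0 < w x, repro_kernel w n e K, forall x, 0 < K x,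
      forall x, w x <= t * K x `^ (- theta) & forall x, K x `^ (- theta) <= t * w x].

(* The map w |-> K_w ^ (- theta) contracts the logarithmic sup distance by the
   factor theta, so that finitely many iterations already give a weight that it
   fixes up to the factor 2. *)
Lemma lewis_weight n (e : nat -> X -> C) (theta : R) : 0 < theta -> theta <= 2^-1 ->
  in_span n e (fun=> 1) -> exists w K, almost_lewis n e theta 2 w K.
Proof.
move=> th0 th2 e1.
pose P t := exists w K, almost_lewis n e theta t w K.
have P_mono s t : s <= t -> P s -> P t.
  move=> st [w [K [w0 hK K0 h1 h2]]]; exists w, K; split => // x.
    by apply: le_trans (h1 x) _; rewrite ler_wpM2r ?powR_ge0.
  by apply: le_trans (h2 x) _; rewrite ler_wpM2r // ltW.
have P_step t : 1 <= t -> P t -> P (t `^ theta).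
  move=> t1 [w [K [w0 hK K0 h1 h2]]].
  have t0 : 0 <= t := le_trans ler01 t1.
  have w'0 x : 0 < K x `^ (- theta) by rewrite powR_gt0.
  have [K' hK'] := repro_kernel_exists n e w'0.
  have K'0 := kernel_gt0 hK' e1.
  have pw (a b : R) : 0 < a -> 0 < b -> a <= t * b -> b `^ (- theta) <= t `^ theta * a `^ (- theta).
    move=> a0 b0 ab; rewrite !powRN ler_pdivlMr ?powR_gt0 // ler_pdivrMl ?powR_gt0 //.
    rewrite mulrC -powRM ?(ltW b0) //; apply: powR_mono; rewrite ?(ltW th0) ?(ltW a0) //.
  exists (fun x => K x `^ (- theta)), K'; split => // x.
    by apply: pw => //; apply: (kernel_mono t0 hK' hK).
  by apply: pw => //; apply: (kernel_mono t0 hK hK').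
(* As theta <= 1/2, one step replaces t by at most its square root, so 2^(2^m) comes down to 2 in m
   steps. *)
have P2 m : P (2 ^+ (2 ^ m)) -> P 2.
  elim: m => [|m IH]; first by rewrite expn0 expr1.
  move=> /P_step h; apply: IH; apply: P_mono (h _); last by rewrite exprn_ege1 // ler1n.
  have t1 : 1 <= 2 ^+ (2 ^ m.+1) :> R by rewrite exprn_ege1 // ler1n.
  apply: le_trans (ler_powR t1 th2) _.
  rewrite expnS mulnC exprM powR12_sqrt ?exprn_ge0 // sqrtr_sqr ger0_norm //.
have [K hK] := repro_kernel_exists n e (fun x : X => ltr01 : 0 < (1 : R)).
have K0 := kernel_gt0 hK e1.
(* A starting distance for w = 1, finite because [X] is; its size only affects the number of
   iterations. *)
pose t := 1 + \sum_x (K x `^ (- theta) + K x `^ theta).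
have F0 x : 0 <= K x `^ (- theta) + K x `^ theta by rewrite addr_ge0 ?powR_ge0.
have tx x : K x `^ (- theta) + K x `^ theta <= t.
  by rewrite /t (bigD1 x) //=; have := sumr_ge0 (index_enum X) (P := predC1 x) (fun x _ => F0 x); lra.
have Pt : P t.
  exists (fun=> 1), K; split => // x; last by rewrite mulr1; have := tx x; have := powR_ge0 (K x) theta; lra.
  rewrite powRN ler_pdivlMr ?powR_gt0 // mul1r.
  by have := tx x; have := powR_ge0 (K x) (- theta); lra.
have t0 : 0 <= t by rewrite addr_ge0 // sumr_ge0.
apply: (P2 (Num.bound t)); apply: P_mono Pt.
apply: le_trans (ltW (archi_boundP t0)) _.
rewrite -natrX ler_nat; apply: ltnW; apply: leq_trans (ltn_expl _ (ltnSn 1)) _.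
by rewrite leq_exp2l // ltnW // ltn_expl.
Qed.

End LewisWeights.

(** * Lower bound *)

Section DiscreteLowerBound.
Context {R : realType}.
Local Notation C := R[i].
Local Notation nc := (@Normc.normc R).

Lemma dft_orth M x y : (x < M)%N -> (y < M)%N ->
  \sum_(k < M) dft M k x * ((dft M k y)^*)%C = (if x == y then M%:R else 0 : C).
Proof.
move=> xM yM; have M0 : (0 < M)%N by apply: leq_ltn_trans xM.
have cj k : ((dft M k y)^*)%C = dft M k (M - y) :> C.
  have h : dft M k y * dft M k (M - y) = 1 :> C.
    by rewrite ![dft M k _]dftC -dftDl subnKC ?(ltnW yM) // dft_nl.
  rewrite -[LHS]mulr1 -h mulrA [_^*%C * _]mulrC mulcJ nc_dft expr1n.
  by rewrite [X in X * _](_ : _ = 1) ?mul1r.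
under eq_bigr do rewrite cj ![dft M _ x]dftC ![dft M _ (M - y)]dftC -dftDl dftC.
rewrite dft_sum //.
have -> : (M %| x + (M - y))%N = (x == y).
  apply/idP/eqP => [/dvdnP[q hq]|->]; last by rewrite subnKC ?dvdnn // ltnW.
  have : (q = 1)%N by nia.
  by move=> q1; move: hq; rewrite q1; lia.
by [].
Qed.

(** Parseval's identity for all M rows; the first N of them give at most as much. *)
Lemma dft_bessel M N : (N <= M)%N -> (0 < M)%N ->
  bessel N (fun k (x : 'I_M) => dft M k x : C) M%:R.
Proof.
move=> NM M0 y.
pose a k := nc (\sum_x y x * ((dft M k x)^*)%C) ^+ 2.
apply: (@le_trans _ _ (\sum_(k < M) a k)).
  rewrite (big_ord_widen _ a NM) big_mkcond; apply: ler_sum => k _.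
  by case: ifP => // _; rewrite exprn_ge0 ?nc_ge0.
rewrite le_eqVlt; apply/orP; left; apply/eqP.
suff : ((\sum_(k < M) a k)%:C)%C = ((M%:R * \sum_x nc (y x) ^+ 2)%:C)%C :> C by move=> [].
rewrite rmorph_sum /=.
under eq_bigr do rewrite -mulcJ.
have e (f : 'I_M -> C) : (\sum_x y x * ((f x)^*)%C) * ((\sum_x y x * ((f x)^*)%C)^*)%C =
    \sum_x \sum_z (y x * ((y z)^*)%C) * (f z * ((f x)^*)%C).
  rewrite mulr_suml; apply: eq_bigr => x _; rewrite rmorph_sum mulr_sumr /=.
  by apply: eq_bigr => z _; rewrite rmorphM /= conjcK mulrACA [X in _ * X]mulrC.
under eq_bigr do rewrite e.
rewrite exchange_big /=; under eq_bigr do rewrite exchange_big /=.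
rewrite real_complexM rmorph_sum mulr_sumr /=; apply: eq_bigr => x _.
under eq_bigr do rewrite -mulr_sumr dft_orth //.
rewrite (bigD1 x) //= eqxx big1 ?addr0 => [|z zx]; last first.
  by rewrite (_ : (val z == x) = false) ?mulr0 //; apply/negbTE.
by rewrite mulcJ mulrC; congr (_ * _); rewrite rmorph_nat.
Qed.

(** The entries of [F] have modulus 1, so [F] correlates with itself on [S] exactly to |S|. *)
Lemma corr_ge M (S : pred 'I_M) (W F : 'I_M -> C) : (forall x, nc (F x) = 1) ->
  #|S|%:R - \sum_x nc (W x - F x) <= nc (\sum_(x | S x) W x * ((F x)^*)%C).
Proof.
move=> F1; rewrite lerBlDr.
have -> : #|S|%:R = nc (\sum_(x | S x) W x * ((F x)^*)%C - \sum_(x | S x) (W x - F x) * ((F x)^*)%C).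
  rewrite -sumrB (eq_bigr (fun=> 1)) => [|x _].
    rewrite sumr_const [X in nc X](_ : _ = ((#|S|%:R)%:C)%C); last by rewrite rmorph_nat.
    by rewrite nc_real ger0_norm.
  rewrite -mulrBl opprB addrC subrK mulcJ F1 expr1n.
  by [].
apply: le_trans (ncB _ _) _; rewrite lerD2l.
apply: le_trans (nc_sum _ _ _) _; rewrite big_mkcond; apply: ler_sum => x _.
by case: (S x); rewrite ?nc_ge0 // ncM ncJ F1 mulr1.
Qed.

(** Each W_k has correlation at least M - M/4 >= M/2 with F_k and squared norm at most 4 M, while
    the kernel for w = 1 has trace at most n: N M^2 / 4 <= 4 M^2 n. *)
Lemma discrete_L2 M N n (e W : nat -> 'I_M -> C) : (N <= M)%N -> (0 < M)%N ->
  (forall k, (k < N)%N -> in_span n e (W k)) ->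
  (forall k, (k < N)%N -> \sum_x nc (W k x - dft M k x) ^+ 2 <= M%:R / 16) ->
  (N <= 16 * n)%N.
Proof.
move=> NM M0 hW hD.
have MR : 0 < M%:R :> R by rewrite ltr0n.
have [K hK] := repro_kernel_exists n e (fun x : 'I_M => ltr01 : 0 < (1 : R)).
have D1 k : (k < N)%N -> \sum_x nc (W k x - dft M k x) <= M%:R / 4.
  move=> kN; have := sum_mul_sqr_le (fun=> 1) (fun x => nc (W k x - dft M k x)).
  under eq_bigr do rewrite mul1r.
  rewrite expr1n sumr_const card_ord => h.
  rewrite -(ler_pXn2r (n := 2)) ?nnegrE ?divr_ge0 ?sumr_ge0 //.
  apply: le_trans h _; apply: le_trans (ler_wpM2l _ (hD k kN)) _ => //.
  by rewrite expr_div_n mulrA -expr2 ler_wpM2l ?sqr_ge0 //; lra.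
have lamW k : (k < N)%N -> \sum_y 1 * nc (W k y) ^+ 2 <= 4 * M%:R.
  move=> kN.
  apply: (@le_trans _ _ (\sum_y (2 * nc (W k y - dft M k y) ^+ 2 + 2))).
    apply: ler_sum => y _; rewrite mul1r.
    have h : nc (W k y) <= nc (W k y - dft M k y) + 1.
      rewrite -[X in _ + X](nc_dft M k y); apply: le_trans (ncD _ _).
      by rewrite subrK.
    have b0 := nc_ge0 (W k y - dft M k y).
    apply: (@le_trans _ _ ((nc (W k y - dft M k y) + 1) ^+ 2)).
      by rewrite ler_pXn2r ?nnegrE ?nc_ge0 ?addr_ge0.
    by have := sqr_ge0 (nc (W k y - dft M k y) - 1); rewrite !expr2; lra.
  rewrite big_split /= -mulr_sumr sumr_const card_ord -[_ *+ M]mulr_natr.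
  by have := hD k kN; lra.
have := kernel_corr hK (xpredT) (mulr_ge0 (ler0n R 4) (ltW MR)) (dft_bessel NM M0) hW lamW.
have := kernel_sum_le hK; under eq_bigr do rewrite mul1r.
move=> Kn hc.
have low : N%:R * (M%:R / 2) ^+ 2 <= 4 * M%:R * (M%:R * n%:R) :> R.
  apply: (@le_trans _ _ (4 * M%:R * (M%:R * \sum_x K x))); last by rewrite !ler_wpM2l // mulr_ge0.
  apply: (le_trans _ hc).
  rewrite mulr_natl -[in leLHS](card_ord N) -sumr_const; apply: ler_sum => k _.
  rewrite ler_pXn2r ?nnegrE ?nc_ge0 ?divr_ge0 //.
  apply: le_trans (corr_ge xpredT _ (nc_dft M k)).
  by rewrite cardT size_enum_ord; have := D1 k (ltn_ord k); lra.
rewrite -(ler_nat R) natrM.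
have M2 : 0 < M%:R ^+ 2 / 4 :> R by rewrite divr_gt0 ?exprn_gt0.
rewrite -(ler_pM2r M2); have := low; rewrite expr_div_n; lra.
Qed.

End DiscreteLowerBound.

(** * The Lewis weight argument on the grid *)

Section DiscreteLp.
Context {R : realType}.
Local Notation C := R[i].
Local Notation nc := (@Normc.normc R).
Variable p : R.
Hypothesis p1 : 1 <= p.
Hypothesis p2 : p < 2.

(** The power mean inequality, by Bernoulli's inequality at [a x / eta]. *)
Lemma sum_le_of_sum_powR M (a : 'I_M -> R) (eta : R) : 0 < eta -> (forall x, 0 <= a x) ->
  \sum_x a x `^ p <= M%:R * eta `^ p -> \sum_x a x <= M%:R * eta.
Proof.
move=> e0 a0 h; have p0 : 0 < p := lt_le_trans ltr01 p1.
have h1 : \sum_x (1 + p * (a x / eta - 1)) <= M%:R.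
  apply: (@le_trans _ _ (\sum_x (a x / eta) `^ p)).
    by apply: ler_sum => x _; apply: powR_bernoulli => //; rewrite divr_ge0 // ltW.
  under eq_bigr do rewrite powRM ?invr_ge0 ?(ltW e0) // .
  rewrite -mulr_suml -powR_inv1 ?(ltW e0) // -powRrM mulN1r powRN.
  by rewrite ler_pdivrMr ?powR_gt0.
move: h1; rewrite big_split /= sumr_const card_ord -mulr_sumr sumrB sumr_const card_ord -mulr_suml.
set s := \sum_x a x => h1.
have : s / eta <= M%:R by nra.
by rewrite ler_pdivrMr.
Qed.

(** Two bounds make M cancel: the squared weighted norm of W_k is at most (16 M)^(2/p), and [K] is
    at most (8 n / M)^(2/p) on three quarters of the grid. Correlations are taken on that part [S]
    only and remain at least 3M/4 - M/4 = M/2. *)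
Lemma discrete_Lp M N n (e W : nat -> 'I_M -> C) (eta : R) : (N <= M)%N -> (0 < M)%N -> (0 < n)%N ->
  in_span n e (fun=> 1) -> 0 < eta -> eta <= 4^-1 ->
  (forall k, (k < N)%N -> in_span n e (W k)) ->
  (forall k, (k < N)%N -> \sum_x nc (W k x - dft M k x) `^ p <= M%:R * eta `^ p) ->
  N%:R <= 4 * (128 * n%:R) `^ (2 / p).
Proof.
move=> NM M0 n0 e1 eta0 eta4 hW hD; have hp1 := p1; have hp2 := p2.
have p0 : 0 < p by lra.
have MR : 0 < M%:R :> R by rewrite ltr0n.
have nR : 0 < n%:R :> R by rewrite ltr0n.
pose theta := 1 - p / 2.
have [w [K [w0 hK K0 wK Kw]]] : exists w K, almost_lewis n e theta 2 w K.
  by apply: lewis_weight => //; rewrite /theta; lra.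
have lamW k : (k < N)%N -> \sum_y w y * nc (W k y) ^+ 2 <= (16 * M%:R) `^ (2 / p).
  move=> kN; set q := \sum_y _.
  have q0 : 0 <= q by apply: sumr_ge0 => y _; rewrite mulr_ge0 ?exprn_ge0 ?nc_ge0 // ltW.
  have [->|q1] := eqVneq q 0; first exact: powR_ge0.
  have qp : 0 < q by rewrite lt_neqAle eq_sym q1.
  have sumW : \sum_y nc (W k y) `^ p <= 8 * M%:R.
    apply: (@le_trans _ _ (\sum_y 4 * (nc (W k y - dft M k y) `^ p + 1))).
      apply: ler_sum => y _.
      have d1 : nc (dft M k y) `^ p = 1 by rewrite nc_dft powR1.
      rewrite -[X in _ + X]d1.
      apply: le_trans (powR_add_le p0 (ltW hp2) (nc_ge0 _) (nc_ge0 _)).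
      apply: powR_mono; rewrite ?(ltW p0) ?nc_ge0 //.
      by apply: le_trans (ncD _ _); rewrite subrK.
    rewrite -mulr_sumr big_split /= sumr_const card_ord -[_ *+ M]mulr_natr mul1r.
    have e1' : eta `^ p <= 1.
      have h : eta `^ p <= 1 `^ p by apply: powR_mono; rewrite ?(ltW p0) ?(ltW eta0) //; lra.
      by rewrite powR1 in h.
    by have := hD k kN; nra.
  (* w |W|^2 = w |W|^p (|W|^2)^theta, where |W|^2 <= K q and w K^theta <= 2. Cancelling q^theta
     afterwards leaves a bound on q^(p/2). *)
  have hq : q <= 2 * q `^ theta * \sum_y nc (W k y) `^ p.
    rewrite mulr_sumr; apply: ler_sum => y _.
    have [W0|W1] := eqVneq (nc (W k y)) 0.
      by rewrite W0 expr0n mulr0 powR0 ?gt_eqF // mulr0.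
    have Wp : 0 < nc (W k y) by rewrite lt_neqAle eq_sym W1 nc_ge0.
    have hs := kernel_sup hK y (hW k kN).
    have e2 : nc (W k y) ^+ 2 = nc (W k y) `^ p * (nc (W k y) ^+ 2) `^ theta.
      rewrite -powR_mulrn ?nc_ge0 // -powRrM -powRD ?W1 ?implybT //.
      by congr (_ `^ _); rewrite /theta; field.
    have e3 : (nc (W k y) ^+ 2) `^ theta <= K y `^ theta * q `^ theta.
      rewrite -powRM ?(ltW (K0 y)) //; apply: powR_mono => //; last by rewrite exprn_ge0 // ltW.
      by rewrite /theta; lra.
    have e4 : w y * K y `^ theta <= 2.
      apply: le_trans (ler_wpM2r (powR_ge0 (K y) theta) (wK y)) _.
      by rewrite powRN -mulrA mulVf ?mulr1 // gt_eqF // powR_gt0.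
    rewrite e2; apply: (@le_trans _ _ (w y * (nc (W k y) `^ p * (K y `^ theta * q `^ theta)))).
      by rewrite ler_wpM2l ?(ltW (w0 y)) // ler_wpM2l ?powR_ge0.
    rewrite [leLHS](_ : _ = (w y * K y `^ theta) * (q `^ theta * nc (W k y) `^ p)); last by ring.
    by rewrite -[leRHS]mulrA ler_wpM2r // mulr_ge0 ?powR_ge0.
  have e5 : q `^ (p / 2) <= 16 * M%:R.
    have qt : 0 < q `^ theta by rewrite powR_gt0.
    rewrite -(ler_pM2l qt) -powRD ?q1 ?implybT //.
    rewrite (_ : theta + p / 2 = 1); last by rewrite /theta; lra.
    rewrite powRr1 //; nra.
  have -> : q = (q `^ (p / 2)) `^ (2 / p).
    rewrite -powRrM (_ : p / 2 * (2 / p) = 1) ?powRr1 //.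
    by field; rewrite gt_eqF.
  by apply: powR_mono; rewrite ?powR_ge0 // divr_ge0 // ltW.
(* Markov's inequality at this level: K^(p/2) sums to at most 2 n, so it exceeds 8 n / M at no more
   than M/4 points. *)
pose tau : R := (8 * n%:R / M%:R) `^ (2 / p).
pose S : pred 'I_M := fun x => K x <= tau.
have sumK : \sum_x K x `^ (p / 2) <= 2 * n%:R.
  apply: (@le_trans _ _ (2 * \sum_x w x * K x)); last by rewrite ler_pM2l // (kernel_sum_le hK).
  rewrite mulr_sumr; apply: ler_sum => x _.
  have -> : K x `^ (p / 2) = K x `^ (- theta) * K x.
    rewrite -[X in _ = _ * X]powRr1 ?(ltW (K0 x)) // -powRD ?(gt_eqF (K0 x)) ?implybT //.
    by congr (_ `^ _); rewrite /theta; lra.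
  by rewrite [leRHS]mulrA ler_wpM2r ?(ltW (K0 x)).
have cS : #|S|%:R >= M%:R * (3 / 4) :> R.
  have h : \sum_(x | ~~ S x) (8 * n%:R / M%:R) <= 2 * n%:R :> R.
    apply: (le_trans _ sumK); rewrite big_mkcond; apply: ler_sum => x _.
    case: ifPn => [Sx|_]; last exact: powR_ge0.
    have -> : 8 * n%:R / M%:R = tau `^ (p / 2).
      rewrite /tau -powRrM (_ : 2 / p * (p / 2) = 1) ?powRr1 ?divr_ge0 ?mulr_ge0 //.
      by field; rewrite gt_eqF.
    apply: powR_mono; rewrite ?powR_ge0 ?divr_ge0 ?(ltW p0) //.
    by move: Sx; rewrite /S -ltNge => /ltW.
  move: h; rewrite sumr_const -[_ *+ _]mulr_natr.
  have hC : #|[pred x | ~~ S x]|%:R + #|S|%:R = M%:R :> R.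
    have hC := cardC S; rewrite card_ord in hC.
    have eC : #|[pred x | ~~ S x]| = #|[predC S]| by apply: eq_card.
    by rewrite eC -natrD addnC hC.
  rewrite mulrAC ler_pdivrMr //; move: hC.
  set d : R := #|[pred x | ~~ S x]|%:R; set s : R := #|S|%:R => hC h.
  have h4 : 8 * d <= 2 * M%:R.
    by rewrite -(ler_pM2r nR); apply: le_trans (le_trans _ h) _; rewrite le_eqVlt; apply/orP; left; apply/eqP; ring.
  lra.
have := kernel_corr hK S (powR_ge0 _ _) (dft_bessel NM M0) hW lamW.
move=> hc.
have SK : \sum_(x | S x) K x <= M%:R * tau.
  apply: (@le_trans _ _ (\sum_(x < M) tau)); last by rewrite sumr_const card_ord mulr_natl.
  by rewrite big_mkcond; apply: ler_sum => x _; case: ifP => // _; apply: powR_ge0.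
have low : N%:R * (M%:R / 2) ^+ 2 <= (16 * M%:R) `^ (2 / p) * (M%:R * (M%:R * tau)) :> R.
  apply: (@le_trans _ _ ((16 * M%:R) `^ (2 / p) * (M%:R * \sum_(x | S x) K x))); last first.
    by rewrite ler_wpM2l ?powR_ge0 // ler_wpM2l.
  apply: (le_trans _ hc).
  rewrite mulr_natl -[in leLHS](card_ord N) -sumr_const; apply: ler_sum => k _.
  rewrite ler_pXn2r ?nnegrE ?nc_ge0 ?divr_ge0 //.
  apply: le_trans (corr_ge S _ (nc_dft M k)).
  have := sum_le_of_sum_powR eta0 (fun x => nc_ge0 (W k x - dft M k x)) (hD k (ltn_ord k)).
  by nra.
have e6 : (16 * M%:R) `^ (2 / p) * tau = (128 * n%:R) `^ (2 / p).
  rewrite /tau -powRM ?mulr_ge0 ?divr_ge0 ?mulr_ge0 //; congr (_ `^ _).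
  by field; rewrite gt_eqF.
have M2 : 0 < M%:R ^+ 2 / 4 :> R by rewrite divr_gt0 ?exprn_gt0.
rewrite -(ler_pM2r M2) -e6; have := low; rewrite expr_div_n expr2; nra.
Qed.

End DiscreteLp.

(** * Passage from the circle to a grid *)

Section Discretization.
Context {R : realType}.
Local Notation C := R[i].
Local Notation nc := (@Normc.normc R).
Local Notation mT := (torus_measure R).
Local Notation T := (measurableTypeR R).
Variable p : R.
Hypothesis p1 : 1 <= p.
Hypothesis p2 : p < 2.

Definition cell_avg M j (f : R -> C) : C := (M%:R%:C)%C * cint (cell M j) f.

(** Cell averages are linear, so those of the n generators span a space containing those of each
    v_k, and they do not increase p-th means. The constant is adjoined as one more generator for the
    sake of the Lewis weight. *)
Lemma discretize n (V : set (R -> C)) N M (eps : R) (v : nat -> R -> C) :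
  Lp_subspace p V -> dim_le V n -> (0 < M)%N -> 0 <= eps ->
  (forall k, (k < N)%N -> V (v k)) ->
  (forall k, (k < N)%N -> (Lp_norm p (fun x => ek k%:Z x - v k x)%R <= eps%:E)%E) ->
  exists E W : nat -> 'I_M -> C,
  [/\ in_span n.+1 E (fun=> 1), forall k, (k < N)%N -> in_span n.+1 E (W k) &
      forall k, (k < N)%N ->
        \sum_j nc (W k j - cell_avg M j (ek k%:Z)) `^ p <= M%:R * eps `^ p].
Proof.
move=> [VL _ _ _] [e eV he] M0 eps0 vV hv; have p0 : 0 < p := lt_le_trans ltr01 p1.
have Le i : Lp p (e i) by apply: VL.
have /choice[a ha] : forall k, exists a : 'I_n -> C, (k < N)%N ->
    v k = (fun x => \sum_(i < n) a i * e i x) %[ae mT].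
  move=> k; have [kN|kN] := ltnP k N; last by exists (fun=> 0).
  by have [a ha] := he _ (vV k kN); exists a.
(* At index n, [insub] fails and the default value 1 supplies the constant. *)
pose E (i : nat) (j : 'I_M) : C :=
  if insub i is Some i' then cell_avg M j (e i') else 1.
pose W k (j : 'I_M) : C := \sum_(i < n) a k i * cell_avg M j (e i).
exists E, W; split.
- exists (fun i => (i == n)%:R) => j.
  rewrite big_ord_recr /= eqxx mul1r big1 ?add0r => [|i _].
    by rewrite /E insubF // ltnn.
  by rewrite ltn_eqF ?mul0r.
- move=> k kN; exists (fun i => if insub i is Some i' then a k i' else 0) => j.
  rewrite big_ord_recr /= insubF ?ltnn // mul0r addr0; apply: eq_bigr => i _.
  by rewrite /E valK.
- move=> k kN; pose g x : C := ek k%:Z x - \sum_(i < n) a k i * e i x.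
  have Ls : Lp p (fun x => \sum_(i < n) a k i * e i x) by apply: Lp_sum.
  have Lg : Lp p g.
    have := Lp_lin (-1) p1 Ls (ek_Lp k%:Z p0).
    by congr (Lp p); apply/funext => x; rewrite /g mulN1r addrC.
  have mv : cmeasurable (fun x => ek k%:Z x - v k x).
    by apply: cmeasB; [exact: cmeas_ek | exact: Lp_cmeas (VL _ (vV k kN))].
  have ig : (\int[mT]_x (nc (g x) `^ p)%:E <= (eps `^ p)%:E)%E.
    have := hv k kN; rewrite Lp_norm_leP //; apply: le_trans.
    rewrite le_eqVlt; apply/orP; left; apply/eqP; apply: ae_eq_integral => //.
    + by apply: cmeas_powR; exact: Lp_cmeas Lg.
    + exact: cmeas_powR.
    + move: (ha k kN); apply: filterS; first exact: (ae_filter_ringOfSetsType mT).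
      by move=> x h _; rewrite /g -h.
  apply: le_trans (cell_average_contract p1 M0 Lg ig).
  apply: ler_sum => j _; rewrite le_eqVlt; apply/orP; left; apply/eqP.
  congr (_ `^ _); rewrite -ncN; congr nc; rewrite opprB.
  have mc : measurable (cell M j : set T) by exact: measurable_cell.
  have ie i : cintegrable (cell M j) (e i).
    by apply: cintegrable_sub => //; apply: Lp_cintegrable p1 (Le i).
  have -> : cint (cell M j) g = cint (cell M j) (ek k%:Z) - \sum_(i < n) a k i * cint (cell M j) (e i).
    rewrite (cint_ext (g := fun x => (-1) * (\sum_(i < n) a k i * e i x) + ek k%:Z x)); last first.
      by move=> x _; rewrite /g mulN1r addrC.
    have i1 : cintegrable (cell M j) (fun x => \sum_(i < n) a k i * e i x).
      exact: cintegrable_sum.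
    rewrite cintD //; first last.
    + exact: cintegrable_ek.
    + exact: cintegrableZ.
    by rewrite cintZ // mulN1r addrC (cint_sum _ (a k) (F := e)).
  rewrite mulrBr /W /cell_avg mulr_sumr; congr (_ - _).
  by apply: eq_bigr => i _; rewrite mulrCA.
Qed.

Lemma cell_avg_ek : exists2 K : R, 0 < K & forall (k M j : nat), (j < M)%N ->
  nc (cell_avg M j (ek k%:Z) - dft M k j) <= K * k%:R / M%:R.
Proof.
have [K K0 hK] := @cint_ek_cell R; exists K => // k M j jM.
have MR : 0 < M%:R :> R by rewrite ltr0n; apply: leq_ltn_trans jM.
have -> : dft M k j = (M%:R%:C)%C * (ek k%:Z (j%:R / M%:R) * (M%:R^-1)%:C%C) :> C.
  rewrite mulrCA -real_complexM mulfV ?gt_eqF // mulr1.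
  by rewrite /dft /ek -pmulrn mulrA.
rewrite /cell_avg -mulrBr ncM nc_real gtr0_norm //.
apply: le_trans (ler_wpM2l (ltW MR) (hK k%:Z M j jM)) _.
rewrite mulrCA mulfV ?gt_eqF // mulr1 -pmulrn ger0_norm //.
Qed.

End Discretization.

(** * Obstruction to simultaneous approximation of the exponentials *)

Section LowerBound.
Context {R : realType}.
Local Notation C := R[i].
Local Notation nc := (@Normc.normc R).
Local Notation mT := (torus_measure R).
Local Notation T := (measurableTypeR R).
Variable p : R.
Hypothesis p1 : 1 <= p.
Hypothesis p2 : p < 2.

(** With s the sum of the p-th powers, a^2 = a^p (a^p)^(2/p - 1) <= a^p s^(2/p - 1). *)
Lemma sum_sqr_le_powR (I : finType) (a : I -> R) : (forall x, 0 <= a x) ->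
  \sum_x a x ^+ 2 <= (\sum_x a x `^ p) `^ (2 / p).
Proof.
move=> a0; have hp1 := p1; have hp2 := p2; have p0 : 0 < p by lra.
set s := \sum_x _ `^ _.
have s0 : 0 <= s by apply: sumr_ge0 => x _; apply: powR_ge0.
have as_ x : a x `^ p <= s.
  rewrite /s (bigD1 x) //= lerDl; apply: sumr_ge0 => y _; exact: powR_ge0.
have [sz|s1] := eqVneq s 0.
  rewrite sz big1 ?powR_ge0 // => x _.
  have := as_ x; rewrite sz => h; have /eqP : a x `^ p = 0 by apply: le_anti; rewrite h powR_ge0.
  by rewrite powR_eq0 => /andP[/eqP -> _]; rewrite expr0n.
have e : s `^ (2 / p) = s * s `^ (2 / p - 1).
  rewrite -{2}[s]powRr1 // -powRD ?s1 ?implybT //.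
  by congr (_ `^ _); ring.
rewrite e {1}/s mulr_suml; apply: ler_sum => x _.
have [->|ax] := eqVneq (a x) 0; first by rewrite expr0n mulr_ge0 ?powR_ge0.
have -> : a x ^+ 2 = a x `^ p * (a x `^ p) `^ (2 / p - 1).
  rewrite -powR_mulrn // -powRrM -powRD ?ax ?implybT //.
  by congr (_ `^ _); field; rewrite gt_eqF.
rewrite ler_wpM2l ?powR_ge0 //; apply: powR_mono; rewrite ?powR_ge0 //.
by rewrite subr_ge0 ler_pdivlMr //; lra.
Qed.

(** The grid has M = C0 N points with C0 > 32 K, so that the averages of e_k, k < N, differ from the
    Fourier matrix by at most 1/32. The two conclusions come from w = 1 and from the Lewis
    weight. *)
Lemma exponentials_not_approximable : exists2 C0 : nat, (0 < C0)%N &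
  forall n (V : set (R -> C)) N (eps : R) (v : nat -> R -> C),
  Lp_subspace p V -> dim_le V n -> (0 < N)%N -> 0 <= eps ->
  (forall k, (k < N)%N -> V (v k)) ->
  (forall k, (k < N)%N -> (Lp_norm p (fun x => ek k%:Z x - v k x)%R <= eps%:E)%E) ->
  ((C0 * N)%:R `^ (2 / p) * eps ^+ 2 <= (C0 * N)%:R / 64 -> (N <= 16 * n.+1)%N) /\
  (eps <= 32^-1 -> N%:R <= 4 * (128 * n.+1%:R) `^ (2 / p)).
Proof.
have hp1 := p1; have hp2 := p2; have p0 : 0 < p by lra.
have [K K0 hK] := @cell_avg_ek R.
pose C0 := (Num.bound (32 * K)).+1.
have C0K : K <= C0%:R / 32.
  have := archi_boundP (mulr_ge0 (ler0n R 32) (ltW K0)).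
  have : C0%:R = (Num.bound (32 * K))%:R + 1 :> R by rewrite natr1.
  lra.
exists C0 => // n V N eps v hV dV N0 eps0 vV hv.
pose M := (C0 * N)%N.
have M0 : (0 < M)%N by rewrite muln_gt0.
have NM : (N <= M)%N by rewrite leq_pmull.
have MR : 0 < M%:R :> R by rewrite ltr0n.
have [E [W [E1 hW hD]]] := discretize p1 hV dV M0 eps0 vV hv.
have hF k (j : 'I_M) : (k < N)%N -> nc (cell_avg M j (ek k%:Z) - dft M k j) <= 32^-1.
  move=> kN; apply: le_trans (hK k M j (ltn_ord j)) _.
  rewrite ler_pdivrMr //; apply: (@le_trans _ _ (C0%:R / 32 * N%:R)).
    by rewrite ler_pM ?(ltW K0) // ler_nat ltnW.
  by rewrite /M natrM; lra.
have split k j : W k j - dft M k j =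
    (W k j - cell_avg M j (ek k%:Z)) + (cell_avg M j (ek k%:Z) - dft M k j).
  by rewrite addrA subrK.
split=> [heps|eps32].
- apply: (discrete_L2 NM M0 hW) => k kN.
  have h1 : \sum_j nc (W k j - cell_avg M j (ek k%:Z)) ^+ 2 <= M%:R / 64.
    apply: le_trans (sum_sqr_le_powR (fun j => nc_ge0 _)) _.
    apply: le_trans heps.
    have -> : eps ^+ 2 = (eps `^ p) `^ (2 / p).
      by rewrite -powRrM -powR_mulrn //; congr (_ `^ _); field; rewrite gt_eqF.
    rewrite -powRM ?powR_ge0 //; apply: powR_mono; rewrite ?divr_ge0 ?(ltW p0) //.
    by apply: sumr_ge0 => j _; apply: powR_ge0.
    exact: hD.
  apply: (@le_trans _ _ (\sum_j (2 * nc (W k j - cell_avg M j (ek k%:Z)) ^+ 2 + 64^-1))).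
    apply: ler_sum => j _; rewrite split.
    set a := W k j - _; set b := _ - dft M k j.
    have hb : nc b <= 32^-1 by apply: hF.
    have hab := ncD a b; have a0 := nc_ge0 a; have b0 := nc_ge0 b.
    apply: (@le_trans _ _ ((nc a + nc b) ^+ 2)).
      by rewrite ler_pXn2r ?nnegrE ?nc_ge0 ?addr_ge0.
    have := sqr_ge0 (nc a - nc b).
    have : nc b ^+ 2 <= 128^-1 by rewrite expr2; nra.
    by rewrite !expr2; lra.
  rewrite big_split /= -mulr_sumr sumr_const card_ord -[_ *+ M]mulr_natr; lra.
- apply: (discrete_Lp p1 p2 (eta := 4^-1) NM M0 _ E1 _ _ hW) => // k kN.
  (* 1/32 is 1/4 times 1/8 and p >= 1, so each error contributes at most 4^-p / 8; then 4 (1/8 +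
     1/8) = 1 gives eta = 1/4. *)
  have e8 (t : R) : 0 <= t -> t <= 32^-1 -> t `^ p <= 4^-1 `^ p / 8.
    move=> t0 t32; apply: (@le_trans _ _ ((4^-1 * 8^-1) `^ p)).
      by apply: powR_mono; rewrite ?(ltW p0) //; lra.
    rewrite powRM ?invr_ge0 // ler_wpM2l ?powR_ge0 //.
    rewrite -[leRHS]powRr1 ?invr_ge0 //; apply: ger_powR => //.
    by rewrite invr_gt0 ltr0n invf_le1 ?ltr0n // ler1n.
  apply: (@le_trans _ _ (\sum_j 4 * (nc (W k j - cell_avg M j (ek k%:Z)) `^ p + 4^-1 `^ p / 8))).
    apply: ler_sum => j _; rewrite split.
    apply: (@le_trans _ _ (4 * (nc (W k j - cell_avg M j (ek k%:Z)) `^ p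
       + nc (cell_avg M j (ek k%:Z) - dft M k j) `^ p))).
      apply: le_trans (powR_add_le p0 (ltW hp2) (nc_ge0 _) (nc_ge0 _)).
      by apply: powR_mono; rewrite ?(ltW p0) ?nc_ge0 // ncD.
    by rewrite ler_pM2l // lerD2l e8 ?nc_ge0 // hF.
  rewrite -mulr_sumr big_split /= sumr_const card_ord -[_ *+ M]mulr_natr.
  have := hD k kN; have := e8 eps eps0 eps32; nra.
Qed.

End LowerBound.

(** * From exponentials to the width of the Wiener ball *)

Section WidthLower.
Context {R : realType}.
Local Notation C := R[i].
Local Notation nc := (@Normc.normc R).
Local Notation mT := (torus_measure R).
Local Notation T := (measurableTypeR R).
Variable p : R.
Hypothesis p1 : 1 <= p.
Hypothesis p2 : p < 2.

Lemma sum_eq_le1 (I : eqType) (s : seq I) (i : I) : uniq s ->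
  \sum_(j <- s) (j == i)%:R <= 1 :> R.
Proof.
move=> us; have [i_s|i_s] := boolP (i \in s).
  by rewrite (bigD1_seq i) //= eqxx big1 ?addr0 // => j /negbTE ->.
rewrite big_seq big1 ?ler01 // => j js.
by case: eqP js i_s => [->->|].
Qed.

Lemma wiener_ball_ek (beta : R) (k : nat) :
  wiener_ball beta (fun x => (((1 + k%:R) `^ (- beta))%:C)%C * ek k%:Z x : C).
Proof.
set c : C := ((_)%:C)%C; split.
  have := Lp_lin c (lexx 1) (ek_Lp k%:Z ltr01) (Lp_zero (lexx 1)).
  by congr (Lp _); apply/funext => x; rewrite addr0.
have F l : fourier (fun x => c * ek k%:Z x) l = c * (k%:Z == l)%:R.
  rewrite -(fourier_ek (R := R)) !fourierE -cintZ //.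
    by apply: cint_ext => x _; rewrite mulrA.
  apply: (@cintegrable_mul_bounded _ _ _ _ 1) => //; [exact: cmeas_ek|exact: cintegrable_ek|exact: cmeas_ek|].
  by move=> x; rewrite nc_ek.
apply: ge_ereal_sup => _ [A [fA _] <-].
rewrite fsbig_finite // sumEFin lee_fin.
apply: (@le_trans _ _ (\sum_(l <- finmap.enum_fset (fset_set A)) (l == k%:Z)%:R)).
  have ncc : nc c = (1 + k%:R) `^ (- beta) by rewrite nc_real ger0_norm ?powR_ge0.
  apply: ler_sum => l _; rewrite F ncM ncc [l == _]eq_sym.
  case: (k%:Z =P l) => [<-|_]; last by rewrite nc0 !mulr0.
  by rewrite nc1 mulr1 -intr_norm /= powRN mulfV // gt_eqF // powR_gt0 // ltr_pwDl.
exact: sum_eq_le1 (finmap.fset_uniq _).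
Qed.

(** Dividing an approximant of the normalized exponential by its coefficient (1 + k)^-beta
    multiplies the error by at most N^beta when k < N. *)
Lemma width_ge (beta eps0 : R) n N : 0 < beta -> 0 < eps0 ->
  (forall (V : set (R -> C)) (v : nat -> R -> C), Lp_subspace p V -> dim_le V n ->
     (forall k, (k < N)%N -> V (v k)) ->
     (forall k, (k < N)%N ->
        (Lp_norm p (fun x => ek k%:Z x - v k x)%R <= (eps0 * N%:R `^ beta)%:E)%E) -> False) ->
  (eps0%:E <= kolmogorov_width p (wiener_ball beta) n)%E.
Proof.
move=> b0 e0 hV; have p0 : 0 < p := lt_le_trans ltr01 p1.
apply: le_ereal_inf_tmp => _ [V [sV dV] <-].
rewrite leNgt; apply/negP => hlt.
have [VL V0 Vlin _] := sV.
pose c k : R := (1 + k%:R) `^ (- beta).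
have c0 k : 0 < c k by rewrite powR_gt0 // ltr_pwDl.
have /choice[g hg] : forall k : nat, exists g : R -> C, V g /\
    (Lp_norm p (fun x => ((c k)%:C)%C * ek k%:Z x - g x)%R <= eps0%:E)%E.
  move=> k.
  have : (Lp_dist p (fun x => ((c k)%:C)%C * ek k%:Z x)%R V < eps0%:E)%E.
    apply: le_lt_trans hlt; apply: ereal_sup_ubound.
    by exists (fun x => ((c k)%:C)%C * ek k%:Z x) => //; exact: wiener_ball_ek.
  by move=> /ereal_inf_lt[_ [g Vg <-] h]; exists g; split => //; exact: ltW.
apply: (hV V (fun k x => (((c k)^-1)%:C)%C * g k x) sV dV) => k kN.
  have := Vlin (((c k)^-1)%:C)%C _ _ (hg k).1 V0.
  by congr V; apply/funext => x; rewrite addr0.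
have mg : cmeasurable (fun x => ((c k)%:C)%C * ek k%:Z x - g k x).
  apply: cmeasB; last exact: Lp_cmeas (VL _ (hg k).1).
  by apply: cmeasM; [exact: cmeas_cst|exact: cmeas_ek].
have -> : (fun x => ek k%:Z x - (((c k)^-1)%:C)%C * g k x) =
    (fun x => (((c k)^-1)%:C)%C * (((c k)%:C)%C * ek k%:Z x - g k x)).
  apply/funext => x; rewrite mulrBr mulrA -real_complexM mulVf ?gt_eqF //.
  by rewrite [X in _ = X * _ - _](_ : _ = 1) ?mul1r.
rewrite Lp_normZ // nc_real gtr0_norm ?invr_gt0 // mulrC EFinM.
have h1 : (c k)^-1 <= N%:R `^ beta.
  rewrite /c powRN invrK; apply: powR_mono; rewrite ?(ltW b0) ?addr_ge0 //.
  by rewrite addrC natr1 ler_nat.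
apply: (@le_trans _ _ (((c k)^-1)%:E * eps0%:E)%E).
  by apply: lee_wpmul2l; [rewrite lee_fin invr_ge0 ltW|exact: (hg k).2].
by rewrite -!EFinM lee_fin ler_wpM2r // ltW.
Qed.

Lemma lesssim_ge (x : nat -> R) (Y : nat -> \bar R) (c : R) : 0 < c ->
  (forall n, (0 < n)%N -> ((c * x n)%:E <= Y n)%E) -> lesssim (fun n => (x n)%:E) Y.
Proof.
move=> c0 h; exists c^-1; first by rewrite invr_gt0.
move=> n n0; apply: le_trans (lee_wpmul2l _ (h n n0)); last by rewrite lee_fin invr_ge0 ltW.
by rewrite -EFinM mulrA mulVf ?mul1r ?gt_eqF.
Qed.

Lemma width_lower (beta : R) : 0 < beta ->
  lesssim (fun n => (n%:R `^ (- beta - (p^-1 - 2^-1) * Num.min 1 (2 * beta)))%:E)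
          (kolmogorov_width p (wiener_ball beta)).
Proof.
move=> b0; have hp1 := p1; have hp2 := p2; have p0 : 0 < p by lra.
have [C0 C00 hC] := exponentials_not_approximable p1 p2.
pose al : R := p^-1 - 2^-1.
have al2 : 2 / p = 1 + 2 * al by rewrite /al; lra.
have al0 : 0 < al.
  by rewrite /al subr_gt0 ltf_pV2 ?posrE.
(* The exponents alpha and 2 alpha beta coincide at beta = 1/2. *)
have [hb|hb] := leP 1 (2 * beta).
  rewrite -/al mulr1.
  (* 17 (n + 1) <= 34 n, so [A * n%:R] bounds both [N] and the grid size [M]. *)
  pose A : R := (34 * C0)%:R.
  have A0 : 0 < A by rewrite ltr0n muln_gt0.
  apply: (lesssim_ge (c := A `^ (- beta - al) / 8)) => [|n n0]; first by rewrite divr_gt0 ?powR_gt0.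
  have nR : 0 < n%:R :> R by rewrite ltr0n.
  (* This [N] just violates the bound 16 (n + 1) of the case w = 1. *)
  pose N := (17 * n.+1)%N; pose M := (C0 * N)%N.
  have N0 : (0 < N)%N by rewrite muln_gt0.
  have MR : 0 < M%:R :> R by rewrite ltr0n muln_gt0 C00.
  have MA : M%:R <= A * n%:R by rewrite /A -natrM ler_nat /M /N; move: C00 n0; clear; nia.
  have NA : N%:R <= A * n%:R by rewrite /A -natrM ler_nat /N; move: C00 n0; clear; nia.
  have An : 0 < A * n%:R by rewrite mulr_gt0.
  rewrite mulrAC -powRM ?(ltW A0) //.
  apply: (width_ge (N := N)) => // [|V v sV dV hv hd]; first by rewrite divr_gt0 ?powR_gt0.
  set eps := _ * _ in hd.
  have eps0 : 0 <= eps by rewrite mulr_ge0 ?divr_ge0 ?powR_ge0.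
  have [+ _] := hC n V N eps v sV dV N0 eps0 hv hd.
  have : ~~ (N <= 16 * n.+1)%N by rewrite -ltnNge /N; clear; lia.
  move=> /negP h /(_ _)/h; apply; rewrite -/M.
  have e1 : eps <= M%:R `^ (- al) / 8.
    apply: (@le_trans _ _ ((A * n%:R) `^ (- al) / 8)).
      rewrite /eps mulrAC ler_pM2r ?invr_gt0 // powRD ?(gt_eqF An) ?implybT //.
      apply: (@le_trans _ _ ((A * n%:R) `^ (- beta) * (A * n%:R) `^ (- al) * (A * n%:R) `^ beta)).
        by rewrite ler_wpM2l ?mulr_ge0 ?powR_ge0 //; apply: powR_mono; rewrite ?(ltW b0).
      by rewrite mulrAC powRN mulVf ?mul1r // gt_eqF // powR_gt0.
    rewrite ler_pM2r ?invr_gt0 // !powRN lef_pV2 ?posrE ?powR_gt0 //.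
    by apply: powR_mono; rewrite ?(ltW al0) ?(ltW MR).
  have e2 : eps ^+ 2 <= (M%:R `^ (- al) / 8) ^+ 2.
    by rewrite ler_pXn2r ?nnegrE ?divr_ge0 ?powR_ge0.
  apply: le_trans (ler_wpM2l (powR_ge0 _ _) e2) _.
  have e3 : M%:R `^ (2 / p) = M%:R * (M%:R `^ al) ^+ 2.
    rewrite al2 powRD ?(gt_eqF MR) ?implybT // powRr1 ?(ltW MR) //; congr (_ * _).
    by rewrite mulrC powRrM powR_mulrn ?powR_ge0.
  have e4 : (0 : R) < M%:R `^ al by rewrite powR_gt0.
  rewrite e3 powRN le_eqVlt; apply/orP; left; apply/eqP; field.
  by rewrite gt_eqF.
pose A : R := 8 * 256 `^ (2 / p).
have A0 : 0 < A by apply: mulr_gt0 => //; apply: powR_gt0.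
apply: (lesssim_ge (c := A `^ (- beta) / 32)) => [|n n0]; first by rewrite divr_gt0 ?powR_gt0.
have nR : 0 < n%:R :> R by rewrite ltr0n.
have n1 : 1 <= n%:R :> R by rewrite ler1n.
(* Since 256 n >= 128 (n + 1), any N > t contradicts the Lewis weight bound; N <= 2 t keeps it of
   order n^(2/p). *)
pose t : R := 4 * (256 * n%:R) `^ (2 / p).
have p20 : 0 <= 2 / p by rewrite divr_ge0 // ltW.
have t1 : 1 <= t.
  have : 1 `^ (2 / p) <= (256 * n%:R) `^ (2 / p) by apply: powR_mono => //; lra.
  by rewrite powR1 /t; lra.
have t0 : 0 <= t by lra.
pose N := (Num.truncn t).+1.
have [tN Nt] : t < N%:R /\ N%:R <= A * n%:R `^ (2 / p).
  have /andP[h1 h2] := truncn_itv t0; split => //.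
  have -> : A * n%:R `^ (2 / p) = 2 * t by rewrite /A /t powRM //; ring.
  by rewrite /N -natr1; lra.
have expE : n%:R `^ (- beta - (p^-1 - 2^-1) * (2 * beta)) = (n%:R `^ (2 / p)) `^ (- beta).
  by rewrite -powRrM; congr (_ `^ _); rewrite al2 /al; ring.
rewrite expE mulrAC -powRM ?powR_ge0 ?(ltW A0) //.
set B := A * _ in Nt *.
have B0 : 0 < B by rewrite mulr_gt0 ?powR_gt0.
apply: (width_ge (N := N)) => // [|V v sV dV hv hd]; first by rewrite divr_gt0 ?powR_gt0.
set eps := _ * _ in hd.
have eps0 : 0 <= eps by rewrite mulr_ge0 ?divr_ge0 ?powR_ge0.
have [_] := hC n V N eps v sV dV (ltn0Sn _) eps0 hv hd.
have eps32 : eps <= 32^-1.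
  rewrite /eps mulrAC -[leRHS]mul1r ler_pM2r ?invr_gt0 //.
  apply: (@le_trans _ _ (B `^ (- beta) * B `^ beta)).
    by rewrite ler_wpM2l ?powR_ge0 //; apply: powR_mono; rewrite ?(ltW b0).
  by rewrite powRN mulVf // gt_eqF // powR_gt0.
move=> /(_ eps32); apply/negP; rewrite -ltNge; apply: le_lt_trans tN.
rewrite /t ler_pM2l //; apply: powR_mono => //; rewrite ?mulr_ge0 //.
by rewrite -natr1; lra.
Qed.

End WidthLower.

Theorem corollary1p9 (R : realType) (p : R) (hp1 : 1 <= p) (hp2 : p < 2) :
  (forall beta : R, 0 < beta ->
     exists B b : R, [/\ 0 < B, 0 < b & wiener_width_bounds p beta B b]) /\
  (exists c : R, 0 < c /\
     forall beta : R, 0 < beta ->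
       wiener_width_bounds p beta
         ((p^-1 - 2^-1) * Num.min 1 (2 * beta)) (c * Num.min 1 beta)).
Proof.
have [c c0 up] := width_upper hp1 hp2.
have bounds beta : 0 < beta -> wiener_width_bounds p beta
    ((p^-1 - 2^-1) * Num.min 1 (2 * beta)) (c * Num.min 1 beta).
  by move=> b0; split; [exact: width_lower | exact: up].
split; last by exists c.
move=> beta b0; exists ((p^-1 - 2^-1) * Num.min 1 (2 * beta)), (c * Num.min 1 beta).
have p0 : 0 < p := lt_le_trans ltr01 hp1.
split; last exact: bounds.
- by rewrite mulr_gt0 ?lt_min ?ltr01 ?mulr_gt0 // subr_gt0 ltf_pV2 ?posrE.
- by rewrite mulr_gt0 // lt_min ltr01.
Qed.
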